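(* Let $0<\alpha,\beta<1$, let $\mathbf L_{\min}$ be the minimal operator that acts via the Jacobi expression $$\ell_{\alpha,\beta}[f](x)=-\frac{1}{(1-x)^\alpha(1+x)^\beta}\big[(1-x)^{\alpha+1}(1+x)^{\beta+1}f'(x)\big]'$$ in $L^2[(-1,1),(1-x)^\alpha(1+x)^\beta]$, let $\Theta$ be a self-adjoint linear relation in $\mathbb C^2$, and let $\boldsymbol A_0$, $\mathbf B$, $\Gamma_0$, $\Gamma_1$ be as in the context. Define $\boldsymbol A_\Theta$ as the singular rank-two perturbation $$\boldsymbol A_\Theta:=\boldsymbol A_0+\mathbf B\Theta\mathbf B^*,$$ interpreted in terms of semi-bounded forms as in the context. Then every self-adjoint extension of $\mathbf L_{\min}$ can be written as $\boldsymbol A_\Theta$ for some $\Theta$. In particular, $$\operatorname{dom}(\boldsymbol A_\Theta)=\big\{f\in\mathcal D_{\max}^{(\alpha,\beta)}:\{\Gamma_0f,\Gamma_1f\}\in\Theta\big\}.$$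
   Context: **Operators.** Write $p(x)=(1-x)^{\alpha+1}(1+x)^{\beta+1}$ and $\mathcal H=L^2_{\alpha,\beta}(-1,1)=L^2[(-1,1),(1-x)^\alpha(1+x)^\beta]$. The maximal domain is $\mathcal D_{\max}^{(\alpha,\beta)}=\{f\in\mathcal H: f,f'\in AC_{loc}(-1,1),\ \ell_{\alpha,\beta}[f]\in\mathcal H\}$; $\mathbf L_{\max}$ acts by $\ell_{\alpha,\beta}$ on it, and $\mathbf L_{\min}=\mathbf L_{\max}^*$ (deficiency indices $(2,2)$). **Boundary maps.** For $f\in\mathcal D_{\max}^{(\alpha,\beta)}$ put $$f^{[0]}(-1)=\lim_{x\to-1^+}-p(x)f'(x),\qquad f^{[0]}(1)=\lim_{x\to1^-}p(x)f'(x),$$ $$f^{[1]}(-1)=\lim_{x\to-1^+}\Big(-f(x)-\tfrac{(1+x)f'(x)}{\beta}\Big),\qquad f^{[1]}(1)=\lim_{x\to1^-}\Big(f(x)-\tfrac{(1-x)f'(x)}{\alpha}\Big),$$ and $\Gamma_0f=(f^{[0]}(-1),f^{[0]}(1))^\top$, $\Gamma_1f=(f^{[1]}(-1),-f^{[1]}(1))^\top$. $\boldsymbol A_0$ is the self-adjoint extension of $\mathbf L_{\min}$ with $\operatorname{dom}\boldsymbol A_0=\{f\in\mathcal D_{\max}^{(\alpha,\beta)}:f^{[1]}(-1)=f^{[1]}(1)=0\}$. **Form domain.** With $F={}_2F_1$ the Gauss hypergeometric function, let $\widetilde w_{2(1)}(x)=\frac{((1-x)/2)^{-\alpha}}{\alpha2^{\alpha+\beta+1}}F(-\alpha,\beta+1;1-\alpha;\frac{1-x}2)$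 near $x=1$ and $\widetilde w_{2(-1)}(x)=\frac{((1+x)/2)^{-\beta}}{\beta2^{\alpha+\beta+1}}F(-\beta,\alpha+1;1-\beta;\frac{1+x}2)$ near $x=-1$ (solutions of $\ell_{\alpha,\beta}[f]=0$), and for a function $\varphi$ let $N_\varphi f=\sqrt p\,\varphi\,(f/\varphi)'$. Let $$\mathfrak D=\{f\in\mathcal H: f\in AC(-1,1),\ \sqrt pf'\in L^2(-\tfrac34,\tfrac34),\ N_{\widetilde w_{2(-1)}}f\in L^2(-1,-\tfrac34),\ N_{\widetilde w_{2(1)}}f\in L^2(\tfrac34,1)\},$$ and let $\mathfrak t$, with domain $\mathfrak D$, be the closed semi-bounded form associated with $\boldsymbol A_0$. **The maps $\Lambda$, $\mathbf B$.** The mapping $\Gamma_0$ is extended to $\mathfrak D$ as $$\Lambda f=\begin{pmatrix}\lim_{x\to-1^+}-p(x)f'(x)\\ \lim_{x\to1^-}p(x)f'(x)\end{pmatrix},\qquad f\in\mathfrak D,$$ and weighted distributions $\widetilde\delta_{-1},\widetilde\delta_1\in\mathcal H_{-1}(\boldsymbol A_0)$ are defined on $\mathfrak D$ by $\langle f,\widetilde\delta_{-1}\rangle=\lim_{x\to-1^+}-p(x)f'(x)$ and $\langle f,\widetilde\delta_1\rangle=\lim_{x\to1^-}p(x)f'(x)$. Here $\mathcal H_1(\boldsymbol A_0)$ is the space of $\varphi\in\mathcal H$ with $\|(|\boldsymbol A_0|+I)^{1/2}\varphi\|<\infty$, and $\mathcal H_{-1}(\boldsymbol A_0)$ is its dual.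 $\mathbf B:\mathbb C^2\to\operatorname{ran}\mathbf B\subset\mathcal H_{-1}(\boldsymbol A_0)$ is multiplication by the row vector $(\widetilde\delta_{-1},\widetilde\delta_1)$, and $\mathbf B^*f=(\langle f,\widetilde\delta_{-1}\rangle,\langle f,\widetilde\delta_1\rangle)^\top$, with $f$ restricted to $\mathcal H_1(\boldsymbol A_0)$. **Meaning of the perturbation.** A self-adjoint linear relation $\Theta$ in $\mathbb C^2$ is a linear subspace of $\mathbb C^2\times\mathbb C^2$ equal to its adjoint; $\operatorname{mul}\Theta=\{h':\{0,h'\}\in\Theta\}$, and $\Theta=\Theta_{op}\,\widehat\oplus\,(\{0\}\times\operatorname{mul}\Theta)$ with $\Theta_{op}$ a self-adjoint operator on $(\operatorname{mul}\Theta)^\perp$. The perturbation is interpreted through the closed semi-bounded form $\mathfrak t_\Theta$ with $\langle\boldsymbol A_\Theta f,g\rangle=\mathfrak t_\Theta[f,g]$ for $f\in\operatorname{dom}\boldsymbol A_\Theta$, $g\in\operatorname{dom}\mathfrak t_\Theta$: (i) if $\Theta$ is a Hermitian matrix, $\mathfrak t_\Theta[f,g]=\mathfrak t[f,g]+\langle\Theta\Lambda f,\Lambda g\rangle$ on $\mathfrak D$; (ii) if $\dim\operatorname{dom}\Theta_{op}=1$, $\mathfrak t_\Theta[f,g]=\mathfrak t[f,g]+\langle\Theta_{op}\Lambda f,\Lambda g\rangle$ on $\{h\in\mathfrak D:\Lambda h\in\operatorname{dom}\Theta_{op}\}$; (iii) if $\Theta=\{0\}\times\mathbb C^2$, $\mathfrak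 t_\Theta=\mathfrak t$ on $\{h\in\mathfrak D:\Lambda h=0\}$.
   Formalization: The sign of Γ_1 is reversed, Γ_1 f = (-f^{[1]}(-1), f^{[1]}(1))^T, since the printed sign contradicts Green's identity; the cut points ±3/4 in 𝔇 become arbitrary -1<a<b<1; the limits defining Λ on 𝔇 are approximate limits, as ordinary ones need not exist. *)

(* Defs.v *)
From HB Require Import structures.
From mathcomp Require Import all_boot all_order all_algebra.
From mathcomp Require Import all_classical all_reals all_analysis.
From mathcomp Require Import complex.

Set Implicit Arguments.
Unset Strict Implicit.
Unset Printing Implicit Defensive.

Import Order.TTheory GRing.Theory Num.Theory.
Import numFieldNormedType.Exports.

Local Open Scope classical_set_scope.
Local Open Scope ring_scope.
Local Open Scope complex_scope.

Local Notation Re := (@complex.Re _).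
Local Notation Im := (@complex.Im _).

(* Complex-valued functions of a real variable.  Limits, derivatives, integrals
   and absolute continuity are taken on real and imaginary parts. *)

Section ComplexValued.
Variable R : realType.
Implicit Types (f g : R -> R[i]) (D : set R).

Definition sqnormc (z : R[i]) : R := Re z ^+ 2 + Im z ^+ 2.

Definition clim (F : set_system R) f : R[i] :=
  lim (Re (f x) @[x --> F]) +i* lim (Im (f x) @[x --> F]).

Definition cderiv f (x : R) : R[i] :=
  derive1 (Re \o f) x +i* derive1 (Im \o f) x.

Definition cintegral D f : R[i] :=
  Rintegral lebesgue_measure D (Re \o f)
  +i* Rintegral lebesgue_measure D (Im \o f).

Definition abs_cont (c d : R) (u : R -> R) : Prop :=
  forall e : R, 0 < e -> exists2 delta : R, 0 < delta &
  forall (n : nat) (l r : 'I_n -> R),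
    (forall i, [/\ c <= l i, l i <= r i & r i <= d]) ->
    (forall i j, i != j -> r i <= l j \/ r j <= l i) ->
    \sum_(i < n) (r i - l i) < delta ->
    \sum_(i < n) `|u (r i) - u (l i)| < e.

Definition AC_loc f : Prop :=
  forall c d : R, -1 < c -> c < d -> d < 1 ->
    abs_cont c d (Re \o f) /\ abs_cont c d (Im \o f).

Definition sq_integrable D (rho : R -> R) f : Prop :=
  [/\ measurable_fun D (Re \o f), measurable_fun D (Im \o f) &
      (\int[lebesgue_measure]_(x in D) (sqnormc (f x) * rho x)%:E < +oo)%E].

Definition ae_eq_on D f g : Prop :=
  {ae lebesgue_measure, forall x : R, D x -> f x = g x}.

(* Membership in L^2(D, rho dx) of a function that is only defined a.e., such as
   the derivative of an absolutely continuous function. *)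
Definition ae_sq_integrable D (rho : R -> R) f : Prop :=
  exists2 h, sq_integrable D rho h & ae_eq_on D f h.

(* Approximate limits: l is the approximate limit of f at x0 from the right if
   every set {|f - l| >= e} has right density 0 at x0. *)
Definition off_limit f (l : R[i]) (e : R) : set R :=
  [set y | e ^+ 2 <= sqnormc (f y - l)].

Definition ap_cvg_right f (x0 : R) (l : R[i]) : Prop :=
  forall e : R, 0 < e ->
    fine (lebesgue_measure (`]x0, x0 + h[ `&` off_limit f l e)) / h
      @[h --> 0^'+] --> (0 : R).

Definition ap_cvg_left f (x0 : R) (l : R[i]) : Prop :=
  forall e : R, 0 < e ->
    fine (lebesgue_measure (`]x0 - h, x0[ `&` off_limit f l e)) / h
      @[h --> 0^'+] --> (0 : R).

Definition ap_lim_right f x0 : R[i] := xget 0 [set l | ap_cvg_right f x0 l].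
Definition ap_lim_left f x0 : R[i] := xget 0 [set l | ap_cvg_left f x0 l].

End ComplexValued.

(* The Hilbert space H = L^2((-1,1), (1-x)^alpha (1+x)^beta dx).  Its elements are
   represented by Borel functions R -> R[i]; equality in H is eqH, and values
   outside (-1,1) are irrelevant.  Operators and relations in H are given by their
   graphs. *)

Section HilbertSpace.
Variables (R : realType) (alpha beta : R).
Local Notation func := (R -> R[i]).
Implicit Types (f g h k : func) (S T : func -> func -> Prop).

Definition weight (x : R) : R := (1 - x) `^ alpha * (1 + x) `^ beta.

Definition inH f : Prop := sq_integrable `]-1, 1[ weight f.

Definition eqH f g : Prop := ae_eq_on `]-1, 1[ f g.

Definition ip f g : R[i] :=
  cintegral `]-1, 1[ (fun x => f x * (g x)^* * (weight x)%:C).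

Definition sqnormH f : R := Re (ip f f).

(* The elements of H that have a representative in D. *)
Definition classesH (D : set func) : set func :=
  [set f | inH f /\ exists2 f0, D f0 & eqH f f0].

Definition dom T : set func := [set f | exists h, T f h].

Definition adjoint T : func -> func -> Prop := fun g k =>
  [/\ inH g, inH k & forall f h, T f h -> ip h g = ip f k].

(* For a relation equal to its adjoint, being single-valued is the same as having
   a dense domain. *)
Definition selfadjoint_operator S : Prop :=
  [/\ forall f h f' h' (c : R[i]), S f h -> S f' h' ->
        S (fun x => f x + c * f' x) (fun x => h x + c * h' x),
      forall f h h', S f h -> S f h' -> eqH h h' &
      forall f h, S f h <-> adjoint S f h].

Definition selfadjoint_extension T S : Prop :=
  selfadjoint_operator S /\ forall f h, T f h -> S f h.

(* Closed semi-bounded Hermitian forms t with domain D. *)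
Definition closed_semibounded_form (D : set func) (t : func -> func -> R[i]) :
    Prop :=
  (forall f, D f -> inH f) /\
  (forall f g (c : R[i]), D f -> D g -> D (fun x => f x + c * g x)) /\
  (forall f g k (c : R[i]), D f -> D g -> D k ->
     t (fun x => f x + c * g x) k = t f k + c * t g k) /\
  (forall f g, D f -> D g -> t g f = (t f g)^*) /\
  (exists m : R, forall f, D f -> m * sqnormH f <= Re (t f f)) /\
  (forall (u : nat -> func) f, (forall n, D (u n)) -> inH f ->
     sqnormH (u n \- f) @[n --> \oo] --> 0 ->
     (forall e : R, 0 < e -> exists N : nat, forall m n : nat,
        (N <= m)%N -> (N <= n)%N ->
        `|Re (t (u m \- u n) (u m \- u n))| < e) ->
     exists f0, [/\ D f0, eqH f f0 &
       Re (t (u n \- f0) (u n \- f0)) @[n --> \oo] --> 0]).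

(* t, with domain D, is the closed semi-bounded form associated with the
   self-adjoint operator A: the closure of the form <A f, g>, f, g in dom A. *)
Definition associated_form A (D : set func) (t : func -> func -> R[i]) : Prop :=
  [/\ closed_semibounded_form D t,
      dom A `<=` classesH D,
      forall f h g, A f h -> D f -> D g -> t f g = ip h g &
      forall f, D f -> exists u : nat -> func,
        [/\ forall n, D (u n) /\ dom A (u n),
            sqnormH (u n \- f) @[n --> \oo] --> 0 &
            Re (t (u n \- f) (u n \- f)) @[n --> \oo] --> 0]].

(* The operator A represented by the form t with domain D:
   <A f, g> = t[f, g] for f in dom A, g in D. *)
Definition operator_of_form (D : set func) (t : func -> func -> R[i]) :
    func -> func -> Prop := fun f h =>
  [/\ inH f, inH h & exists f0, [/\ D f0, eqH f f0 &
    forall g, D g -> t f0 g = ip h g]].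

End HilbertSpace.

Section LinearRelations.
Variable R : realType.
Local Notation C2 := 'cV[R[i]]_2.
Implicit Type Theta : set (C2 * C2).

Definition col2 (a b : R[i]) : C2 := \col_(i < 2) (if i == 0 then a else b).

Definition dot2 (u v : C2) : R[i] := \sum_(i < 2) u i 0 * (v i 0)^*.

Definition linear_relation Theta : Prop :=
  Theta (0, 0) /\
  forall (c : R[i]) (p q : C2 * C2), Theta p -> Theta q ->
    Theta (p.1 + c *: q.1, p.2 + c *: q.2).

Definition adjoint_relation Theta : set (C2 * C2) :=
  [set k | forall h, Theta h -> dot2 h.2 k.1 = dot2 h.1 k.2].

Definition selfadjoint_relation Theta : Prop :=
  linear_relation Theta /\ Theta = adjoint_relation Theta.

Definition mul_part Theta : set C2 := [set h' | Theta (0, h')].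

Definition op_part Theta : set (C2 * C2) :=
  [set h | Theta h /\ forall m, mul_part Theta m -> dot2 h.2 m = 0].

Definition op_dom Theta : set C2 :=
  [set u | exists v, op_part Theta (u, v)].

(* The operator Theta_op; the value is 0 off op_dom Theta. *)
Definition op_apply Theta (u : C2) : C2 :=
  xget 0 [set v | op_part Theta (u, v)].

End LinearRelations.

Section Jacobi.
Variables (R : realType) (alpha beta : R).
Local Notation func := (R -> R[i]).
Local Notation weight := (weight alpha beta).
Local Notation inH := (inH alpha beta).
Local Notation eqH := (@eqH R).
Implicit Types (f g h : func).

Definition pJ (x : R) : R := (1 - x) `^ (alpha + 1) * (1 + x) `^ (beta + 1).

Definition pderiv f : func := fun x => (pJ x)%:C * cderiv f x.

Definition ell f : func := fun x => - ((weight x)^-1)%:C * cderiv (pderiv f) x.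

Definition Dmax : set func :=
  [set f | [/\ inH f, AC_loc f, AC_loc (cderiv f) &
               ae_sq_integrable `]-1, 1[ weight (ell f)]].

Definition Lmax_on (D : set func) : func -> func -> Prop := fun f h =>
  [/\ inH f, inH h & exists f0, [/\ Dmax f0, D f0, eqH f f0 & eqH h (ell f0)]].

Definition Lmax : func -> func -> Prop := Lmax_on setT.

Definition Lmin : func -> func -> Prop := adjoint alpha beta Lmax.

Definition f0_left f : R[i] := clim (-1)^'+ (fun x => - pderiv f x).
Definition f0_right f : R[i] := clim 1^'- (pderiv f).
Definition f1_left f : R[i] :=
  clim (-1)^'+ (fun x => - f x - ((1 + x) / beta)%:C * cderiv f x).
Definition f1_right f : R[i] :=
  clim 1^'- (fun x => f x - ((1 - x) / alpha)%:C * cderiv f x).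

Definition Gamma0 f : 'cV[R[i]]_2 := col2 (f0_left f) (f0_right f).

(* The overall sign is the one for which (Gamma0, Gamma1) satisfies the Green
   identity of a boundary triple,
     <Lmax f, g> - <f, Lmax g> = <Gamma1 f, Gamma0 g> - <Gamma0 f, Gamma1 g>.
   With the opposite sign (f1_left f, - f1_right f)^T the right-hand side changes
   sign, and the operator represented by t + <Theta Lambda ., Lambda .> has
   boundary condition {Gamma0 f, - Gamma1 f} in Theta. *)
Definition Gamma1 f : 'cV[R[i]]_2 := col2 (- f1_left f) (f1_right f).

Definition A0 : func -> func -> Prop :=
  Lmax_on [set f | f1_left f = 0 /\ f1_right f = 0].

Definition pochhammer (a : R) (n : nat) : R := \prod_(i < n) (a + i%:R).

(* Gauss' hypergeometric function for |z| < 1. *)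
Definition hyp2F1 (a b c z : R) : R :=
  limn (series (fun n => pochhammer a n * pochhammer b n
                         / (pochhammer c n * n`!%:R) * z ^+ n)).

Definition w2_right (x : R) : R :=
  ((1 - x) / 2) `^ (- alpha) / (alpha * 2 `^ (alpha + beta + 1))
  * hyp2F1 (- alpha) (beta + 1) (1 - alpha) ((1 - x) / 2).

Definition w2_left (x : R) : R :=
  ((1 + x) / 2) `^ (- beta) / (beta * 2 `^ (alpha + beta + 1))
  * hyp2F1 (- beta) (alpha + 1) (1 - beta) ((1 + x) / 2).

Definition Nop (phi : R -> R) f : func := fun x =>
  (Num.sqrt (pJ x) * phi x)%:C * cderiv (fun y => f y / (phi y)%:C) x.

(* The form domain, with (-1, a) and (b, 1) as the neighbourhoods of the endpoints
   on which w2_left and w2_right are used.  The choice -a = b = 3/4 is adequate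
   only if neither solution vanishes there, which fails for instance for w2_left
   when beta is close to 1 (its zero tends to -1); the domain does not depend on
   a and b as long as w2_left has no zero in (-1, a] and w2_right none in [b, 1). *)
Definition formdom (a b : R) : set func :=
  [set f | [/\ inH f, AC_loc f,
     ae_sq_integrable `]a, b[ (fun=> 1)
       (fun x => (Num.sqrt (pJ x))%:C * cderiv f x),
     ae_sq_integrable `]-1, a[ (fun=> 1) (Nop w2_left f) &
     ae_sq_integrable `]b, 1[ (fun=> 1) (Nop w2_right f)]].

(* The functionals delta_{-1}, delta_1 extending the components of Gamma0 to the
   form domain.  There f' is an a.e. defined function and p f' need not have an
   ordinary limit at the endpoints (near 1 it equals a convergent function plus
   sqrt p times an arbitrary function in L^2), so the limits are approximate
   limits; these agree with the ordinary ones whenever the latter exist. *)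
Definition delta_left f : R[i] := ap_lim_right (fun x => - pderiv f x) (-1).
Definition delta_right f : R[i] := ap_lim_left (pderiv f) 1.

(* Lambda, which is also B^*. *)
Definition Lambda f : 'cV[R[i]]_2 := col2 (delta_left f) (delta_right f).

(* B c = c_0 delta_{-1} + c_1 delta_1, as a conjugate-linear functional of g:
   <B c, g> = <c, B^* g>. *)
Definition Bmul (c : 'cV[R[i]]_2) (g : func) : R[i] :=
  c 0 0 * (delta_left g)^* + c 1 0 * (delta_right g)^*.

(* The form of A_0 + B Theta B^*, where <B Theta_op B^* f, g> is
   <Theta_op Lambda f, Lambda g>.  For a Hermitian matrix Theta the domain is all
   of D, and for Theta = {0} x C^2 it is the kernel of Lambda, with t unchanged. *)
Definition dom_tTheta (D : set func) (Theta : set ('cV[R[i]]_2 * 'cV[R[i]]_2)) :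
    set func :=
  [set h | D h /\ op_dom Theta (Lambda h)].

Definition tTheta (t : func -> func -> R[i])
    (Theta : set ('cV[R[i]]_2 * 'cV[R[i]]_2)) : func -> func -> R[i] :=
  fun f g => t f g + Bmul (op_apply Theta (Lambda f)) g.

Definition ATheta (D : set func) (t : func -> func -> R[i])
    (Theta : set ('cV[R[i]]_2 * 'cV[R[i]]_2)) : func -> func -> Prop :=
  operator_of_form alpha beta (dom_tTheta D Theta) (tTheta t Theta).

End Jacobi.

(* Main.v *)
(* Let w be the weight, phi = 1 / w and s = alpha + beta.  Since (ell + s) phi = 0,
   the substitution f = phi z turns (ell + s) f = h into y' = h, z' = - r y with
   r = w / (1 - x^2), a regular system: h and r are integrable.  So every f in Dmax
   is phi z with z and y continuous up to the endpoints, Gamma0 f and Gamma1 f are,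
   up to constants, the endpoint values of z and of y, and
     <(ell + s) f, g> = <Gamma1 f, Gamma0 g> + int r y_f (y_g)^*.
   This yields Green's identity, the surjectivity of (Gamma0, Gamma1) and, by testing
   against functions with vanishing boundary values, Lmin^* = Lmax.  Hence the
   self-adjoint extensions of Lmin are the restrictions L_Theta of Lmax given by
   {Gamma0 f, Gamma1 f} in Theta.

   On dom A0 the form t[f] + s |f|^2 is int r |y|^2, so the elements of its closure are
   the phi z with z' = - r eta, eta in L^2(r).  For them p f' is a function continuous up to
   the endpoints minus w eta, which has approximate limit 0 there; therefore Lambda is
   continuous for the norm of t, and t[f, g] = <ell f, g> - <Gamma1 f, Lambda g> for f in
   Dmax, by approximating g from dom A0.  It follows that A_Theta extends L_Theta.  As A_Theta
   is symmetric and L_Theta self-adjoint, they coincide. *)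

(* The choice phi = 1 / w works because p phi' = alpha (1 + x) - beta (1 - x) is affine, so that (p
   phi')' = alpha + beta = (alpha + beta) w phi; this is the origin of the shift s. As phi blows up
   like (1 - x)^(-alpha) and (1 + x)^(-beta), it is dominant at both endpoints, and a single
   substitution regularizes both. The bounds alpha, beta < 1 make 1 / w integrable, hence L^2(w) a
   part of L^1, and alpha, beta > 0 make r integrable. Two obstacles shape the proof. Absolute
   continuity is the epsilon-delta condition, and the system can be integrated only once such a
   function is known to be the primitive of an integrable density. The form is given only as the
   closure of the form of A_0, so that its domain contains a representative of every element of Dmax
   has to be drawn from closedness, by exhibiting limits of elements of dom A_0. Moreover elements
   of H are classes, while Gamma0, Gamma1 and Lambda read a representative; representatives are
   therefore compared pointwise on (-1, 1) through continuity. *)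
Require Import Defs.
From mathcomp Require Import all_boot all_order all_algebra.
From mathcomp Require Import all_classical all_reals all_analysis.
From mathcomp Require Import measurable_realfun.
From mathcomp Require Import complex.
From mathcomp Require Import ring lra.

Set Implicit Arguments.
Unset Strict Implicit.
Unset Printing Implicit Defensive.

Import Order.TTheory GRing.Theory Num.Theory.
Import numFieldNormedType.Exports.

Local Open Scope classical_set_scope.
Local Open Scope ring_scope.

(* Keeps conversion from unfolding real powers down to limits of series. *)
Local Opaque powR.

(** * Integrable functions and absolute continuity *)

Section Integrable.
Variable R : realType.
Notation mu := (@lebesgue_measure R).
Implicit Types (D : set R) (f g : R -> R).

Lemma aeS (P Q : R -> Prop) : (forall x, P x -> Q x) ->
  {ae mu, forall x, P x} -> {ae mu, forall x, Q x}.
Proof. by move=> PQ; apply: filterS => //; exact: (ae_filter_ringOfSetsType mu). Qed.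

Lemma aeI (P Q : R -> Prop) : {ae mu, forall x, P x} -> {ae mu, forall x, Q x} ->
  {ae mu, forall x, P x /\ Q x}.
Proof. by move=> HP HQ; apply: filterI => //; exact: (ae_filter_ringOfSetsType mu). Qed.

Definition L1 D f : Prop := mu.-integrable D (EFin \o f).

Lemma L1_eq D f g : measurable D -> (forall x, D x -> f x = g x) -> L1 D f -> L1 D g.
Proof.
move=> mD fg; rewrite /L1; apply: (@eq_integrable _ _ _ mu D mD) => x /set_mem Dx.
by rewrite /= fg.
Qed.

Lemma L1D D f g : measurable D -> L1 D f -> L1 D g -> L1 D (fun x => f x + g x).
Proof. by move=> mD If Ig; have := @integrableD _ _ _ mu D mD _ _ If Ig. Qed.

Lemma L1B D f g : measurable D -> L1 D f -> L1 D g -> L1 D (fun x => f x - g x).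
Proof. by move=> mD If Ig; have := @integrableB _ _ _ mu D mD _ _ If Ig. Qed.

Lemma L1Z D (c : R) f : measurable D -> L1 D f -> L1 D (fun x => c * f x).
Proof. by move=> mD If; have := @integrableZl _ _ _ mu D mD c _ If. Qed.

Lemma L1_meas D f : L1 D f -> measurable_fun D f.
Proof. by move=> /measurable_int/measurable_EFinP. Qed.

Lemma L1_le D g f : measurable D -> measurable_fun D f ->
  (forall x, D x -> `|f x| <= g x) -> L1 D g -> L1 D f.
Proof.
move=> mD mf fg Ig; apply: (@le_integrable _ _ _ mu D mD _ (EFin \o g)) => //.
  exact/measurable_EFinP.
by move=> x Dx /=; rewrite lee_fin (le_trans (fg _ Dx))// ler_norm.
Qed.

Lemma L1_norm D f : measurable D -> L1 D f -> L1 D (fun x => `|f x|).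
Proof. by move=> mD If; exact: (@integrable_norm _ _ _ mu D). Qed.

Lemma L1_sub A B f : measurable A -> measurable B -> B `<=` A -> L1 A f -> L1 B f.
Proof. by move=> mA mB BA; exact: (@integrableS _ _ _ mu A B). Qed.

Lemma L1_ge0P D f : measurable D -> measurable_fun D f ->
  (forall x, D x -> 0 <= f x) ->
  (\int[mu]_(x in D) (f x)%:E < +oo)%E -> L1 D f.
Proof.
move=> mD mf f0 fi; apply/integrableP; split; first exact/measurable_EFinP.
by under eq_integral => x /set_mem Dx do rewrite /= ger0_norm ?f0//.
Qed.

Lemma L1_normP D f : measurable D -> measurable_fun D f ->
  (\int[mu]_(x in D) `|f x|%:E < +oo)%E -> L1 D f.
Proof. by move=> mD mf fi; apply/integrableP; split; first exact/measurable_EFinP. Qed.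

Lemma L1_EFin D f : measurable D -> L1 D f ->
  (\int[mu]_(x in D) (f x)%:E = (\int[mu]_(x in D) f x)%R%:E)%E.
Proof. by move=> mD If; rewrite /Rintegral fineK//; exact: (@integrable_fin_num _ _ _ mu D mD _ If). Qed.

Lemma L1_lty D f : measurable D -> L1 D f -> (\int[mu]_(x in D) (f x)%:E < +oo)%E.
Proof. by move=> mD If; rewrite L1_EFin// ltry. Qed.

Lemma L1U A B f : measurable A -> measurable B -> L1 A f -> L1 B f -> L1 (A `|` B) f.
Proof.
move=> mA mB IA IB; rewrite /L1.
have mAB := measurableU _ _ mA mB.
have mf : measurable_fun (A `|` B) f by apply/measurable_funU => //; split; exact: L1_meas.
have -> : A `|` B = A `|` (B `\` A) by rewrite setDE setUIr setUv setIT.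
have mBA : measurable (B `\` A) by exact: measurableD.
apply: L1_normP => //.
- by exact: measurableU.
- by apply: measurable_funS mf => //; exact: setUS.
rewrite ge0_integral_setU//=.
- apply: lte_add_pinfty; first exact: L1_lty (L1_norm _ _).
  by apply: L1_lty => //; apply: L1_norm => //; apply: L1_sub IB.
- apply/measurable_EFinP; apply: measurableT_comp => //.
  by apply: measurable_funS mf => //; exact: setUS.
- by apply/disj_setPS => x [Ax [_ /(_ Ax)]].
Qed.

Lemma IntD D f g : measurable D -> L1 D f -> L1 D g ->
  \int[mu]_(x in D) (f x + g x) = \int[mu]_(x in D) f x + \int[mu]_(x in D) g x.
Proof. exact: (@RintegralD _ _ _ mu D). Qed.

Lemma IntB D f g : measurable D -> L1 D f -> L1 D g ->
  \int[mu]_(x in D) (f x - g x) = \int[mu]_(x in D) f x - \int[mu]_(x in D) g x.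
Proof. exact: (@RintegralB _ _ _ mu D). Qed.

Lemma IntZ D c f : measurable D -> L1 D f ->
  \int[mu]_(x in D) (c * f x) = c * \int[mu]_(x in D) f x.
Proof. by move=> mD If; exact: (@RintegralZl _ _ _ mu D). Qed.

Lemma Int_ge0 D f : (forall x, D x -> 0 <= f x) -> 0 <= \int[mu]_(x in D) f x.
Proof. exact: (@Rintegral_ge0 _ _ _ mu D). Qed.

Lemma Int_le D f g : measurable D -> L1 D f -> L1 D g -> (forall x, D x -> f x <= g x) ->
  \int[mu]_(x in D) f x <= \int[mu]_(x in D) g x.
Proof. exact: (@le_Rintegral _ _ _ mu D). Qed.

Lemma Int_norm D f : measurable D -> L1 D f ->
  `|\int[mu]_(x in D) f x| <= \int[mu]_(x in D) `|f x|.
Proof. exact: (@le_normr_Rintegral _ _ _ mu D). Qed.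

Lemma Int_eq D f g : (forall x, D x -> f x = g x) ->
  \int[mu]_(x in D) f x = \int[mu]_(x in D) g x.
Proof. by move=> fg; apply: (@eq_Rintegral _ _ _ mu D) => x /set_mem; exact: fg. Qed.

Lemma Int_subset A B f : measurable A -> measurable B -> A `<=` B -> L1 B f ->
  (forall x, B x -> 0 <= f x) ->
  \int[mu]_(x in A) f x <= \int[mu]_(x in B) f x.
Proof.
move=> mA mB AB IB f0.
have IA : L1 A f by exact: L1_sub IB.
rewrite -lee_fin -!L1_EFin//; apply: ge0_subset_integral => //.
exact: measurable_int IB.
Qed.

Lemma Int_ae_eq D f g : measurable D -> L1 D f -> measurable_fun D g ->
  {ae mu, forall x, D x -> f x = g x} ->
  \int[mu]_(x in D) f x = \int[mu]_(x in D) g x.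
Proof.
move=> mD If mg fg; rewrite /Rintegral; congr fine.
apply: ae_eq_integral => //.
- exact: measurable_int If.
- exact/measurable_EFinP.
- by apply: aeS fg => x /= h Dx; rewrite h.
Qed.

Lemma L1_ae_eq D f g : measurable D -> L1 D f -> measurable_fun D g ->
  {ae mu, forall x, D x -> f x = g x} -> L1 D g.
Proof.
move=> mD If mg fg; apply: L1_normP => //.
rewrite -(_ : (\int[mu]_(x in D) `|f x|%:E = \int[mu]_(x in D) `|g x|%:E)%E).
  exact: L1_lty (L1_norm _ _).
apply: ae_eq_integral => //.
- by apply/measurable_EFinP/measurableT_comp => //; exact: L1_meas.
- exact/measurable_EFinP/measurableT_comp.
- by apply: aeS fg => x /= h Dx; rewrite h.
Qed.

Lemma Int_eq0_ae D f : measurable D -> L1 D f -> (forall x, D x -> 0 <= f x) ->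
  \int[mu]_(x in D) f x = 0 -> {ae mu, forall x, D x -> f x = 0}.
Proof.
move=> mD If f0 I0.
have mf : measurable_fun D (EFin \o f) by exact: measurable_int If.
have /(@ae_eq_integral_abs _ _ _ mu _ mD _ mf) : (\int[mu]_(x in D) `|(EFin \o f) x| = 0)%E.
  rewrite (_ : (\int[mu]_(x in D) `|(EFin \o f) x|)%E = \int[mu]_(x in D) (f x)%:E)%E.
    by rewrite L1_EFin// I0.
  by apply: eq_integral => x /set_mem Dx /=; rewrite ger0_norm// f0.
by apply: aeS => x /= h Dx; have := h Dx => -[].
Qed.

Lemma L1_bounded D f (M : R) : measurable D -> (mu D < +oo)%E -> measurable_fun D f ->
  (forall x, D x -> `|f x| <= M) -> L1 D f.
Proof.
move=> mD fD mf fM; apply: (@L1_le _ (fun=> M)) => //.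
apply/integrableP; split; first exact/measurable_EFinP.
by rewrite integral_cst//= lte_mul_pinfty.
Qed.

End Integrable.

(** * Completeness of L^1 *)

Section L1Complete.
Variable R : realType.
Notation mu := (@lebesgue_measure R).
Variables (D : set R) (mD : measurable D) (v : nat -> R -> R).
Hypothesis Iv : forall n, L1 D (v n).
Hypothesis vC : forall e, 0 < e -> exists N, forall m n, (N <= m)%N -> (N <= n)%N ->
  \int[mu]_(x in D) `|v m x - v n x| < e.

Lemma fast_subsequence : exists sg : nat -> nat,
  [/\ forall k, (k <= sg k)%N, {homo sg : i j / (i <= j)%N} &
   forall k m n, (sg k <= m)%N -> (sg k <= n)%N ->
     \int[mu]_(x in D) `|v m x - v n x| < 2^-1 ^+ k].
Proof.
have /choice[N HN] : forall k, exists N, forall m n, (N <= m)%N -> (N <= n)%N ->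
    \int[mu]_(x in D) `|v m x - v n x| < 2^-1 ^+ k.
  by move=> k; apply: vC; rewrite exprn_gt0.
(* Summing all thresholds up to k makes the index monotone and at least [N k]; the extra k makes it
   tend to infinity. *)
pose sg k := (\sum_(i < k.+1) N i + k)%N.
exists sg; split.
- by move=> k; rewrite leq_addl.
- apply: homo_leq => //; first exact: leq_trans.
  by move=> i; rewrite /sg [in leqRHS]big_ord_recr/= addnS leqW// leq_add2r leq_addr.
- move=> k m n km kn; apply: HN.
    by apply: leq_trans km; rewrite /sg big_ord_recr/= -addnA addnCA leq_addr.
  by apply: leq_trans kn; rewrite /sg big_ord_recr/= -addnA addnCA leq_addr.
Qed.

(** Riesz-Fischer: along the fast subsequence the increments have summable L^1 norms, so they are
    absolutely summable a.e., and Fatou's lemma turns the Cauchy estimate into convergence of the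
    whole sequence. The subsequence stays in the statement because [L2_complete] identifies a second
    limit through a.e. convergence. *)
Lemma L1_complete : exists u : R -> R, exists sg : nat -> nat,
  [/\ L1 D u, forall k, (k <= sg k)%N,
   {ae mu, forall x, D x -> v (sg k) x @[k --> \oo] --> u x} &
   \int[mu]_(x in D) `|v n x - u x| @[n --> \oo] --> 0].
Proof.
have [sg [sgk sgh sgC]] := fast_subsequence.
pose w k := v (sg k).
have mw k : measurable_fun D (w k) by exact: L1_meas (Iv _).
pose g k x : R := `|w k.+1 x - w k x|.
have g0 k x : 0 <= g k x by exact: normr_ge0.
have Ig k : L1 D (g k) by apply: L1_norm => //; apply: L1B => //; exact: Iv.
have mg k : measurable_fun D (g k) by exact: L1_meas (Ig _).
have gk k : (\int[mu]_(x in D) (g k x)%:E <= (2^-1 ^+ k)%:E)%E.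
  by rewrite L1_EFin// lee_fin ltW// sgC// sgh.
have SF : (\int[mu]_(x in D) (\sum_(k <oo) (g k x)%:E) < +oo)%E.
  rewrite integral_nneseries//.
  - apply: (@le_lt_trans _ _ (\sum_(k <oo) (2^-1 ^+ k)%:E)%E).
      apply: lee_nneseries => // k _ _; apply: integral_ge0 => x _.
      by rewrite lee_fin.
    have := @cvg_geometric_eseries_half R 2 0.
    rewrite (_ : (fun k => _) = (fun k => (2^-1 ^+ k)%:E)).
      by move=> h; rewrite (cvg_lim _ h)// ltry.
    apply/funext => k.
    by rewrite natrX addn1 exprS invfM mulrA divff// mul1r exprVn.
  - by move=> k; apply/measurable_EFinP; exact: mg.
  - by move=> k x _; rewrite lee_fin.
have S0 x : (0 <= \sum_(k <oo) (g k x)%:E)%E.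
  by apply: nneseries_ge0 => k _ _; rewrite lee_fin.
have Sm : measurable_fun D (fun x => (\sum_(k <oo) (g k x)%:E)%E).
  have := @ge0_emeasurable_sum _ _ R D (fun k x => (g k x)%:E) xpredT.
  apply.
    by move=> k x _ _; rewrite lee_fin.
  by move=> k _; apply/measurable_EFinP; exact: mg.
have Sae : {ae mu, forall x, D x -> (\sum_(k <oo) (g k x)%:E < +oo)%E}.
  have : mu.-integrable D (fun x => (\sum_(k <oo) (g k x)%:E)%E).
    apply/integrableP; split => //.
    under eq_integral => x _ do rewrite gee0_abs//.
    exact: SF.
  move=> /(@integrable_ae _ _ _ mu D mD _); apply: aeS => x h Dx.
  by have := h Dx; rewrite ge0_fin_numE.
have wcv x : (\sum_(k <oo) (g k x)%:E < +oo)%E -> cvgn (w ^~ x).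
  move=> Sx.
  have c1 : cvgn (series (fun k => w k.+1 x - w k x)).
    apply: normed_cvg; apply: nondecreasing_is_cvgn.
      by apply: nondecreasing_series => k _ _; exact: normr_ge0.
    exists (fine (\sum_(k <oo) (g k x)%:E)%E) => _ [n _ <-].
    rewrite -lee_fin fineK; last by rewrite ge0_fin_numE.
    rewrite /= -sumEFin; by apply: nneseries_lim_ge => k _ _; rewrite lee_fin.
  rewrite (_ : w ^~ x = (fun k => series (fun k => w k.+1 x - w k x) k + w 0%N x)).
    by apply: is_cvgD => //; exact: is_cvg_cst.
  by apply/funext => k; rewrite /series/= telescope_sumr// subrK.
(* The upper limit is measurable and defined everywhere, which avoids a choice on the exceptional
   null set. *)
pose u x := fine (limn_esup (fun k => (w k x)%:E)).
have mu_u : measurable_fun D u.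
  have := @measurable_fun_limn_esup _ _ R D (fun k x => (w k x)%:E).
  move=> /(_ (fun k => ltac:(apply/measurable_EFinP; exact: mw))) m1.
  by rewrite /u; apply: measurableT_comp m1.
have wux x : cvgn (w ^~ x) -> w k x @[k --> \oo] --> u x.
  move=> cw; have lw : (EFin \o (w ^~ x)) @ \oo --> (limn (w ^~ x))%:E.
    by apply: cvg_EFin; [exact: nearW|exact: cw].
  rewrite /u (_ : (fun k => (w k x)%:E) = EFin \o (w ^~ x))//.
  by rewrite is_cvg_limn_esupE; [rewrite (cvg_lim _ lw)|apply/cvgP: lw].
have wu : {ae mu, forall x, D x -> w k x @[k --> \oo] --> u x}.
  by apply: aeS Sae => x Sx Dx; apply/wux/wcv/Sx.
(* Fatou for |v n - w (i + k)| as i grows: every integral is at most 2^-k, and the a.e. limit of the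
   integrands is |v n - u|. *)
have fat n k : (sg k <= n)%N -> (\int[mu]_(x in D) `|v n x - u x|%:E <= (2^-1 ^+ k)%:E)%E.
  move=> nk.
  have := @fatou _ _ R mu D mD (fun i x => `|v n x - w (i + k)%N x|%:E).
  move=> /(_ (fun i => ltac:(apply/measurable_EFinP/measurableT_comp => //; apply: measurable_funB; [exact: L1_meas (Iv _)|exact: mw])) (fun i x _ => ltac:(rewrite lee_fin; exact: normr_ge0))) fa.
  apply: (@le_trans _ _ (\int[mu]_(x in D) limn_einf (fun i => `|v n x - w (i + k)%N x|%:E))%E).
    rewrite le_eqVlt; apply/orP; left; apply/eqP.
    apply: ae_eq_integral => //.
    - by apply/measurable_EFinP/measurableT_comp => //; apply: measurable_funB => //; exact: L1_meas (Iv _).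
    - under eq_fun do rewrite -(oppeK (limn_einf _)) -limn_esupN.
      apply: measurableT_comp => //.
      apply: (@measurable_fun_limn_esup _ _ R D (fun i x => - `|v n x - w (i + k)%N x|%:E)%E) => i.
      apply: measurableT_comp => //.
      by apply/measurable_EFinP/measurableT_comp => //; apply: measurable_funB; [exact: L1_meas (Iv _)|exact: mw].
    - apply: aeS wu => x /= wu Dx.
      have cw : (fun i => `|v n x - w (i + k)%N x|%:E) @ \oo --> `|v n x - u x|%:E.
        apply/cvg_EFin; first by apply: nearW.
        apply: cvg_norm; apply: cvgB; first exact: cvg_cst.
        by have := wu Dx; rewrite -(cvg_shiftn k).
      by rewrite is_cvg_limn_einfE; [rewrite (cvg_lim _ cw)|apply/cvgP: cw].
  apply: (le_trans fa); rewrite limn_einf_lim.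
  apply: lime_le; first exact: is_cvg_einfs.
  apply: nearW => i; apply: (@le_trans _ _ (\int[mu]_(x in D) `|v n x - w (i + k)%N x|%:E)%E).
    by apply: ereal_inf_lbound; exists i => /=.
  rewrite L1_EFin//; last by apply: L1_norm => //; apply: L1B => //; exact: Iv.
  by rewrite lee_fin ltW// sgC// sgh// leq_addl.
have Ivu n : (sg 0%N <= n)%N -> L1 D (fun x => v n x - u x).
  move=> n0; apply: L1_normP => //; first by apply: measurable_funB => //; exact: L1_meas (Iv _).
  by apply: le_lt_trans (fat _ _ n0) _; rewrite ltry.
have Iu : L1 D u.
  have := L1B mD (Iv (sg 0%N)) (Ivu _ (leqnn _)).
  by apply: L1_eq => // x _; rewrite opprB addrC subrK.
exists u, sg; split => //.
apply/cvgrPdist_le => e e0.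
have [k ke] : exists k, 2^-1 ^+ k < e.
  have /cvgrPdist_lt/(_ e e0)[k _ /(_ k (leqnn _))] : (2^-1 : R) ^+ k @[k --> \oo] --> (0 : R).
    by apply: cvg_expr; rewrite ger0_norm// invf_lt1// ltr1n.
  by rewrite sub0r normrN ger0_norm ?exprn_ge0//; exists k.
exists (sg k) => // n /= nk; rewrite sub0r normrN ger0_norm; last by apply: Int_ge0.
rewrite (le_trans _ (ltW ke))// -lee_fin -L1_EFin//; first exact: fat.
by apply: L1_norm => //; apply: Ivu; apply: leq_trans nk; exact: sgh.
Qed.
End L1Complete.

(** * Primitives of integrable functions *)

Section Indefinite.
Variable R : realType.
Notation mu := (@lebesgue_measure R).
Implicit Types (D : set R) (v : R -> R).

Lemma Int_dominated D (f_ : nat -> R -> R) (f g : R -> R) : measurable D ->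
  (forall n, measurable_fun D (f_ n)) -> measurable_fun D f ->
  {ae mu, forall x, D x -> f_ n x @[n --> \oo] --> f x} ->
  L1 D g -> (forall n x, D x -> `|f_ n x| <= g x) ->
  \int[mu]_(x in D) f_ n x @[n --> \oo] --> \int[mu]_(x in D) f x.
Proof.
move=> mD mf_ mf cf Ig fg.
have [|||||I0 I1 I2] := @dominated_convergence _ _ R mu D mD
    (fun n x => (f_ n x)%:E) (fun x => (f x)%:E) (fun x => (g x)%:E).
- by move=> n; apply/measurable_EFinP; exact: mf_.
- exact/measurable_EFinP.
- apply: aeS cf => x cf Dx; apply: cvg_EFin; first exact: nearW.
  exact: cf.
- exact: Ig.
- by apply: aeW => x n Dx; rewrite /= lee_fin fg.
have If_ n : L1 D (f_ n) by apply: L1_le Ig => //; exact: fg.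
rewrite L1_EFin// in I2.
have /= -> : (fun n => \int[mu]_(x in D) f_ n x) =
  fine \o (fun n => \int[mu]_(x in D) (f_ n x)%:E)%E by [].
exact: (fine_cvg I2).
Qed.

(** Absolute continuity of the integral: the part of |v| above height N has small integral by
    dominated convergence, and the part below contributes at most N times the measure of A. *)
Lemma L1_uniform_small v : L1 setT v -> forall e, 0 < e -> exists2 d, 0 < d &
  forall A, measurable A -> (mu A < d%:E)%E -> \int[mu]_(x in A) `|v x| < e.
Proof.
move=> Iv e e0.
have mv : measurable_fun setT v by exact: L1_meas.
have Iav : L1 setT (fun x => `|v x|) by exact: L1_norm.
pose g n x : R := `|v x| - Num.min `|v x| n%:R.
have mg n : measurable_fun setT (g n).
  apply: measurable_funB; first exact: L1_meas.
  by apply: measurable_minr; [exact: L1_meas|].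
have gv n x : `|g n x| <= `|v x|.
  rewrite /g ger0_norm; last by rewrite subr_ge0 ge_min lexx.
  by rewrite gerBl le_min normr_ge0 ler0n.
have cg : \int[mu]_x g n x @[n --> \oo] --> \int[mu]_(x in [set: R]) (0 : R).
  apply: (Int_dominated (g := fun x => `|v x|)) => //.
  apply: aeW => x _; apply: cvg_near_cst; near=> n; rewrite /g min_l ?subrr//.
  by near: n; exact: nbhs_infty_ger.
have I00 : \int[mu]_(x in [set: R]) (0 : R) = 0 :> R.
  by rewrite Rintegral_cst// mul0r.
rewrite I00 in cg.
have e20 : 0 < e / 2 by rewrite divr_gt0.
have /cvgrPdist_lt/(_ _ e20)[N _ /(_ N (leqnn _))] := cg.
rewrite sub0r normrN => gN.
(* N + 1 in place of N keeps the denominator positive. *)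
exists (e / 2 / N.+1%:R); first by rewrite divr_gt0.
move=> A mA Ad.
have IgN : L1 setT (g N) by exact: L1_le Iav.
have Ag : L1 A (g N) by exact: L1_sub IgN.
have Av : L1 A (fun x => `|v x|) by exact: L1_sub Iav.
have Am : L1 A (fun x => `|v x| - g N x) by apply: L1B.
rewrite (_ : \int[mu]_(x in A) `|v x| =
  \int[mu]_(x in A) g N x + \int[mu]_(x in A) (`|v x| - g N x)); last first.
  by rewrite -IntD//; apply: Int_eq => x _; rewrite addrC subrK.
have fA : (mu A < +oo)%E by rewrite (lt_le_trans Ad)// leey.
have g0 x : 0 <= g N x by rewrite /g subr_ge0 ge_min lexx.
rewrite [ltRHS](splitr e) ltr_leD//.
  apply: le_lt_trans gN; apply: le_trans (ler_norm _).
  by apply: Int_subset.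
apply: (@le_trans _ _ (\int[mu]_(x in A) N%:R)).
  apply: Int_le => //.
    by apply: (@L1_bounded _ _ _ N%:R) => // x _; rewrite ger0_norm.
  by move=> x _; rewrite /g opprB addrC subrK ge_min lexx orbT.
rewrite Rintegral_cst//.
apply: (@le_trans _ _ (N.+1%:R * fine (mu A))).
  by rewrite ler_wpM2r ?fine_ge0// ler_nat.
rewrite mulrC -ler_pdivlMr//.
by rewrite -lee_fin fineK ?ge0_fin_numE// ltW.
Unshelve. all: by end_near. Qed.

(** Based at -oo, so that a function living on an interval is integrated through its extension by 0,
    and increments are differences without a case distinction on a base point. *)
Definition Ji v x := \int[mu]_(t in `]-oo, x]) v t.

Lemma JiB v x y : L1 setT v -> x <= y ->
  Ji v y - Ji v x = \int[mu]_(t in `]x, y]) v t.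
Proof.
move=> Iv xy; apply: (@Rintegral_itvB R v -oo%O (BRight y) x) => //.
exact: L1_sub Iv.
Qed.

Lemma Ji_abs v x y : L1 setT v -> x <= y ->
  `|Ji v y - Ji v x| <= \int[mu]_(t in `]x, y]) `|v t|.
Proof. by move=> Iv xy; rewrite JiB//; apply: Int_norm => //; exact: L1_sub Iv. Qed.

Lemma Ji_cont v : L1 setT v -> continuous (Ji v).
Proof.
move=> Iv x; apply/cvgrPdist_lt => e e0.
have [d d0 H] := L1_uniform_small Iv e0.
have key (a b : R) : a <= b -> `|a - b| < d -> `|Ji v a - Ji v b| < e.
  move=> ab; rewrite distrC => abd.
  have bd : b - a < d by rewrite (le_lt_trans (ler_norm _)).
  rewrite distrC; apply: le_lt_trans (Ji_abs Iv ab) _; apply: H => //.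
  by rewrite lebesgue_measure_itv/= lte_fin; case: ifP => _; rewrite -?EFinB lte_fin.
near=> y.
have xyd : `|x - y| < d by near: y; apply: (@cvgr_dist_lt _ R^o).
have [xy|/ltW yx] := leP x y; first exact: key.
by rewrite distrC; apply: key => //; rewrite distrC.
Unshelve. all: by end_near. Qed.

Lemma Ji_ae_derive v : L1 setT v ->
  {ae mu, forall x, is_derive x (1 : R) (Ji v) (v x)}.
Proof.
move=> Iv.
have I0 y : L1 `]-oo, y] v by exact: L1_sub Iv.
have : {ae mu, forall x, derivable (Ji v) x 1 /\ derive1 (Ji v) x = v x}.
  apply: FTC1Ny => //.
  by apply: open_integrable_locally => //; exact: openT.
by apply: aeS => x [dx <-]; rewrite derive1E; exact/derivableP.
Qed.

Lemma Ji_derive v (x : R) : L1 setT v -> {for x, continuous v} ->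
  is_derive x (1 : R) (Ji v) (v x).
Proof.
move=> Iv cx.
have x1 : x < x + 1 by rewrite ltrDl.
have I1 : L1 `]-oo, x + 1] v by exact: L1_sub Iv.
have [dx <-] := @continuous_FTC1 R v -oo%O x (x + 1) x1 I1 (ltNyr _) cx.
by rewrite derive1E; exact/derivableP.
Qed.

End Indefinite.

Section AbsCont.
Variable R : realType.
Notation mu := (@lebesgue_measure R).

Lemma Ji_abs_cont (v : R -> R) (c d : R) : L1 setT v -> abs_cont c d (Ji v).
Proof.
move=> Iv e e0; have [dl dl0 H] := L1_uniform_small Iv e0.
exists dl => // n l r lr dis ld.
(* Half-open cells: intervals that share an endpoint stay disjoint, as additivity of the measure
   requires. *)
pose F i := `]l i, r i]%classic.
pose A := \big[setU/set0]_(i < n) F i.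
have mF i : measurable (F i) by exact: measurable_itv.
have mA : measurable A by exact: bigsetU_measurable.
have muF i : (mu (F i) <= (r i - l i)%:E)%E.
  have [_ lri _] := lr i; rewrite lebesgue_measure_itv/= lte_fin.
  by case: ifP => _; rewrite -?EFinB ?lee_fin// subr_ge0.
have tF : trivIset setT F.
  apply/trivIsetP => i j _ _ ij; apply/seteqP; split => // x [].
  rewrite /F /= !in_itv/= => /andP[lx xr] /andP[lx' xr'].
  by case: (dis _ _ ij) => h; [have := lt_le_trans lx' (le_trans xr h)|
    have := lt_le_trans lx (le_trans xr' h)]; rewrite ltxx.
have Iav : L1 setT (fun x => `|v x|) by exact: L1_norm.
have IvA : L1 A (fun x => `|v x|) by exact: L1_sub Iav.
apply: (@le_lt_trans _ _ (\int[mu]_(x in A) `|v x|)).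
  rewrite -lee_fin -L1_EFin// /A ge0_integral_bigsetU//=.
  - rewrite -sumEFin; apply: lee_sum => i _.
    have [_ lri _] := lr i.
    by rewrite L1_EFin ?lee_fin//; [exact: Ji_abs|exact: L1_sub Iav].
  - exact: index_enum_uniq.
  - exact: sub_trivIset tF.
  - by apply/measurable_EFinP; exact: L1_meas IvA.
apply: H => //; rewrite /A measure_semi_additive_ord//.
apply: le_lt_trans (_ : _ <= (\sum_(i < n) (r i - l i))%:E)%E _; last by rewrite lte_fin.
rewrite -sumEFin; apply: lee_sum => i _; exact: muF.
Qed.

End AbsCont.

(** * Absolutely continuous functions are primitives *)

Section Huber.
Variable R : realType.
Implicit Types (K a b e : R).

(** The Huber function: convex and C^1, quadratic on [-K, K] and of linear growth outside. Linear
    growth bounds its sums by the variation of u, while on [-K, K] its Bregman divergence is the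
    squared distance. *)
Definition huber K (t : R) : R := if `|t| <= K then t ^+ 2 else 2 * K * `|t| - K ^+ 2.

Definition dhuber K (t : R) : R :=
  if `|t| <= K then 2 * t else if 0 <= t then 2 * K else - (2 * K).

Lemma huber_le K a : 0 < K -> huber K a <= 2 * K * `|a|.
Proof.
move=> K0; rewrite /huber; case: ifPn => aK; last by rewrite gerBl exprn_ge0// ltW.
by rewrite -(real_normK (num_real a)); have := normr_ge0 a; nra.
Qed.

Lemma bregman_huber_ge0 K a b : 0 < K ->
  0 <= huber K b - huber K a - dhuber K a * (b - a).
Proof.
move=> K0; rewrite /huber /dhuber.
case: (leP 0 a) => a0; case: (leP 0 b) => b0;
  rewrite ?(ger0_norm a0) ?(ltr0_norm a0) ?(ger0_norm b0) ?(ltr0_norm b0);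
  case: ifPn => bK; case: ifPn => aK; rewrite -?ltNge in aK bK *;
  have := sqr_ge0 (b - K); have := sqr_ge0 (b + K); have := sqr_ge0 (b - a);
  have := sqr_ge0 (a - K); have := sqr_ge0 (a + K); nra.
Qed.

(* Large values are paid for by themselves, the others by the Bregman divergence. *)
Lemma dist_le_bregman K a b e : 0 < K -> 0 < e ->
  `|b - a| <= 2 * (`|b| *+ (K < `|b|)%R) + 2 * (`|a| *+ (K < `|a|)%R)
    + e + (huber K b - huber K a - dhuber K a * (b - a)) / e.
Proof.
move=> K0 e0.
have D0 := bregman_huber_ge0 a b K0.
have De0 : 0 <= (huber K b - huber K a - dhuber K a * (b - a)) / e.
  by rewrite divr_ge0// ltW.
have ab := ler_normB b a.
have [Kb|bK] := ltP K `|b|; have [Ka|aK] := ltP K `|a|;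
  rewrite ?mulr1n ?mulr0n ?mulr0 ?add0r ?addr0.
- by have := normr_ge0 a; have := normr_ge0 b; lra.
- by have := normr_ge0 a; have := normr_ge0 b; lra.
- by have := normr_ge0 a; have := normr_ge0 b; lra.
- rewrite /huber /dhuber bK aK.
  rewrite (_ : _ - _ - _ = `|b - a| ^+ 2); last by rewrite real_normK ?num_real//; ring.
  set t := `|b - a|; have t0 : 0 <= t by exact: normr_ge0.
  have [te|et] := leP t e; first by rewrite ler_wpDr// divr_ge0// ?exprn_ge0// ltW.
  rewrite ler_wpDl//; first exact: ltW.
  by rewrite ler_pdivlMr// expr2 ler_wpM2l// ltW.
Qed.

End Huber.

(* The dyadic difference quotients of an absolutely continuous u are uniformly integrable.
   Refinement increases the integral of a convex function of them, so the Bregman divergence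
   of a convex function of linear growth makes them Cauchy in L^1; u is a primitive of
   their limit. *)
Section Grid.
Variables (R : realType) (u : R -> R) (c d : R).
Hypotheses (cd : c < d) (uac : abs_cont c d u).
Notation mu := (@lebesgue_measure R).

Let gr n k : R := c + (d - c) * (k%:R / 2 ^+ n).
Let len n : R := (d - c) / 2 ^+ n.
Let Du n k := u (gr n k.+1) - u (gr n k).
Let a n k := Du n k / len n.

Let len_gt0 n : 0 < len n. Proof. by rewrite divr_gt0 ?exprn_gt0// subr_gt0. Qed.

Let grS n k : gr n k.+1 - gr n k = len n.
Proof. by rewrite /gr /len -natr1; ring. Qed.

Let gr_le n i j : (i <= j)%N -> gr n i <= gr n j.
Proof.
by move=> ij; rewrite lerD2l ler_pM2l ?subr_gt0// ler_pM2r ?invr_gt0 ?exprn_gt0// ler_nat.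
Qed.

Let gr0 n : gr n 0 = c. Proof. by rewrite /gr mul0r mulr0 addr0. Qed.

Let gr_end n : gr n (2 ^ n) = d.
Proof. by rewrite /gr natrX divff ?expf_neq0// mulr1 addrC subrK. Qed.

Let gr_shift n p k : gr (n + p) (k * 2 ^ p) = gr n k.
Proof.
rewrite /gr natrM natrX exprD; congr (_ + _ * _).
by rewrite -mulf_div divff ?mulr1// expf_neq0.
Qed.

Let lenD n p : len n = len (n + p) * 2 ^+ p.
Proof. by rewrite /len exprD invfM mulrA mulfVK// expf_neq0. Qed.

Let DuE n k : Du n k = a n k * len n.
Proof. by rewrite /a divfK// gt_eqF. Qed.

Let absDu n k : `|Du n k| = `|a n k| * len n.
Proof. by rewrite DuE normrM (gtr0_norm (len_gt0 n)). Qed.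

Lemma grid_abs_cont e : 0 < e -> exists2 dl, 0 < dl & forall n (P : pred nat),
  \sum_(0 <= k < 2 ^ n | P k) len n < dl -> \sum_(0 <= k < 2 ^ n | P k) `|Du n k| < e.
Proof.
move=> e0; have [dl dl0 H] := uac e0; exists dl => // n P.
rewrite [X in X < dl -> _]big_mkcond [X in _ -> X < e]big_mkcond/= !big_mkord => ldl.
pose l (i : 'I_(2 ^ n)) := gr n i.
(* A cell that is not selected is collapsed to a point, so that the family stays indexed by all
   cells. *)
pose r (i : 'I_(2 ^ n)) := if P i then gr n i.+1 else gr n i.
apply: le_lt_trans (H _ l r _ _ _).
- apply: ler_sum => i _; rewrite /l /r; case: ifP => //.
- move=> i; rewrite /l /r -(gr0 n) -(gr_end n); split.
  + exact: gr_le.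
  + by case: ifP => // _; exact: gr_le.
  + by case: ifP => // _; apply: gr_le => //; exact: ltnW.
- move=> i j; rewrite -val_eqE neq_ltn /l /r => /orP[] ij; [left|right];
    by case: ifP => // _; apply: gr_le => //; exact: ltnW.
- apply: le_lt_trans ldl; apply: ler_sum => i _; rewrite /l /r.
  by case: ifP => _; rewrite ?grS ?subrr.
Qed.

Let sum_block n p (F : nat -> R) :
  \sum_(0 <= k < 2 ^ (n + p)) F k =
  \sum_(0 <= i < 2 ^ n) \sum_(i * 2 ^ p <= k < i.+1 * 2 ^ p) F k.
Proof. by rewrite expnD big_nat_mul. Qed.

(** Once the cells of level n0 are shorter than the delta that belongs to epsilon = 1, the subcells
    of each carry variation less than 1 at every finer level, and there are 2^n0 of these cells. *)
Lemma grid_bounded_variation : exists n0, exists2 M : R, 0 <= M & forall n,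
  \sum_(0 <= k < 2 ^ (n0 + n)) `|Du (n0 + n) k| <= M.
Proof.
have [dl dl0 H] := grid_abs_cont ltr01.
have [n0 n0d] : exists n0, len n0 < dl.
  have : len n @[n --> \oo] --> (0 : R).
    rewrite -(mulr0 (d - c)); apply: cvgMr.
    under eq_fun do rewrite -exprVn.
    by apply: cvg_expr; rewrite ger0_norm// invf_lt1// ltr1n.
  move=> /cvgrPdist_lt/(_ _ dl0)[n _ /(_ n (leqnn _))].
  by rewrite sub0r normrN gtr0_norm//; exists n.
exists n0, (2 ^ n0)%:R => // n.
rewrite sum_block (_ : (2 ^ n0)%:R = \sum_(0 <= i < 2 ^ n0) (1 : R)); last first.
  by rewrite sumr_const_nat subn0.
rewrite big_nat [leRHS]big_nat; apply: ler_sum => i /andP[_ i2].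
have im : (i.+1 * 2 ^ n <= 2 ^ (n0 + n))%N by rewrite expnD leq_mul2r i2 orbT.
have E (F : nat -> R) : \sum_(i * 2 ^ n <= k < i.+1 * 2 ^ n) F k =
    \sum_(0 <= k < 2 ^ (n0 + n) | (i * 2 ^ n <= k < i.+1 * 2 ^ n)%N) F k.
  rewrite (big_nat_widen _ _ _ _ _ im) (big_nat_widenl _ 0)//.
  by apply: eq_bigl => k; rewrite /= andbC.
rewrite E ltW// H// -E sumr_const_nat mulSn addnK -mulr_natr natrX.
by rewrite -lenD.
Qed.

(** Chebyshev: the cells whose quotient exceeds K have total length at most M / K, and K = (M + 1) /
    dl brings this below dl. *)
Lemma grid_uniform_integrability n0 (M : R) e :
  (forall n, \sum_(0 <= k < 2 ^ (n0 + n)) `|Du (n0 + n) k| <= M) -> 0 < e ->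
  exists2 K, 0 < K & forall n,
    \sum_(0 <= k < 2 ^ (n0 + n)) (`|a (n0 + n) k| *+ (K < `|a (n0 + n) k|)%R) * len (n0 + n) < e.
Proof.
move=> HM e0; have [dl dl0 H] := grid_abs_cont e0.
have M0 : 0 <= M by apply: le_trans (HM 0%N); apply: sumr_ge0.
exists ((M + 1) / dl); first by rewrite divr_gt0// ltr_wpDl.
set K := (M + 1) / dl => n; set N := (n0 + n)%N.
have K0 : 0 < K by rewrite divr_gt0// ltr_wpDl.
rewrite (_ : \sum_(0 <= k < 2 ^ N) _ = \sum_(0 <= k < 2 ^ N | K < `|a N k|) `|Du N k|).
  apply: H; rewrite -(ltr_pM2l K0).
  apply: (@le_lt_trans _ _ (\sum_(0 <= k < 2 ^ N) `|Du N k|)).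
    rewrite mulr_sumr [leLHS]big_mkcond/=; apply: ler_sum => k _.
    case: ifPn => [Ka|_]; last exact: normr_ge0.
    by rewrite absDu ler_pM2r// ltW.
  by rewrite (le_lt_trans (HM n))// /K divfK ?gt_eqF// ltrDl.
rewrite [RHS]big_mkcond/=; apply: eq_bigr => k _.
by rewrite absDu; case: ifPn; rewrite ?mulr1n ?mulr0n ?mul0r.
Qed.

Let block_div p i k : (i * 2 ^ p <= k)%N -> (k < i.+1 * 2 ^ p)%N -> (k %/ 2 ^ p)%N = i.
Proof.
move=> ik ki; apply/eqP.
by rewrite eqn_leq -ltnS ltn_divLR ?expn_gt0// ki leq_divRL ?expn_gt0.
Qed.

Let sum_coarse n p (G : nat -> R) :
  \sum_(0 <= k < 2 ^ (n + p)) G (k %/ 2 ^ p)%N * len (n + p) =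
  \sum_(0 <= i < 2 ^ n) G i * len n.
Proof.
rewrite sum_block; apply: eq_bigr => i _.
rewrite big_nat (eq_bigr (fun=> G i * len (n + p))); last first.
  move=> k /andP[ik ki]; by rewrite (block_div ik ki).
rewrite -big_nat sumr_const_nat mulSn addnK (lenD n p) -[in LHS]mulr_natr natrX.
by rewrite mulrA.
Qed.

(** The martingale property: over a coarse cell the fine quotients average to the coarse one. A
    function of the coarse quotient is therefore orthogonal to the increments, which turns a
    difference of Huber sums into a sum of Bregman divergences. *)
Let sum_cross n p (G : R -> R) :
  \sum_(0 <= k < 2 ^ (n + p)) G (a n (k %/ 2 ^ p)%N) *
     (a (n + p) k - a n (k %/ 2 ^ p)%N) * len (n + p) = 0.
Proof.
rewrite sum_block big1// => i _.
rewrite big_nat (eq_bigr (fun k => G (a n i) * (Du (n + p) k - a n i * len (n + p)))); last first.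
  move=> k /andP[ik ki]; by rewrite (block_div ik ki) (DuE (n + p) k); ring.
rewrite -big_nat -mulr_sumr sumrB telescope_sumr ?leq_mul2r ?leqnSn ?orbT//.
rewrite !gr_shift sumr_const_nat mulSn addnK -mulr_natr natrX -mulrA -lenD.
by rewrite -/(Du n i) DuE subrr mulr0.
Qed.

Lemma grid_L1_cauchy : forall e, 0 < e -> exists N, forall n p, (N <= n)%N ->
  \sum_(0 <= k < 2 ^ (n + p)) `|a (n + p) k - a n (k %/ 2 ^ p)%N| * len (n + p) < e.
Proof.
move=> e e0.
have [n0 [M M0 HM]] := grid_bounded_variation.
have e8 : 0 < e / 8 by rewrite divr_gt0.
have [K K0 UI] := grid_uniform_integrability HM e8.
pose S n := \sum_(0 <= k < 2 ^ n) huber K (a n k) * len n.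
have SD n p : S (n + p)%N - S n = \sum_(0 <= k < 2 ^ (n + p))
    (huber K (a (n + p) k) - huber K (a n (k %/ 2 ^ p)%N)
     - dhuber K (a n (k %/ 2 ^ p)%N) * (a (n + p) k - a n (k %/ 2 ^ p)%N)) * len (n + p).
  rewrite -[RHS]addr0 -[X in _ = _ + X](sum_cross n p (dhuber K)) -big_split/=.
  have -> : S n = \sum_(0 <= k < 2 ^ (n + p)) huber K (a n (k %/ 2 ^ p)%N) * len (n + p).
    by rewrite (sum_coarse n p (fun i => huber K (a n i))).
  rewrite /S -sumrB.
  by apply: eq_bigr => k _; ring.
have S_nd : {homo (fun n => S (n0 + n)%N) : i j / (i <= j)%N >-> i <= j}.
  move=> i j ij; rewrite -subr_ge0 -(subnKC ij) addnA SD; apply: sumr_ge0 => k _.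
  by apply: mulr_ge0; [exact: bregman_huber_ge0|exact: ltW].
have S_bd n : S (n0 + n)%N <= 2 * K * M.
  apply: (@le_trans _ _ (2 * K * \sum_(0 <= k < 2 ^ (n0 + n)) `|Du (n0 + n) k|)).
    rewrite mulr_sumr; apply: ler_sum => k _; rewrite absDu [leRHS]mulrA.
    by rewrite ler_pM2r// huber_le.
  by rewrite ler_pM2l ?HM// mulr_gt0.
have S_cv : cvgn (fun n => S (n0 + n)%N).
  by apply: nondecreasing_is_cvgn => //; exists (2 * K * M) => _ [n _ <-].
(* [eta] times d - c is e / 8. With the two tails, each weighted by 2, and the divergence divided by
   [eta], the total stays below 6 e / 8. *)
pose eta := e / (8 * (d - c)).
have eta0 : 0 < eta by rewrite divr_gt0// mulr_gt0// subr_gt0.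
have [N HN] : exists N, forall n p, (N <= n)%N -> S (n0 + n + p)%N - S (n0 + n)%N < eta * (e / 8).
  have ee0 : 0 < eta * (e / 8) by rewrite mulr_gt0.
  have /cvgrPdist_lt/(_ _ ee0)[N _ HN] := S_cv.
  exists N => n p Nn; have := HN n Nn; apply: le_lt_trans.
  apply: le_trans (ler_norm _); rewrite lerD2r -addnA.
  exact: (nondecreasing_cvgn_le S_nd S_cv).
exists (n0 + N)%N => n p nN.
have [n' nE Nn'] : exists2 n', n = (n0 + n')%N & (N <= n')%N.
  exists (n - n0)%N; first by rewrite subnKC// (leq_trans _ nN)// leq_addr.
  by rewrite leq_subRL// (leq_trans _ nN)// leq_addr.
have lenS m : \sum_(0 <= k < 2 ^ m) len m = d - c.
  by rewrite sumr_const_nat subn0 -mulr_natr natrX /len divfK// expf_neq0.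
apply: (@le_lt_trans _ _ (\sum_(0 <= k < 2 ^ (n + p))
    (2 * (`|a (n + p) k| *+ (K < `|a (n + p) k|)%R) * len (n + p)
     + 2 * (`|a n (k %/ 2 ^ p)%N| *+ (K < `|a n (k %/ 2 ^ p)%N|)%R) * len (n + p)
     + eta * len (n + p) + (huber K (a (n + p) k) - huber K (a n (k %/ 2 ^ p)%N)
     - dhuber K (a n (k %/ 2 ^ p)%N) * (a (n + p) k - a n (k %/ 2 ^ p)%N)) * len (n + p) / eta))).
  apply: ler_sum => k _; rewrite [_ * len (n + p) / eta]mulrAC -!mulrDl ler_pM2r//.
  exact: dist_le_bregman.
rewrite !big_split/= -[X in _ + X < _]mulr_suml -SD -[X in _ + X + _ < _]mulr_sumr lenS.
rewrite (sum_coarse n p (fun i => 2 * (`|a n i| *+ (K < `|a n i|)%R))).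
have U1 := UI (n' + p)%N; rewrite addnA -nE in U1.
have U2 := UI n'; rewrite -nE in U2.
under eq_bigr do rewrite -mulrA. rewrite -mulr_sumr.
under [X in _ + X + _ + _ < _]eq_bigr do rewrite -mulrA. rewrite -mulr_sumr.
have U3 : (S (n + p)%N - S n) / eta < e / 8.
  by rewrite ltr_pdivrMr// mulrC nE HN.
have U4 : eta * (d - c) = e / 8.
  by rewrite /eta invfM !mulrA divfK// subr_eq0 gt_eqF.
rewrite U4; move: U1 U2 U3 e0; set x1 := \sum_(_ <= _ < _) _; set x2 := \sum_(_ <= _ < _) _.
set x3 := _ / eta; lra.
Qed.

Let kap n (x : R) : nat := Num.trunc ((x - c) / (d - c) * 2 ^+ n).

Let kap_itv n x : c <= x -> gr n (kap n x) <= x < gr n (kap n x).+1.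
Proof.
move=> cx; have dc0 : 0 < d - c by rewrite subr_gt0.
have y0 : 0 <= (x - c) / (d - c) * 2 ^+ n.
  by rewrite mulr_ge0 ?exprn_ge0// divr_ge0 ?subr_ge0// ltW.
have E m : gr n m = c + m%:R / ((d - c)^-1 * 2 ^+ n).
  by rewrite /gr invfM invrK mulrCA.
rewrite !E -lerBrDl -ltrBlDl ler_pdivrMr ?ltr_pdivlMr ?mulr_gt0 ?invr_gt0 ?exprn_gt0//.
by rewrite mulrA; exact: truncn_itv.
Qed.

Let kap_eq n k x : gr n k <= x < gr n k.+1 -> kap n x = k.
Proof.
move=> /andP[kx xk]; have cx : c <= x by rewrite (le_trans _ kx)// -(gr0 n) gr_le.
have /andP[kx' xk'] := kap_itv n cx.
have lt_of i j : gr n i < gr n j -> (i < j)%N.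
  by move=> h; rewrite ltnNge; apply/negP => /(gr_le n); rewrite leNgt h.
apply/eqP; rewrite eqn_leq -ltnS (lt_of _ _ (le_lt_trans kx' xk))/= -ltnS.
exact: lt_of (le_lt_trans kx xk').
Qed.

Let kap_coarse n p x : c <= x -> kap n x = (kap (n + p) x %/ 2 ^ p)%N.
Proof.
move=> cx; apply: kap_eq; have /andP[kx xk] := kap_itv (n + p) cx.
rewrite -!(gr_shift n p); apply/andP; split.
  by apply: le_trans kx; apply: gr_le; exact: leq_trunc_div.
by apply: lt_le_trans xk _; apply: gr_le; rewrite ltn_ceil// expn_gt0.
Qed.

Let cell_integral n (G : nat -> R) j : L1 `[c, gr n j[ (G \o kap n) /\
  \int[mu]_(x in `[c, gr n j[) G (kap n x) = \sum_(0 <= k < j) G k * len n.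
Proof.
elim: j => [|j [I1 I2]].
  rewrite gr0 set_itvco0 Rintegral_set0 big_geq//; split=> //.
  exact: integrable_set0.
have cj : c <= gr n j by rewrite -(gr0 n) gr_le.
have jj : gr n j <= gr n j.+1 by exact: gr_le.
have IE : `[c, gr n j.+1[%classic = `[c, gr n j[ `|` `[gr n j, gr n j.+1[.
  by rewrite -itv_bndbnd_setU//= bnd_simp.
have Gj x : `[gr n j, gr n j.+1[%classic x -> G (kap n x) = G j.
  by rewrite /= in_itv/= => /kap_eq ->.
have fin : (mu `[gr n j, gr n j.+1[ < +oo)%E.
  by rewrite lebesgue_measure_itv/=; case: ifP => _; rewrite -?EFinB ltry.
have Ic : L1 `[gr n j, gr n j.+1[ (G \o kap n).
  apply: (@L1_eq _ _ (fun=> G j)) => //; first by move=> x /Gj.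
  by apply: (@L1_bounded _ _ _ `|G j|).
have IU : L1 `[c, gr n j.+1[ (G \o kap n) by rewrite IE; exact: L1U.
split=> //; rewrite IE Rintegral_setU//; last 2 first.
  by rewrite -IE.
  apply/disj_setPS => x [/=]; rewrite !in_itv/= => /andP[_ xj] /andP[+ _].
  by rewrite leNgt xj.
rewrite I2 big_nat_recr//=; congr (_ + _).
have muE : mu `[gr n j, gr n j.+1[ = (len n)%:E.
  by rewrite lebesgue_measure_itv/= lte_fin -subr_gt0 -EFinB grS len_gt0.
rewrite (Int_eq Gj) Rintegral_cst//; congr (_ * _).
by rewrite -[RHS]/(fine (len n)%:E); congr fine; exact: muE.
Qed.

Let vn n x : R := a n (kap n x).

Let vn_int n j p : \int[mu]_(x in `[c, gr n j[) vn (n + p) x = u (gr n j) - u c.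
Proof.
rewrite -(gr_shift n p) (cell_integral _ (a (n + p)) _).2.
under eq_bigr do rewrite -DuE.
by rewrite telescope_sumr// gr0.
Qed.

Let L1vn n : L1 `[c, d[ (vn n).
Proof. by rewrite -(gr_end n); exact: (cell_integral n (a n) _).1. Qed.

Let vn_cauchy e : 0 < e -> exists N, forall m n, (N <= m)%N -> (N <= n)%N ->
  \int[mu]_(x in `[c, d[) `|vn m x - vn n x| < e.
Proof.
move=> e0; have [N HN] := grid_L1_cauchy e0; exists N.
have key n p : (N <= n)%N -> \int[mu]_(x in `[c, d[) `|vn (n + p) x - vn n x| < e.
  move=> Nn; apply: le_lt_trans (HN n p Nn).
  rewrite -(cell_integral (n + p) (fun k => `|a (n + p) k - a n (k %/ 2 ^ p)%N|) _).2.
  rewrite gr_end le_eqVlt; apply/orP; left; apply/eqP/Int_eq => x /=.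
  by rewrite in_itv/= => /andP[cx _]; rewrite /vn (kap_coarse n p cx).
move=> m n Nm Nn; have [mn|/ltnW nm] := leqP n m.
  by rewrite -(subnKC mn); exact: key.
rewrite -(subnKC nm); rewrite (Int_eq (g := fun x => `|vn (m + (n - m))%N x - vn m x|)).
  exact: key.
by move=> x _; rewrite distrC.
Qed.

Let abs_cont_at x e : c <= x <= d -> 0 < e -> exists2 dl, 0 < dl &
  forall y, c <= y <= d -> `|y - x| < dl -> `|u y - u x| < e.
Proof.
move=> /andP[cx xd] e0; have [dl dl0 H] := uac e0; exists dl => // y /andP[cy yd] yx.
have K l r : c <= l -> l <= r -> r <= d -> r - l < dl -> `|u r - u l| < e.
  move=> cl lr rd rl; have := H 1%N (fun=> l) (fun=> r).
  rewrite !big_ord1; apply => //.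
  by move=> i j; rewrite !ord1.
have [xy|/ltW yx'] := leP x y.
  by apply: K => //; rewrite (le_lt_trans (ler_norm _)).
by rewrite distrC; apply: K => //; rewrite (le_lt_trans (ler_norm _))// distrC.
Qed.

(** The step functions of the difference quotients integrate exactly to the increments of u between
    grid points, at their own level and at every finer one. Convergence in L^1 preserves this, and
    continuity of both sides carries it from grid points to all points. *)
Theorem abs_cont_integral : exists2 v, L1 setT v & forall x, c <= x <= d ->
  u x - u c = Ji v x - Ji v c.
Proof.
have [w [sg [Iw _ _ wc]]] := L1_complete (measurable_itv _) L1vn vn_cauchy.
pose v := w \_ `[c, d[.
have Iv : L1 setT v.
  rewrite /L1 (_ : EFin \o v = (EFin \o w) \_ `[c, d[); last by rewrite restrict_EFin.
  by apply/(integrable_mkcond _ _).1.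
exists v => //.
have JC := Ji_cont Iv.
have Hgr n j : (j < 2 ^ n)%N -> u (gr n j) - u c = Ji v (gr n j) - Ji v c.
  move=> j2; have cj : c <= gr n j by rewrite -(gr0 n) gr_le.
  have jd : gr n j <= d by rewrite -(gr_end n) gr_le// ltnW.
  have sub : `[c, gr n j[ `<=` `[c, d[.
    by move=> x /=; rewrite !in_itv/= => /andP[-> /lt_le_trans]; exact.
  have Iwj : L1 `[c, gr n j[ w by exact: L1_sub Iw.
  have JE : Ji v (gr n j) - Ji v c = \int[mu]_(x in `[c, gr n j[) w x.
    rewrite JiB// -[LHS]Rintegral_itv_bndo_bndc; last exact: L1_sub Iv.
    rewrite Rintegral_itv_obnd_cbnd; last exact: L1_sub Iv.
    by apply: Int_eq => x /sub xs; rewrite /v patchE mem_set.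
  rewrite JE; apply/eqP; rewrite -subr_eq0 -normr_le0; apply/ler_addgt0Pl => e e0.
  rewrite addr0; have /cvgrPdist_lt/(_ _ e0)[N _ HN] := wc.
  have /= := HN (n + N)%N (leq_addl _ _); rewrite sub0r normrN => wN.
  rewrite -(vn_int n j N) -IntB//; last exact: L1_sub (L1vn _).
  have Id : L1 `[c, gr n j[ (fun x => vn (n + N) x - w x).
    by apply: L1B => //; exact: L1_sub (L1vn _).
  apply: le_trans (Int_norm _ Id) _ => //.
  apply: le_trans (ltW wN); apply: le_trans (ler_norm _).
  by apply: Int_subset => //; apply: L1_norm => //; apply: L1B.
have Hx x : c <= x < d -> u x - u c = Ji v x - Ji v c.
  move=> /andP[cx xd]; apply/eqP; rewrite -subr_eq0 -normr_le0; apply/ler_addgt0Pl => e e0.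
  have e2 : 0 < e / 2 by rewrite divr_gt0.
  have [|d1 d10 H1] := @abs_cont_at x _ _ e2; first by rewrite cx ltW.
  have /cvgrPdist_lt/(_ _ e2)[d2 /= d20 H2] := JC x.
  have : len n @[n --> \oo] --> (0 : R).
    rewrite -(mulr0 (d - c)); apply: cvgMr.
    under eq_fun do rewrite -exprVn.
    by apply: cvg_expr; rewrite ger0_norm// invf_lt1// ltr1n.
  have dd : 0 < Num.min d1 d2 by rewrite lt_min d10.
  move=> /cvgrPdist_lt/(_ _ dd)[n _ /(_ n (leqnn _))]; rewrite sub0r normrN gtr0_norm//.
  rewrite lt_min => /andP[l1 l2].
  have /andP[kx xk] := kap_itv n cx.
  set g := gr n (kap n x) in kx xk.
  have xg : `|x - g| < len n.
    by rewrite ger0_norm ?subr_ge0//; move: xk; rewrite -(grS n (kap n x)) ltrBlDr subrK.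
  have k2 : (kap n x < 2 ^ n)%N.
    by rewrite ltnNge; apply/negP => /(gr_le n); rewrite gr_end => /le_trans/(_ kx); rewrite leNgt xd.
  have := Hgr _ _ k2; rewrite -/g => E.
  have cg : c <= g by rewrite -(gr0 n) gr_le.
  have B1 : `|u g - u x| < e / 2.
    by apply: H1; rewrite ?cg ?(ltW (le_lt_trans kx xd))// distrC (lt_trans xg).
  have B2 : `|Ji v x - Ji v g| < e / 2 by apply: H2; rewrite /= (lt_trans xg).
  rewrite (_ : _ - _ = - (u g - u x) - (Ji v x - Ji v g)).
    rewrite addr0 (splitr e) (le_trans (ler_normB _ _))// normrN.
    by rewrite lerD// ltW.
  by move: E; set p1 := Ji v x; lra.
(* The endpoint d starts no cell of the grid, so it is approached from the left. *)
move=> x /andP[cx]; rewrite le_eqVlt => /orP[/eqP ->|xd]; last by rewrite Hx ?cx.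
apply/eqP; rewrite -subr_eq0 -normr_le0; apply/ler_addgt0Pl => e e0.
have e2 : 0 < e / 2 by rewrite divr_gt0.
have [|d1 d10 H1] := @abs_cont_at d _ _ e2; first by rewrite lexx ltW.
have /cvgrPdist_lt/(_ _ e2)[d2 /= d20 H2] := JC d.
pose y := Num.max c (d - Num.min d1 d2 / 2).
have dd : 0 < Num.min d1 d2 by rewrite lt_min d10.
have yd : y < d by rewrite gt_max cd gtrBl divr_gt0.
have cy : c <= y by rewrite le_max lexx.
have yd2 : `|d - y| < Num.min d1 d2.
  rewrite gtr0_norm ?subr_gt0//.
  have : d - Num.min d1 d2 / 2 <= y by rewrite le_max lexx orbT.
  by lra.
move: yd2; rewrite lt_min => /andP[y1 y2].
have B1 : `|u y - u d| < e / 2 by apply: H1; rewrite ?cy ?(ltW yd)// distrC.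
have B2 : `|Ji v d - Ji v y| < e / 2 by exact: H2.
have E : u y - u c = Ji v y - Ji v c by apply: Hx; rewrite cy yd.
rewrite (_ : _ - _ = - (u y - u d) - (Ji v d - Ji v y)).
  rewrite addr0 (splitr e) (le_trans (ler_normB _ _))// normrN.
  by rewrite lerD// ltW.
by move: E; set p1 := Ji v d; lra.
Qed.

End Grid.

(** * Derivatives, sums and products of absolutely continuous functions *)

Section AbsContCalculus.
Variable R : realType.
Notation mu := (@lebesgue_measure R).
Notation is_der x f df := (is_derive (x : R) (1 : R) (f : R -> R) (df : R)).
Implicit Types (u v k f g : R -> R) (c d x : R).

Lemma der_val f x d1 d2 : is_der x f d1 -> d1 = d2 -> is_der x f d2.
Proof. by move=> + <-. Qed.

Lemma derD f g x df dg : is_der x f df -> is_der x g dg ->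
  is_der x (fun y => f y + g y) (df + dg).
Proof. by move=> Df Dg; exact: is_deriveD. Qed.

Lemma derB f g x df dg : is_der x f df -> is_der x g dg ->
  is_der x (fun y => f y - g y) (df - dg).
Proof. by move=> Df Dg; exact: is_deriveB. Qed.

Lemma der_cst (a : R) x : is_der x (fun=> a) 0.
Proof. exact: is_derive_cst. Qed.

Lemma der_id x : is_der x id 1.
Proof. exact: is_derive_id. Qed.

Lemma derM f g x df dg : is_der x f df -> is_der x g dg ->
  is_der x (fun y => f y * g y) (df * g x + f x * dg).
Proof.
move=> Df Dg; have := is_deriveM Df Dg.
by rewrite (_ : _ *: _ + _ = df * g x + f x * dg)// /GRing.scale/= addrC [g x * _]mulrC.
Qed.

Lemma derZ f (a : R) x df : is_der x f df -> is_der x (fun y => a * f y) (a * df).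
Proof. by move=> Df; have := derM (der_cst a x) Df; rewrite mul0r add0r. Qed.

Lemma derV f x df : f x != 0 -> is_der x f df ->
  is_der x (fun y => (f y)^-1) (- df / (f x) ^+ 2).
Proof.
move=> fx Df; have := @is_deriveV R f x df 1 fx Df.
by rewrite (_ : _ *: _ = - df / f x ^+ 2)// /GRing.scale/= -exprVn !mulNr mulrC.
Qed.

Lemma der_near f g x df : (\near x, f x = g x) -> is_der x f df -> is_der x g df.
Proof. exact: near_eq_is_derive. Qed.

Lemma der_itv f g c d x df : c < x < d -> (forall y, c < y < d -> f y = g y) ->
  is_der x f df -> is_der x g df.
Proof.
move=> xcd fg; apply: der_near; have xI : x \in `]c, d[ by rewrite in_itv.
near=> y; apply: fg; have : y \in `]c, d[ by near: y; exact: near_in_itvoo.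
by rewrite in_itv.
Unshelve. all: by end_near. Qed.

Lemma cont_itv f g c d x : c < x < d -> (forall y, c < y < d -> f y = g y) ->
  {for x, continuous f} -> {for x, continuous g}.
Proof.
move=> xcd fg; rewrite /prop_for /continuous_at -(fg _ xcd) => cf.
have xI : x \in `]c, d[ by rewrite in_itv.
apply: cvg_trans cf; apply: near_eq_cvg; near=> y; apply: fg.
have : y \in `]c, d[ by near: y; exact: near_in_itvoo.
by rewrite in_itv.
Unshelve. all: by end_near. Qed.

Lemma der_derive1 f x df : is_der x f df -> derive1 f x = df.
Proof. by move=> Df; rewrite derive1E; exact: derive_val. Qed.

Lemma der_derivable f x : derivable f x 1 -> is_der x f (derive1 f x).
Proof. by move=> fx; rewrite derive1E; exact/derivableP. Qed.

Lemma der_continuous f x df : is_der x f df -> {for x, continuous f}.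
Proof. by move=> [Df _]; apply/differentiable_continuous/derivable1_diffP. Qed.

Lemma der_inj f x d1 d2 : is_der x f d1 -> is_der x f d2 -> d1 = d2.
Proof. by move=> /der_derive1 <- /der_derive1 <-. Qed.

Lemma Ji_diff_derive_ae c d u v : L1 setT v ->
  (forall x, c <= x <= d -> u x - u c = Ji v x - Ji v c) ->
  {ae mu, forall x, c < x < d -> is_der x u (v x)}.
Proof.
move=> Iv uv; apply: aeS (Ji_ae_derive Iv) => x dx xcd.
apply: (@der_itv (fun x => Ji v x + (u c - Ji v c)) _ c d) => //.
  move=> y /andP[cy yd]; have := uv y; rewrite (ltW cy) (ltW yd) => /(_ isT).
  by move=> h; lra.
by rewrite -[v x]addr0; apply: derD => //; exact: der_cst.
Qed.

Lemma abs_cont_derivable_ae c d u : c < d -> abs_cont c d u ->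
  {ae mu, forall x, c < x < d -> derivable u x 1}.
Proof.
move=> cd uac; have [v Iv uv] := abs_cont_integral cd uac.
by apply: aeS (Ji_diff_derive_ae Iv uv) => x h /h[].
Qed.

Lemma L1_itv_Ji v k c x : L1 setT v -> L1 setT k -> c <= x ->
  {ae mu, forall y, c < y < x -> v y = k y} -> Ji v x - Ji v c = Ji k x - Ji k c.
Proof.
move=> Iv Ik cx vk; rewrite !JiB//.
have Ivo : L1 `]c, x[ v by exact: L1_sub Iv.
have Iko : L1 `]c, x[ k by exact: L1_sub Ik.
rewrite -!Rintegral_itv_bndo_bndc//; by apply: Int_ae_eq => //; exact: L1_meas.
Qed.

(** The density supplied by [abs_cont_integral] is a.e. the derivative of u, hence a.e. equal to
    k. *)
Lemma abs_cont_FTC c d u k : c < d -> abs_cont c d u -> L1 setT k ->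
  {ae mu, forall x, c < x < d -> is_der x u (k x)} ->
  forall x, c <= x <= d -> u x - u c = Ji k x - Ji k c.
Proof.
move=> cd uac Ik uk; have [v Iv uv] := abs_cont_integral cd uac.
move=> x /andP[cx xd]; rewrite uv ?cx//; apply: L1_itv_Ji => //.
apply: aeS (aeI uk (Ji_diff_derive_ae Iv uv)) => y [h1 h2] /andP[cy yx].
have ycd : c < y < d by rewrite cy (lt_le_trans yx).
exact: der_inj (h2 ycd) (h1 ycd).
Qed.

Lemma abs_cont_eq c d u v : (forall x, c <= x <= d -> u x = v x) ->
  abs_cont c d u -> abs_cont c d v.
Proof.
move=> uv uac e e0; have [dl dl0 H] := uac e e0; exists dl => // n l r lr dis ld.
rewrite (eq_bigr (fun i => `|u (r i) - u (l i)|)); first exact: H.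
move=> i _; have [cl lri rd] := lr i.
by rewrite !uv ?cl ?rd ?(le_trans cl)// (le_trans lri).
Qed.

Lemma lipschitz_abs_cont c d u (M : R) : 0 < M ->
  (forall x y, c <= x -> x <= y -> y <= d -> `|u y - u x| <= M * (y - x)) ->
  abs_cont c d u.
Proof.
move=> M0 HM e e0; exists (e / M); first by rewrite divr_gt0.
move=> n l r lr _; rewrite ltr_pdivlMr// mulrC mulr_sumr; apply: le_lt_trans.
by apply: ler_sum => i _; have [cl lri rd] := lr i; exact: HM.
Qed.

Lemma abs_contD c d u v : abs_cont c d u -> abs_cont c d v ->
  abs_cont c d (fun x => u x + v x).
Proof.
move=> uac vac e e0; have e2 : 0 < e / 2 by rewrite divr_gt0.
have [d1 d10 H1] := uac _ e2; have [d2 d20 H2] := vac _ e2.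
exists (Num.min d1 d2); first by rewrite lt_min d10.
move=> n l r lr dis; rewrite lt_min => /andP[l1 l2].
apply: le_lt_trans (_ : \sum_(i < n) (`|u (r i) - u (l i)| + `|v (r i) - v (l i)|) < _).
  by apply: ler_sum => i _; rewrite opprD addrACA ler_normD.
by rewrite big_split/= (splitr e) ltrD ?H1 ?H2.
Qed.

Lemma abs_cont_bounded c d u : c < d -> abs_cont c d u ->
  exists2 M, 0 < M & forall x, c <= x <= d -> `|u x| <= M.
Proof.
move=> cd uac; have [v Iv uv] := abs_cont_integral cd uac.
exists (`|u c| + \int[mu]_x `|v x| + 1).
  by rewrite ltr_wpDl// addr_ge0//; apply: Int_ge0.
move=> x /[dup] xcd /andP[cx xd].
have -> : u x = u c + (Ji v x - Ji v c) by rewrite -uv// addrC subrK.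
apply: le_trans (ler_normD _ _) _; rewrite -addrA lerD2l ler_wpDr//.
apply: le_trans (Ji_abs Iv cx) _; apply: Int_subset => //; exact: L1_norm.
Qed.

Lemma abs_contM c d u v : c < d -> abs_cont c d u -> abs_cont c d v ->
  abs_cont c d (fun x => u x * v x).
Proof.
move=> cd uac vac e e0.
have [M M0 HM] := abs_cont_bounded cd uac; have [N N0 HN] := abs_cont_bounded cd vac.
have e1 : 0 < e / 2 / N by rewrite !divr_gt0.
have e2 : 0 < e / 2 / M by rewrite !divr_gt0.
have [d1 d10 H1] := uac _ e1; have [d2 d20 H2] := vac _ e2.
exists (Num.min d1 d2); first by rewrite lt_min d10.
move=> n l r lr dis; rewrite lt_min => /andP[l1 l2].
apply: le_lt_trans (_ : \sum_(i < n) (N * `|u (r i) - u (l i)| + M * `|v (r i) - v (l i)|) < _).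
  apply: ler_sum => i _; have [cl lri rd] := lr i.
  rewrite (_ : _ - _ = (u (r i) - u (l i)) * v (r i) + u (l i) * (v (r i) - v (l i))); last by ring.
  apply: le_trans (ler_normD _ _) _; rewrite !normrM lerD//.
    by rewrite mulrC ler_wpM2r// HN// rd (le_trans cl).
  by rewrite ler_wpM2r// HM// cl (le_trans lri).
rewrite big_split/= -!mulr_sumr (splitr e) ltrD//.
  by rewrite mulrC -ltr_pdivlMr// H1.
by rewrite mulrC -ltr_pdivlMr// H2.
Qed.

Lemma C1_abs_cont c d u du : c < d -> (forall x, c <= x <= d -> is_der x u (du x)) ->
  (exists M, forall x, c <= x <= d -> `|du x| <= M) -> abs_cont c d u.
Proof.
move=> cd Du [M HM]; apply: (@lipschitz_abs_cont _ _ _ (`|M| + 1)).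
  by rewrite ltr_wpDl.
move=> x y cx xy yd; move: xy; rewrite le_eqVlt => /orP[/eqP ->|xy].
  by rewrite !subrr normr0 mulr0.
have I z : z \in `]x, y[ -> c <= z <= d.
  by rewrite in_itv/= => /andP[xz zy]; rewrite (le_trans cx (ltW xz)) (le_trans (ltW zy)).
have [||z zxy ->] := @MVT R u du x y xy.
- by move=> z /I; exact: Du.
- apply: continuous_in_subspaceT => z /set_mem/=; rewrite in_itv/= => /andP[xz zy].
  apply: der_continuous (Du z _); rewrite (le_trans cx xz) (le_trans zy)//.
rewrite normrM (gtr0_norm (_ : 0 < y - x)) ?subr_gt0// ler_wpM2r ?subr_ge0 ?ltW//.
by rewrite (le_lt_trans (HM _ (I _ zxy)))// (le_lt_trans (ler_norm _))// ltrDl.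
Qed.

End AbsContCalculus.

(** * Integration by parts for primitives *)

Section IntegrationByParts.
Variable R : realType.
Notation mu := (@lebesgue_measure R).
Implicit Types (v w g : R -> R).

Lemma L1_mul_bounded (D : set R) v g (M : R) : measurable D -> L1 D v -> measurable_fun D g ->
  (forall x, D x -> `|g x| <= M) -> L1 D (fun x => g x * v x).
Proof.
move=> mD Iv mg gM; apply: (@L1_le _ _ (fun x => M * `|v x|)) => //.
- by apply: measurable_funM => //; exact: L1_meas.
- by move=> x Dx; rewrite normrM ler_wpM2r// gM.
- by apply: L1Z => //; exact: L1_norm.
Qed.

Lemma Ji_le v x : L1 setT v -> `|Ji v x| <= \int[mu]_t `|v t|.
Proof.
move=> Iv; apply: le_trans (Int_norm _ _) _ => //; first exact: L1_sub Iv.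
by apply: Int_subset => //; exact: L1_norm.
Qed.

Lemma Ji_measurable v : L1 setT v -> measurable_fun setT (Ji v).
Proof. by move=> Iv; apply: continuous_measurable_fun; exact: Ji_cont. Qed.

Lemma L1M_Ji v w : L1 setT v -> L1 setT w -> L1 setT (fun x => v x * Ji w x).
Proof.
move=> Iv Iw; apply: (@L1_eq _ _ (fun x => Ji w x * v x)) => //.
  by move=> x _; rewrite mulrC.
apply: (@L1_mul_bounded _ _ _ (\int[mu]_t `|w t|)) => //; first exact: Ji_measurable.
by move=> x _; exact: Ji_le.
Qed.

(** Fubini for v(x) w(y) on the half-plane y <= x: one order of integration gives the first
    integral, the other gives the product minus the second integral. *)
Lemma Ji_parts v w : L1 setT v -> L1 setT w ->
  \int[mu]_x (v x * Ji w x) + \int[mu]_x (w x * Ji v x) =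
  (\int[mu]_x v x) * (\int[mu]_x w x).
Proof.
move=> Iv Iw.
have mv : measurable_fun setT v by exact: L1_meas.
have mw : measurable_fun setT w by exact: L1_meas.
pose f (p : measurableTypeR R * measurableTypeR R) : \bar R :=
  (v p.1 * w p.2 * (p.2 <= p.1)%R%:R)%:E.
have mf : measurable_fun setT f.
  apply/measurable_EFinP; apply: measurable_funM.
    apply: measurable_funM.
      exact: measurableT_comp mv (measurable_fst).
    exact: measurableT_comp mw (measurable_snd).
  apply: (@measurableT_comp _ _ _ _ _ _ (fun b : bool => b%:R : R)) => //.
  by apply: measurable_fun_ler; [exact: measurable_snd|exact: measurable_fst].
have Iaw : L1 setT (fun x => `|w x|) by exact: L1_norm.
have If : (mu \x mu)%E.-integrable setT f.
  apply/integrable12ltyP => //.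
  apply: (@le_lt_trans _ _ (\int[mu]_x (`|v x| * \int[mu]_y `|w y|)%:E)%E).
    apply: ge0_le_integral => //.
    - by move=> x _; exact: integral_ge0.
    - by apply: (measurable_fun_fubini_tonelli_F (abse \o f)) => //=; exact: measurableT_comp.
    - by apply/measurable_EFinP; apply: measurable_funM => //; exact: measurableT_comp.
    - move=> x _; rewrite EFinM -L1_EFin//.
      rewrite -ge0_integralZl//; last by apply/measurable_EFinP; exact: measurableT_comp.
      apply: ge0_le_integral => //.
      + by apply: measurableT_comp => //; exact: (measurableT_comp mf (measurable_pair1 x)).
      + by apply/measurable_EFinP; apply: measurable_funM => //; exact: measurableT_comp.
      + move=> y _; rewrite /f /= -EFinM lee_fin !normrM; case: (y <= x);
          by rewrite ?normr1 ?normr0 ?mulr1 ?mulr0// mulr_ge0.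
  apply: L1_lty => //; apply: (@L1_eq _ _ (fun x => (\int[mu]_y `|w y|) * `|v x|)) => //.
    by move=> x _; rewrite mulrC.
  by apply: L1Z => //; exact: L1_norm.
have F := Fubini If.
have E1 x : (\int[mu]_y f (x, y) = (v x * Ji w x)%:E)%E.
  have mx : measurable (`]-oo, x] : set R) by exact: measurable_itv.
  have Iwx : L1 `]-oo, x] w by exact: (L1_sub measurableT mx (@subsetT _ _) Iw).
  rewrite EFinM /Ji -(L1_EFin mx Iwx) -integralZl; [|exact: mx|exact: Iwx].
  rewrite [RHS]integral_mkcond.
  apply: eq_integral => y _; rewrite /f /= patchE.
  case: ifPn; rewrite ?inE ?notin_setE/= in_itv/=; first by move=> ->; rewrite mulr1.
  by move/negP/negbTE ->; rewrite mulr0.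
have E2 y : (\int[mu]_x f (x, y) = (w y * (\int[mu]_x v x - Ji v y))%:E)%E.
  have my : measurable (`[y, +oo[ : set R) by exact: measurable_itv.
  have -> : \int[mu]_x v x - Ji v y = \int[mu]_(x in `[y, +oo[) v x.
    rewrite -Rintegral_itv_obnd_cbnd; last first.
      by exact: (L1_sub measurableT (measurable_itv _) (@subsetT _ _) Iv).
    rewrite -(@Rintegral_itvB R v -oo%O +oo%O y)//; last by rewrite set_itvNyy.
    by rewrite set_itvNyy.
  have Ivy : L1 `[y, +oo[ v by exact: (L1_sub measurableT my (@subsetT _ _) Iv).
  rewrite EFinM -(L1_EFin my Ivy) -integralZl; [|exact: my|exact: Ivy].
  rewrite [RHS]integral_mkcond.
  apply: eq_integral => x _; rewrite /f /= patchE.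
  case: ifPn; rewrite ?inE ?notin_setE/= in_itv/= andbT.
    by move=> ->; rewrite mulr1 [v x * _]mulrC.
  by move/negP/negbTE ->; rewrite mulr0.
have G : \int[mu]_x (v x * Ji w x) = \int[mu]_y (w y * (\int[mu]_x v x - Ji v y)).
  rewrite /Rintegral; congr fine.
  under eq_integral do rewrite -E1.
  by rewrite F; apply: eq_integral => y _; rewrite E2.
rewrite G (Int_eq (g := fun y => (\int[mu]_x v x) * w y - w y * Ji v y)); last first.
  by move=> y _; ring.
by rewrite (IntB measurableT (L1Z _ measurableT Iw) (L1M_Ji Iw Iv)) subrK (IntZ _ measurableT Iw).
Qed.

End IntegrationByParts.

(** * Integrability of powers at the endpoints *)

Section ImproperIntegrable.
Variable R : realType.
Notation mu := (@lebesgue_measure R).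
Notation is_der x f df := (is_derive (x : R) (1 : R) (f : R -> R) (df : R)).
Implicit Types (u U : R -> R).

Lemma continuous_meas_oo (a b : R) u : (forall x, a < x < b -> {for x, continuous u}) ->
  measurable_fun `]a, b[ u.
Proof.
move=> cu; apply: open_continuous_measurable_fun; first exact: interval_open.
by move=> x; rewrite inE/= in_itv/=; exact: cu.
Qed.

Lemma cc_FTC (a b : R) u U : a < b -> (forall x, a <= x <= b -> is_der x U (u x)) ->
  (forall x, a <= x <= b -> {for x, continuous u}) ->
  L1 `[a, b] u /\ \int[mu]_(x in `[a, b]) u x = U b - U a.
Proof.
move=> ab DU cu.
have cuw : {within `[a, b], continuous u}.
  by apply: continuous_in_subspaceT => x /set_mem/=; rewrite in_itv/=; exact: cu.
split.
  by apply: continuous_compact_integrable => //; exact: segment_compact.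
rewrite /Rintegral (@continuous_FTC2 _ u U)//.
- split.
  + move=> x; rewrite in_itv/= => /andP[ax xb]; apply: (@ex_derive _ _ _ _ _ _ _ (DU x _)).
    by rewrite !ltW.
  + by apply: cvg_at_right_filter; apply: (der_continuous (DU _ _)); rewrite lexx ltW.
  + by apply: cvg_at_left_filter; apply: (der_continuous (DU _ _)); rewrite lexx ltW.
- move=> x; rewrite in_itv/= => /andP[ax xb]; apply: (der_derive1 (DU x _)).
  by rewrite !ltW.
Qed.

(** Monotone convergence over closed subintervals that exhaust (a, b): on each of them the integral
    is a difference of values of U, hence at most 2 M. *)
Lemma bounded_primitive_L1 (a b : R) u U (M : R) : a < b ->
  (forall x, a < x < b -> is_der x U (u x)) ->
  (forall x, a < x < b -> {for x, continuous u}) ->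
  (forall x, a < x < b -> 0 <= u x) -> (forall x, a < x < b -> `|U x| <= M) ->
  L1 `]a, b[ u.
Proof.
move=> ab DU cu u0 UM.
have mu_ : measurable_fun `]a, b[ u by exact: continuous_meas_oo.
apply: L1_ge0P => //.
(* Denominators from 3 on keep [a + h n, b - h n] nondegenerate. *)
pose h n : R := (b - a) / n.+3%:R.
have ba0 : 0 < b - a by rewrite subr_gt0.
have h0 n : 0 < h n by rewrite divr_gt0.
have h3 n : h n <= (b - a) / 3 by rewrite ler_pM2l// lef_pV2 ?posrE// ler_nat.
have hd : {homo h : i j / (i <= j)%N >-> j <= i}.
  by move=> i j ij; rewrite ler_pM2l// lef_pV2 ?posrE// ler_nat.
have ah n : a < a + h n by rewrite ltrDl.
have bh n : b - h n < b by rewrite gtrBl.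
have abh n : a + h n < b - h n by have := h3 n; lra.
pose F n := `[a + h n, b - h n]%classic.
have FI n x : F n x -> a < x < b.
  by rewrite /F/= in_itv/= => /andP[ax xb]; rewrite (lt_le_trans (ah n))// (le_lt_trans xb).
have UF : \bigcup_n F n = `]a, b[%classic.
  apply/seteqP; split=> x.
    by move=> [n _] /FI; rewrite /= in_itv.
  rewrite /= in_itv/= => /andP[ax xb].
  have : h n @[n --> \oo] --> (0 : R).
    rewrite -(mulr0 (b - a)); apply: cvgMr.
    rewrite (_ : (fun n => n.+3%:R^-1) = (fun n => harmonic (n + 2)%N)).
      by rewrite cvg_shiftn; exact: cvg_harmonic.
    by apply/funext => n; rewrite /harmonic/= addn2.
  have m0 : 0 < Num.min (x - a) (b - x) by rewrite lt_min !subr_gt0 ax.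
  move=> /cvgrPdist_lt/(_ _ m0)[n _ /(_ n (leqnn _))].
  rewrite sub0r normrN gtr0_norm// lt_min => /andP[h1 h2]; exists n => //.
  by rewrite /F/= in_itv/=; apply/andP; split; lra.
have Fb n : (\int[mu]_(x in F n) (u x)%:E <= (M + M)%:E)%E.
  have inI x : a + h n <= x <= b - h n -> a < x < b by move=> hx; apply: (FI n); rewrite /F/= in_itv.
  have [I1 E1] := cc_FTC (abh n) (fun x hx => DU x (inI x hx)) (fun x hx => cu x (inI x hx)).
  rewrite /F L1_EFin// E1 lee_fin (le_trans (ler_norm _))// (le_trans (ler_normB _ _))//.
  by rewrite lerD// UM// inI// lexx ltW.
rewrite -UF.
have : ((\int[mu]_(x in F i) (u x)%:E) @[i --> \oo] --> \int[mu]_(x in \bigcup_i F i) (u x)%:E)%E.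
  apply: ge0_nondecreasing_set_cvg_integral => //.
  - apply/nondecreasing_seqP => n; rewrite subsetEset => x; rewrite /F/= !in_itv/=.
    by have := hd n n.+1 (leqnSn n); move=> hh /andP[h1 h2]; apply/andP; split; lra.
  - by move=> n; exact: measurable_itv.
  - by move=> n; apply/measurable_EFinP; apply: measurable_funS mu_ => // x /FI; rewrite /= in_itv.
  - by move=> n x /FI xI; rewrite lee_fin u0.
move=> cF; apply: (@le_lt_trans _ _ (M + M)%:E); last by rewrite ltry.
rewrite -(cvg_lim _ cF)//; apply: lime_le; first by apply: cvgP cF.
exact: nearW.
Qed.

End ImproperIntegrable.

Section JacobiWeights.
Variables (R : realType) (alpha beta : R).
Hypotheses (halpha : 0 < alpha < 1) (hbeta : 0 < beta < 1).
Notation is_der x f df := (is_derive (x : R) (1 : R) (f : R -> R) (df : R)).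
Notation I := (`]-1, 1[%classic : set R).

Lemma der_powRB (e x : R) : 0 < 1 - x ->
  is_der x (fun x => (1 - x) `^ e) (- (e * (1 - x) `^ (e - 1))).
Proof.
move=> x1; rewrite -[- (e * _)]mulrN1.
apply: (@is_derive1_comp R (fun y => y `^ e) (fun x => 1 - x)).
  exact: is_derive1_powR.
by rewrite -[-1]sub0r; apply: derB.
Qed.

Lemma der_powRD (e x : R) : 0 < 1 + x ->
  is_der x (fun x => (1 + x) `^ e) (e * (1 + x) `^ (e - 1)).
Proof.
move=> x1; rewrite -[X in is_derive _ _ _ X]mulr1.
apply: (@is_derive1_comp R (fun y => y `^ e) (fun x => 1 + x)).
  exact: is_derive1_powR.
by rewrite -[X in is_derive _ _ _ X]add0r; apply: derD.
Qed.

Lemma inI (x : R) : -1 < x < 1 -> 0 < 1 - x /\ 0 < 1 + x.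
Proof. by move=> /andP[x0 x1]; split; lra. Qed.

Lemma powR_le2 (e x : R) : e <= 1 -> 0 < x < 2 -> 1 <= x -> x `^ e <= 2.
Proof.
move=> e1 /andP[_ x2] x1; apply: (@le_trans _ _ (x `^ 1)); first exact: ler_powR.
by rewrite powRr1 ?(le_trans ler01)// ltW.
Qed.

Lemma powR_L1 (s t : R) : -1 < s -> s < 1 -> -1 < t -> t < 1 ->
  L1 I (fun x => (1 - x) `^ s * (1 + x) `^ t).
Proof.
move=> s0 s1 t0 t1; have N11 : (-1 : R) < 1 by lra.
have Is : L1 I (fun x => (1 - x) `^ s).
  have e0 : 0 < s + 1 by lra.
  apply: (@bounded_primitive_L1 _ _ _ _ (fun x => (- (s + 1)^-1) * (1 - x) `^ (s + 1)) ((s + 1)^-1 * 2 `^ (s + 1))).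
  - exact: N11.
  - move=> x /inI[x0 _]; have := derZ (- (s + 1)^-1) (der_powRB (s + 1) x0).
    by rewrite mulrNN mulrA mulVf ?gt_eqF// mul1r addrK.
  - by move=> x /inI[x0 _]; exact: der_continuous (der_powRB s x0).
  - by move=> x _; exact: powR_ge0.
  - move=> x xI; have [x0 x1] := inI xI.
    rewrite normrM normrN (ger0_norm (powR_ge0 _ _)) gtr0_norm ?invr_gt0// ler_wpM2l ?invr_ge0 ?(ltW e0)//.
    apply: ge0_ler_powR; rewrite ?nnegrE ?(ltW e0)//; lra.
have It : L1 I (fun x => (1 + x) `^ t).
  have e0 : 0 < t + 1 by lra.
  apply: (@bounded_primitive_L1 _ _ _ _ (fun x => (t + 1)^-1 * (1 + x) `^ (t + 1)) ((t + 1)^-1 * 2 `^ (t + 1))).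
  - exact: N11.
  - move=> x /inI[_ x0]; have := derZ (t + 1)^-1 (der_powRD (t + 1) x0).
    by rewrite mulrA mulVf ?gt_eqF// mul1r addrK.
  - by move=> x /inI[_ x0]; exact: der_continuous (der_powRD t x0).
  - by move=> x _; exact: powR_ge0.
  - move=> x xI; have [x0 x1] := inI xI.
    rewrite normrM (ger0_norm (powR_ge0 _ _)) gtr0_norm ?invr_gt0// ler_wpM2l ?invr_ge0 ?(ltW e0)//.
    apply: ge0_ler_powR; rewrite ?nnegrE ?(ltW e0)//; lra.
apply: (@L1_le _ _ (fun x => 2 * ((1 - x) `^ s + (1 + x) `^ t))) => //.
- by apply: measurable_funM; [exact: L1_meas Is|exact: L1_meas It].
- move=> x /=; rewrite in_itv/= => xI; have [x0 x1] := inI xI.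
  have a0 := powR_ge0 (1 - x) s; have b0 := powR_ge0 (1 + x) t.
  rewrite ger0_norm ?mulr_ge0//.
  (* On each half of the interval one of the two bases lies in [1, 2), and its power is at most
     2. *)
  have [xp|xn] := leP 0 x.
    have : (1 + x) `^ t <= 2 by apply: powR_le2; lra.
    by nra.
  have : (1 - x) `^ s <= 2 by apply: powR_le2; lra.
  by nra.
- by apply: L1Z => //; exact: L1D.
Qed.

End JacobiWeights.

(** * The regularizing substitution f = phi z *)

Local Opaque Rintegral.

Section JacobiReal.
Variables (R : realType) (alpha beta : R).
Hypotheses (halpha : 0 < alpha < 1) (hbeta : 0 < beta < 1).
Notation mu := (@lebesgue_measure R).
Notation is_der x f df := (is_derive (x : R) (1 : R) (f : R -> R) (df : R)).
Notation w := (weight alpha beta).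
Notation I := (`]-1, 1[%classic : set R).
Implicit Types (u h f g : R -> R) (x : R).

Definition jQ x : R := (1 - x) * (1 + x).
(** [jB] is p phi', and [jB / jQ] is the logarithmic derivative of [phi]. *)
Definition jB x : R := alpha * (1 + x) - beta * (1 - x).
Definition phi x : R := (w x)^-1.
Definition rr x : R := w x / jQ x.

Let N11 : (-1 : R) < 1. Proof. by lra. Qed.
Let inIP x : I x -> -1 < x < 1. Proof. by rewrite /= in_itv. Qed.
Let mI : measurable I. Proof. exact: measurable_itv. Qed.

Lemma powR_succ (e x : R) : 0 < x -> x `^ (e + 1) = x `^ e * x.
Proof. by move=> x0; rewrite powRD ?powRr1 ?(ltW x0)// (gt_eqF x0) implybT. Qed.

Lemma powR_pred (e x : R) : 0 < x -> x `^ (e - 1) = x `^ e / x.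
Proof. by move=> x0; rewrite powRB ?powRr1 ?(ltW x0)// (gt_eqF x0) implybT. Qed.

Lemma w_gt0 x : -1 < x < 1 -> 0 < w x.
Proof. by move=> /inI[x0 x1]; rewrite mulr_gt0// powR_gt0. Qed.

Lemma phi_gt0 x : -1 < x < 1 -> 0 < phi x.
Proof. by move=> xI; rewrite invr_gt0 w_gt0. Qed.

Lemma jQ_gt0 x : -1 < x < 1 -> 0 < jQ x.
Proof. by move=> /inI[x0 x1]; rewrite mulr_gt0. Qed.

Lemma rr_gt0 x : -1 < x < 1 -> 0 < rr x.
Proof. by move=> xI; rewrite divr_gt0 ?w_gt0 ?jQ_gt0. Qed.

Lemma pJE x : -1 < x < 1 -> pJ alpha beta x = jQ x * w x.
Proof.
move=> /inI[x0 x1]; rewrite /pJ /jQ /weight !powR_succ//; ring.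
Qed.

Lemma der_w x : -1 < x < 1 -> is_der x w (- (w x * jB x / jQ x)).
Proof.
move=> xI; have [x0 x1] := inI xI.
apply: (der_val (derM (der_powRB alpha x0) (der_powRD beta x1))).
rewrite !powR_pred// /weight /jB /jQ.
by field; rewrite !gt_eqF.
Qed.

Lemma der_phi x : -1 < x < 1 -> is_der x phi (phi x * jB x / jQ x).
Proof.
move=> xI; have w0 := w_gt0 xI; have q0 := jQ_gt0 xI.
apply: (der_val (derV (lt0r_neq0 w0) (der_w xI))); rewrite /phi.
by field; rewrite !gt_eqF.
Qed.

Lemma der_jQ x : is_der x jQ (- 2 * x).
Proof.
have D1 : is_der x (fun x => 1 - x) (-1).
  by rewrite -[-1]sub0r; apply: derB.
have D2 : is_der x (fun x => 1 + x) 1.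
  by rewrite -[X in is_derive _ _ _ X]add0r; apply: derD.
by apply: (der_val (derM D1 D2)); ring.
Qed.

Lemma der_jB x : is_der x jB (alpha + beta).
Proof.
have D1 : is_der x (fun x => 1 - x) (-1).
  by rewrite -[-1]sub0r; apply: derB.
have D2 : is_der x (fun x => 1 + x) 1.
  by rewrite -[X in is_derive _ _ _ X]add0r; apply: derD.
by apply: (der_val (derB (derZ alpha D2) (derZ beta D1))); ring.
Qed.

Lemma der_rr x : -1 < x < 1 -> exists d, is_der x rr d.
Proof.
move=> xI; have q0 := lt0r_neq0 (jQ_gt0 xI).
by eexists; apply: derM (der_w xI) (derV q0 (der_jQ x)).
Qed.

Lemma w_le4 x : -1 < x < 1 -> w x <= 4.
Proof.
move=> xI; have [x0 x1] := inI xI.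
have key (e y : R) : 0 < e < 1 -> 0 < y < 2 -> y `^ e <= 2.
  move=> /andP[e0 e1] y02; have [y1|y1] := leP 1 y.
    by apply: powR_le2 => //; exact: ltW.
  apply: (@le_trans _ _ 1); last by lra.
  have -> : 1 = 1 `^ e :> R by rewrite powR1.
  apply: ge0_ler_powR; rewrite ?nnegrE//; first exact: ltW.
  - by case/andP: y02 => /ltW.
  - exact: ltW.
have a1 := key alpha (1 - x) halpha.
have b1 := key beta (1 + x) hbeta.
rewrite /weight (_ : 4 = 2 * 2); last by ring.
by apply: ler_pM; rewrite ?powR_ge0//; [apply: a1|apply: b1]; case/andP: xI => ? ?; lra.
Qed.

Lemma L1_phi : L1 I phi.
Proof.
case/andP: halpha => a0 a1; case/andP: hbeta => b0 b1.
apply: (@L1_eq _ _ (fun x => (1 - x) `^ (- alpha) * (1 + x) `^ (- beta))) => //.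
  by move=> x _; rewrite !powRN /phi /weight invfM.
by apply: powR_L1; lra.
Qed.

Lemma L1_rr : L1 I rr.
Proof.
case/andP: halpha => a0 a1; case/andP: hbeta => b0 b1.
apply: (@L1_eq _ _ (fun x => (1 - x) `^ (alpha - 1) * (1 + x) `^ (beta - 1))) => //.
  move=> x /inIP xI; have [x0 x1] := inI xI.
  rewrite /rr /weight /jQ !powR_pred//.
  by rewrite invfM; ring.
by apply: powR_L1; lra.
Qed.

Lemma w_meas : measurable_fun I w.
Proof. by apply: continuous_meas_oo => x xI; exact: der_continuous (der_w xI). Qed.

Lemma L1_patch f : L1 I f -> L1 setT (f \_ I).
Proof.
move=> If; rewrite /L1 -restrict_EFin.
by apply/(integrable_mkcond _ _).1.
Qed.

Lemma patchI f x : -1 < x < 1 -> (f \_ I) x = f x.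
Proof. by move=> xI; rewrite patchE mem_set//= in_itv. Qed.

Lemma Ji_patch_left f x : x <= -1 -> Ji (f \_ I) x = 0.
Proof.
move=> x1; rewrite /Ji (Int_eq (g := fun=> 0)) ?Rintegral_cst ?mul0r//.
move=> y /=; rewrite in_itv/= => yx; rewrite patchE memNset//= in_itv/= => /andP[y1 _].
by move: (lt_le_trans y1 (le_trans yx x1)); rewrite ltxx.
Qed.

Lemma Ji_patch_right f : L1 I f -> Ji (f \_ I) 1 = \int[mu]_(x in I) f x.
Proof.
move=> If; rewrite -[LHS]subr0 -(@Ji_patch_left f (-1))// JiB//; last exact: L1_patch.
have If' := L1_patch If.
rewrite -Rintegral_itv_bndo_bndc; last by apply: (L1_sub _ _ _ If').
by apply: Int_eq => x /inIP xI; rewrite patchI.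
Qed.

Lemma Int_patch f : \int[mu]_(x in I) f x = \int[mu]_x (f \_ I) x.
Proof. exact: Rintegral_mkcond. Qed.

Definition L2w h : Prop := measurable_fun I h /\ L1 I (fun x => h x ^+ 2 * w x).

Lemma L2wM f g : L2w f -> L2w g -> L1 I (fun x => f x * g x * w x).
Proof.
move=> [mf If] [mg Ig]; apply: (@L1_le _ _ (fun x => f x ^+ 2 * w x + g x ^+ 2 * w x)) => //.
- by apply: measurable_funM; [exact: measurable_funM|exact: w_meas].
- move=> x /inIP xI; have w0 := w_gt0 xI.
  rewrite normrM (gtr0_norm w0) -mulrDl ler_pM2r// normrM.
  rewrite -(real_normK (num_real (f x))) -(real_normK (num_real (g x))).
  by have := sqr_ge0 (`|f x| - `|g x|); have := sqr_ge0 (`|f x| + `|g x|); nra.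
- exact: L1D.
Qed.

Lemma L2w_lin f g (c : R) : L2w f -> L2w g -> L2w (fun x => f x + c * g x).
Proof.
move=> Lf Lg; have [mf If] := Lf; have [mg Ig] := Lg.
split; first by apply: measurable_funD => //; exact: measurable_funM.
apply: (@L1_eq _ _ (fun x => f x ^+ 2 * w x + (2 * c) * (f x * g x * w x) + c ^+ 2 * (g x ^+ 2 * w x))) => //.
  by move=> x _; ring.
by apply: L1D => //; [apply: L1D => //|]; apply: L1Z => //; exact: L2wM.
Qed.

(** Cauchy-Schwarz against the integrable function 1 / w, in the pointwise form |h| <= h^2 w + 1 /
    w. *)
Lemma L2w_L1 h : L2w h -> L1 I h.
Proof.
move=> [mh Ih]; apply: (@L1_le _ _ (fun x => h x ^+ 2 * w x + phi x)) => //; last first.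
  by apply: L1D => //; exact: L1_phi.
move=> x /inIP xI; have w0 := w_gt0 xI.
rewrite -(ler_pM2r w0) mulrDl /phi mulVf ?gt_eqF//.
have -> : h x ^+ 2 * w x * w x = (`|h x| * w x) ^+ 2.
  by rewrite exprMn real_normK ?num_real//; ring.
set t := _ * w x; have := sqr_ge0 (t - 1); have := sqr_ge0 t; nra.
Qed.

(** Since phi w = 1, the density (phi z)^2 w is z^2 phi, and phi is integrable. *)
Lemma L2w_phiM (z : R -> R) (M : R) : measurable_fun I z -> (forall x, I x -> `|z x| <= M) ->
  L2w (fun x => phi x * z x).
Proof.
move=> mz zM; have mp : measurable_fun I phi by exact: L1_meas L1_phi.
split; first exact: measurable_funM.
apply: (@L1_le _ _ (fun x => M ^+ 2 * phi x)) => //.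
- by apply: measurable_funM; [apply: measurable_funX; exact: measurable_funM|exact: w_meas].
- move=> x xI; have w0 := w_gt0 (inIP xI); have p0 := phi_gt0 (inIP xI).
  rewrite (_ : _ * w x = z x ^+ 2 * phi x); last by rewrite /phi; field; rewrite gt_eqF.
  rewrite normrM (gtr0_norm p0) ler_pM2r// normrX.
  by rewrite ler_pXn2r ?nnegrE ?zM// (le_trans _ (zM _ xI)).
- by apply: L1Z => //; exact: L1_phi.
Qed.

Lemma L2w_eq f g : (forall x, I x -> f x = g x) -> L2w f -> L2w g.
Proof.
move=> fg [mf If]; split; first by apply: eq_measurable_fun mf => x /set_mem; exact: fg.
by apply: L1_eq If => // x xI; rewrite fg.
Qed.

(* The solution of y' = h, z' = - rr y with values y0 and z0 at -1. *)
Definition Yf (y0 : R) h x := y0 + Ji (h \_ I) x.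
Definition Zf (z0 y0 : R) h x := z0 - Ji ((fun t => rr t * Yf y0 h t) \_ I) x.

Lemma Yf_cont y0 h : L1 I h -> continuous (Yf y0 h).
Proof. by move=> Ih x; apply: cvgD; [exact: cvg_cst|exact: (Ji_cont (L1_patch Ih))]. Qed.

Lemma Yf_bounded y0 h x : L1 I h -> `|Yf y0 h x| <= `|y0| + \int[mu]_t `|(h \_ I) t|.
Proof.
move=> Ih; apply: le_trans (ler_normD _ _) _; rewrite lerD2l.
by apply: Ji_le; exact: L1_patch.
Qed.

Lemma L1_rrY y0 h : L1 I h -> L1 I (fun t => rr t * Yf y0 h t).
Proof.
move=> Ih; apply: (@L1_eq _ _ (fun t => Yf y0 h t * rr t)) => //.
  by move=> x _; rewrite mulrC.
apply: (L1_mul_bounded mI L1_rr) => [|x _]; last exact: Yf_bounded.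
by apply: measurable_funTS; apply: continuous_measurable_fun; exact: Yf_cont.
Qed.

Lemma Zf_cont z0 y0 h : L1 I h -> continuous (Zf z0 y0 h).
Proof.
move=> Ih x; apply: cvgB; first exact: cvg_cst.
exact: (Ji_cont (L1_patch (L1_rrY y0 Ih))).
Qed.

Lemma Zf_bounded z0 y0 h : L1 I h -> exists M, forall x, `|Zf z0 y0 h x| <= M.
Proof.
move=> Ih; exists (`|z0| + \int[mu]_t `|((fun t => rr t * Yf y0 h t) \_ I) t|) => x.
apply: le_trans (ler_normB _ _) _; rewrite lerD2l.
by apply: Ji_le; exact: L1_patch (L1_rrY y0 Ih).
Qed.

Lemma Yf_left y0 h : Yf y0 h (-1) = y0.
Proof. by rewrite /Yf Ji_patch_left ?addr0. Qed.

Lemma Zf_left z0 y0 h : Zf z0 y0 h (-1) = z0.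
Proof. by rewrite /Zf Ji_patch_left ?subr0. Qed.

Lemma Yf_right y0 h : L1 I h -> Yf y0 h 1 = y0 + \int[mu]_(x in I) h x.
Proof. by move=> Ih; rewrite /Yf Ji_patch_right. Qed.

Lemma Zf_right z0 y0 h : L1 I h ->
  Zf z0 y0 h 1 = z0 - \int[mu]_(x in I) (rr x * Yf y0 h x).
Proof. by move=> Ih; rewrite /Zf Ji_patch_right//; exact: L1_rrY. Qed.

Lemma Ji_lin v1 v2 (c x : R) : L1 setT v1 -> L1 setT v2 ->
  Ji (fun t => v1 t + c * v2 t) x = Ji v1 x + c * Ji v2 x.
Proof.
move=> I1 I2; have J1 : L1 `]-oo, x] v1 by exact: L1_sub I1.
have J2 : L1 `]-oo, x] v2 by exact: L1_sub I2.
by rewrite /Ji IntD ?IntZ//; exact: L1Z.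
Qed.

Lemma patch_lin h1 h2 (c : R) : (fun x => h1 x + c * h2 x) \_ I = (fun x => (h1 \_ I) x + c * (h2 \_ I) x).
Proof.
apply/funext => x; rewrite !patchE; case: ifP => // _.
by rewrite -[point]/(0 : R) mulr0 addr0.
Qed.

Lemma Yf_lin y1 y2 h1 h2 (c x : R) : L1 I h1 -> L1 I h2 ->
  Yf (y1 + c * y2) (fun x => h1 x + c * h2 x) x = Yf y1 h1 x + c * Yf y2 h2 x.
Proof.
move=> I1 I2; rewrite /Yf patch_lin Ji_lin; [|exact: L1_patch|exact: L1_patch].
by ring.
Qed.

Lemma Zf_lin z1 z2 y1 y2 h1 h2 (c x : R) : L1 I h1 -> L1 I h2 ->
  Zf (z1 + c * z2) (y1 + c * y2) (fun x => h1 x + c * h2 x) x =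
  Zf z1 y1 h1 x + c * Zf z2 y2 h2 x.
Proof.
move=> I1 I2; rewrite /Zf.
rewrite (_ : (fun t => rr t * _) = (fun t => rr t * Yf y1 h1 t + c * (rr t * Yf y2 h2 t))); last first.
  by apply/funext => t; rewrite Yf_lin//; ring.
rewrite patch_lin Ji_lin; [|exact: L1_patch (L1_rrY _ _)|exact: L1_patch (L1_rrY _ _)].
by move: (Ji _ x) (Ji _ x) => p q; ring.
Qed.

(** u = phi z solves (ell + alpha + beta) u = h, and z0 and y0 are the values of z and y at -1. *)
Definition Rep u (z0 y0 : R) h : Prop :=
  L2w h /\ forall x, -1 < x < 1 -> u x = phi x * Zf z0 y0 h x.

Lemma Rep_L2w u z0 y0 h : Rep u z0 y0 h -> L2w u.
Proof.
move=> [Lh uE]; have Ih := L2w_L1 Lh; have [M HM] := Zf_bounded z0 y0 Ih.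
apply: (@L2w_eq (fun x => phi x * Zf z0 y0 h x)).
  by move=> x /inIP/uE.
apply: L2w_phiM => [|x _]; last exact: HM.
by apply: measurable_funTS; apply: continuous_measurable_fun; exact: Zf_cont.
Qed.

Lemma Rep_lin u1 u2 z1 z2 y1 y2 h1 h2 (c : R) : Rep u1 z1 y1 h1 -> Rep u2 z2 y2 h2 ->
  Rep (fun x => u1 x + c * u2 x) (z1 + c * z2) (y1 + c * y2) (fun x => h1 x + c * h2 x).
Proof.
move=> [L1 U1] [L2 U2]; split; first exact: L2w_lin.
move=> x xI; rewrite Zf_lin; [|exact: L2w_L1|exact: L2w_L1].
by rewrite (U1 x xI) (U2 x xI); move: (phi x) (Zf _ _ _ x) (Zf _ _ _ x) => p q q'; ring.
Qed.

Lemma Rep_eq u v z0 y0 h : (forall x, -1 < x < 1 -> u x = v x) -> Rep u z0 y0 h -> Rep v z0 y0 h.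
Proof. by move=> uv [Lh U]; split => // x xI; rewrite -uv// U. Qed.

Lemma Rep_eq_h u z0 y0 h k : (forall x, -1 < x < 1 -> h x = k x) -> Rep u z0 y0 h -> Rep u z0 y0 k.
Proof.
move=> hk [Lh U]; split; first by apply: L2w_eq Lh => x /inIP; exact: hk.
suff YE : Yf y0 h = Yf y0 k by move=> x xI; rewrite (U x xI) /Zf YE.
rewrite /Yf (_ : h \_ I = k \_ I)//; apply/funext => t; rewrite !patchE.
by case: ifPn => // /set_mem/inIP/hk.
Qed.

End JacobiReal.

(** * The energy identity and derivatives in the regular system *)

Section JacobiCalculus.
Variables (R : realType) (alpha beta : R).
Hypotheses (halpha : 0 < alpha < 1) (hbeta : 0 < beta < 1).
Notation mu := (@lebesgue_measure R).
Notation is_der x f df := (is_derive (x : R) (1 : R) (f : R -> R) (df : R)).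
Notation w := (weight alpha beta).
Notation I := (`]-1, 1[%classic : set R).
Notation phi := (phi alpha beta).
Notation rr := (rr alpha beta).
Notation jB := (jB alpha beta).
Notation Zf := (Zf alpha beta).
Notation Rep := (Rep alpha beta).
Implicit Types (u h f g : R -> R) (x : R).

Let N11 : (-1 : R) < 1. Proof. by lra. Qed.
Let inIP x : I x -> -1 < x < 1. Proof. by rewrite /= in_itv. Qed.
Let mI : measurable I. Proof. exact: measurable_itv. Qed.

Lemma L1_hZ h1 z2 y2 h2 : L1 I h1 -> L1 I h2 -> L1 I (fun x => h1 x * Zf z2 y2 h2 x).
Proof.
move=> I1 I2; have [M HM] := Zf_bounded halpha hbeta z2 y2 I2.
apply: (@L1_eq _ _ (fun t => Zf z2 y2 h2 t * h1 t)) => //.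
  by move=> x _; rewrite mulrC.
apply: (L1_mul_bounded mI I1) => [|x _]; last exact: HM.
apply: measurable_funTS; apply: continuous_measurable_fun.
exact: (Zf_cont halpha hbeta).
Qed.

Lemma L1_rYY y1 h1 y2 h2 : L1 I h1 -> L1 I h2 ->
  L1 I (fun x => rr x * Yf y1 h1 x * Yf y2 h2 x).
Proof.
move=> I1 I2; have I3 := L1_rrY halpha hbeta y1 I1.
apply: (@L1_eq _ _ (fun t => Yf y2 h2 t * (rr t * Yf y1 h1 t))) => //.
  by move=> x _; rewrite mulrC.
apply: (L1_mul_bounded mI I3) => [|x _]; last exact: Yf_bounded.
by apply: measurable_funTS; apply: continuous_measurable_fun; exact: Yf_cont.
Qed.

(* Integration by parts of int Y1' Z2, with Z2' = - rr Y2. *)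
Lemma energy_identity y1 h1 z2 y2 h2 : L1 I h1 -> L1 I h2 ->
  \int[mu]_(x in I) (h1 x * Zf z2 y2 h2 x) =
  Yf y1 h1 1 * Zf z2 y2 h2 1 - y1 * z2
  + \int[mu]_(x in I) (rr x * Yf y1 h1 x * Yf y2 h2 x).
Proof.
move=> I1 I2; have Iq := L1_rrY halpha hbeta y2 I2.
set q := fun t => rr t * Yf y2 h2 t in Iq.
have Jv := L1_patch I1; have Jq := L1_patch Iq.
have P := Ji_parts Jv Jq.
rewrite -!Int_patch in P.
have E1 : \int[mu]_x ((h1 \_ I) x * Ji (q \_ I) x) =
    z2 * \int[mu]_(x in I) h1 x - \int[mu]_(x in I) (h1 x * Zf z2 y2 h2 x).
  rewrite -IntZ// -IntB//; [|exact: L1Z|exact: L1_hZ].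
  rewrite [RHS]Int_patch; apply: Int_eq => x _; rewrite !patchE; case: ifP => _.
    by rewrite /Zf -/q; ring.
  by rewrite mul0r.
have E2 : \int[mu]_x ((q \_ I) x * Ji (h1 \_ I) x) =
    \int[mu]_(x in I) (rr x * Yf y1 h1 x * Yf y2 h2 x) - y1 * \int[mu]_(x in I) q x.
  rewrite -IntZ// -IntB//; [|exact: L1_rYY|exact: L1Z].
  rewrite [RHS]Int_patch; apply: Int_eq => x _; rewrite !patchE; case: ifP => _.
    by rewrite /Yf /q /Yf; ring.
  by rewrite mul0r.
rewrite E1 E2 in P; rewrite Yf_right// (Zf_right halpha hbeta)// -/q.
by move: P; lra.
Qed.

Lemma phiK x : -1 < x < 1 -> phi x * w x = 1.
Proof. by move=> xI; rewrite mulVf// gt_eqF// w_gt0. Qed.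

Lemma Rep_energy u1 z1 y1 h1 u2 z2 y2 h2 : Rep u1 z1 y1 h1 -> Rep u2 z2 y2 h2 ->
  \int[mu]_(x in I) (h1 x * u2 x * w x) =
  Yf y1 h1 1 * Zf z2 y2 h2 1 - y1 * z2
  + \int[mu]_(x in I) (rr x * Yf y1 h1 x * Yf y2 h2 x).
Proof.
move=> [La U1] [Lb U2]; have I1 := L2w_L1 halpha hbeta La; have I2 := L2w_L1 halpha hbeta Lb.
rewrite -energy_identity//; apply: Int_eq => x /inIP xI.
by rewrite U2// -[RHS]mulr1 -(phiK xI); ring.
Qed.

(** The integrand r y is continuous on (-1, 1), so the derivative of z exists at every point, while
    that of y exists only a.e. *)
Lemma Zf_der z0 y0 h x : L1 I h -> -1 < x < 1 -> is_der x (Zf z0 y0 h) (- (rr x * Yf y0 h x)).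
Proof.
move=> Ih xI; rewrite -[X in is_derive _ _ _ X]sub0r.
apply: derB.
have [d Dr] := @der_rr R alpha beta x xI.
have cq : {for x, continuous ((fun t => rr t * Yf y0 h t) \_ I)}.
  have : {for x, continuous (fun t => rr t * Yf y0 h t)}.
    by apply: continuousM; [exact: der_continuous Dr|exact: Yf_cont].
  apply: cont_itv xI _ => t tI; by rewrite patchI.
by have := Ji_derive (L1_patch (L1_rrY halpha hbeta y0 Ih)) cq; rewrite patchI.
Qed.

Lemma Yf_der_ae y0 h : L1 I h -> {ae mu, forall x, -1 < x < 1 -> is_der x (Yf y0 h) (h x)}.
Proof.
move=> Ih; apply: aeS (Ji_ae_derive (L1_patch Ih)) => x Dx xI.
rewrite -[X in is_derive _ _ _ X]add0r -(patchI h xI); exact: derD.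
Qed.

(** Since phi r = 1 / (1 - x^2), this is y = [jB] u - (1 - x^2) u' solved for u'. *)
Lemma Rep_der u z0 y0 h x : Rep u z0 y0 h -> -1 < x < 1 ->
  is_der x u ((jB x * u x - Yf y0 h x) / jQ x).
Proof.
move=> [Lh U] xI; have Ih := L2w_L1 halpha hbeta Lh.
apply: (@der_itv _ (fun x => phi x * Zf z0 y0 h x) _ (-1) 1) => //.
  by move=> y yI; rewrite U.
apply: (der_val (derM (der_phi _ _ xI) (Zf_der z0 y0 Ih xI))).
have pr : phi x * rr x = (jQ x)^-1 by rewrite /rr mulrA phiK// mul1r.
transitivity (phi x * jB x / jQ x * Zf z0 y0 h x - (phi x * rr x) * Yf y0 h x); first by ring.
by rewrite pr U//; field; rewrite gt_eqF ?jQ_gt0.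
Qed.

End JacobiCalculus.

(** * Interior regularity and gluing of compact subintervals *)

Section JacobiRegularity.
Variable R : realType.
Notation mu := (@lebesgue_measure R).
Notation is_der x f df := (is_derive (x : R) (1 : R) (f : R -> R) (df : R)).
Implicit Types (u v h f g F : R -> R) (x c d : R).

Lemma L1_patchD (D : set R) f : measurable D -> L1 D f -> L1 setT (f \_ D).
Proof.
move=> mD If; rewrite /L1 -restrict_EFin.
by apply/(integrable_mkcond _ _).1.
Qed.

Lemma cont_bounded c d f : c < d -> (forall x, c <= x <= d -> {for x, continuous f}) ->
  exists M, forall x, c <= x <= d -> `|f x| <= M.
Proof.
move=> cd cf; have cw : {within `[c, d], continuous (fun x => `|f x|)}.
  apply: continuous_in_subspaceT => x /set_mem/=; rewrite in_itv/= => xcd.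
  by apply: continuous_comp; [exact: cf|exact: norm_continuous].
have [m mcd Hm] := EVT_max (ltW cd) cw.
by exists `|f m| => x xcd; apply: Hm; rewrite in_itv.
Qed.

Lemma C1c_abs_cont c d u du : c < d -> (forall x, c <= x <= d -> is_der x u (du x)) ->
  (forall x, c <= x <= d -> {for x, continuous du}) -> abs_cont c d u.
Proof. by move=> cd Du cdu; apply: (C1_abs_cont cd Du); exact: cont_bounded. Qed.

Lemma abs_cont_cst c d (a : R) : abs_cont c d (fun=> a).
Proof.
move=> e e0; exists 1 => // n l r _ _ _.
by rewrite big1// => i _; rewrite subrr normr0.
Qed.

Lemma abs_cont_continuous c d u x : abs_cont c d u -> c < x < d -> {for x, continuous u}.
Proof.
move=> uac /andP[cx xd]; have cd := lt_trans cx xd.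
have [v Iv uv] := abs_cont_integral cd uac.
apply: (@cont_itv _ (fun x => Ji v x + (u c - Ji v c)) _ c d); first by rewrite cx.
  by move=> y /andP[cy yd]; have := uv y; rewrite !ltW// => /(_ isT); lra.
by apply: cvgD; [exact: (Ji_cont Iv)|exact: cvg_cst].
Qed.

(** [derive1 u] has a default value where u is not differentiable, so its absolute continuity alone
    does not give a derivative at every point. But u is a primitive of its a.e. derivative, and this
    agrees a.e. with the continuous function [derive1 u]. *)
Lemma abs_cont_C1 c d u : c < d -> abs_cont c d u -> abs_cont c d (derive1 u) ->
  forall x, c < x < d -> is_der x u (derive1 u x).
Proof.
move=> cd uac duac; have [v Iv uv] := abs_cont_integral cd uac.
have [M M0 HM] := abs_cont_bounded cd duac.
have mcd : measurable `]c, d[%classic by exact: measurable_itv.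
have Ik : L1 setT (derive1 u \_ `]c, d[).
  apply: L1_patchD => //; apply: (@L1_bounded _ _ _ M) => //.
  - by rewrite lebesgue_measure_itv/= lte_fin cd -EFinB ltry.
  - by apply: continuous_meas_oo => x; exact: abs_cont_continuous.
  - by move=> x /=; rewrite in_itv/= => /andP[cx xd]; rewrite HM// !ltW.
have kE y : c < y < d -> (derive1 u \_ `]c, d[) y = derive1 u y.
  by move=> ycd; rewrite patchE mem_set//= in_itv.
have uk x : c <= x <= d -> u x - u c = Ji (derive1 u \_ `]c, d[) x - Ji (derive1 u \_ `]c, d[) c.
  move=> /andP[cx xd]; rewrite uv ?cx//; apply: L1_itv_Ji => //.
  apply: aeS (Ji_diff_derive_ae Iv uv) => y Dy /andP[cy yx].
  have ycd : c < y < d by rewrite cy (lt_le_trans yx).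
  by rewrite kE// (der_derive1 (Dy ycd)).
move=> x xcd.
apply: (@der_itv _ (fun x => Ji (derive1 u \_ `]c, d[) x + (u c - Ji (derive1 u \_ `]c, d[) c)) _ c d) => //.
  by move=> y /andP[cy yd]; have := uk y; rewrite !ltW// => /(_ isT); lra.
rewrite -[X in is_derive _ _ _ X]addr0 -(kE _ xcd); apply: derD.
apply: Ji_derive => //; apply: (cont_itv xcd (f := derive1 u)).
  by move=> y ycd; rewrite kE.
exact: abs_cont_continuous duac xcd.
Qed.

(** Every point is joined to 0 by a compact subinterval, which yields one constant of integration
    for all of (-1, 1). *)
Lemma abs_cont_glue F k : L1 setT k ->
  (forall c d, -1 < c -> c < d -> d < 1 -> abs_cont c d F) ->
  {ae mu, forall x, -1 < x < 1 -> is_der x F (k x)} ->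
  forall x, -1 < x < 1 -> F x = F 0 - Ji k 0 + Ji k x.
Proof.
move=> Ik Fac DF x /andP[x0 x1].
have key c d : -1 < c -> c < d -> d < 1 -> F d - F c = Ji k d - Ji k c.
  move=> c1 cd d1; apply: (abs_cont_FTC cd (Fac _ _ c1 cd d1) Ik); last by rewrite lexx ltW.
  by apply: aeS DF => y Dy /andP[cy yd]; apply: Dy; rewrite (lt_trans c1)// (lt_trans yd).
have [xlt|xgt|->] := ltgtP x 0; last by ring.
- by have := key x 0 x0 xlt ltr01; lra.
- by have := key 0 x (ltrN10 _) xgt x1; lra.
Qed.

End JacobiRegularity.

(** * Equivalence of the Jacobi equation with the regular system *)

Section JacobiEquivalence.
Variables (R : realType) (alpha beta : R).
Hypotheses (halpha : 0 < alpha < 1) (hbeta : 0 < beta < 1).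
Notation mu := (@lebesgue_measure R).
Notation is_der x f df := (is_derive (x : R) (1 : R) (f : R -> R) (df : R)).
Notation w := (weight alpha beta).
Notation I := (`]-1, 1[%classic : set R).
Notation rr := (rr alpha beta).
Notation jB := (jB alpha beta).
Notation Zf := (Zf alpha beta).
Notation Rep := (Rep alpha beta).
Notation L2w := (L2w alpha beta).
Implicit Types (u h f g : R -> R) (x c d : R).

Let sub_itv c d x : -1 < c -> d < 1 -> c <= x <= d -> -1 < x < 1.
Proof. by move=> c1 d1 /andP[cx xd]; rewrite (lt_le_trans c1)// (le_lt_trans xd). Qed.

Let jB_ac c d : c < d -> abs_cont c d jB.
Proof.
move=> cd; apply: (C1c_abs_cont cd (du := fun=> alpha + beta)) => x _; first exact: der_jB.
exact: cvg_cst.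
Qed.

Let jQ_ac c d : c < d -> abs_cont c d (@jQ R).
Proof.
move=> cd; apply: (C1c_abs_cont cd (du := fun x => - 2 * x)) => x _; first exact: der_jQ.
exact: der_continuous (derZ (-2) (der_id x)).
Qed.

Let jQV_ac c d : -1 < c -> c < d -> d < 1 -> abs_cont c d (fun x => (jQ x)^-1).
Proof.
move=> c1 cd d1.
have Q0 x : c <= x <= d -> jQ x != 0 by move=> /(sub_itv c1 d1)/jQ_gt0/lt0r_neq0.
apply: (C1c_abs_cont cd (du := fun x => - (- 2 * x) / (jQ x) ^+ 2)) => x xcd.
  exact: derV (Q0 _ xcd) (der_jQ x).
have D1 := derZ (- -2) (der_id x).
have QQ0 : jQ x * jQ x != 0 by rewrite mulf_neq0 ?Q0.
have D2 := @derV R (fun y => jQ y * jQ y) x _ QQ0 (derM (der_jQ x) (der_jQ x)).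
have /der_continuous := derM D1 D2.
suff -> : (fun x => - (- 2 * x) / (jQ x) ^+ 2) = (fun y => - - 2 * y / (jQ y * jQ y)) :> (R -> R) by [].
by apply/funext => y; rewrite -mulNr.
Qed.

Section Backward.
Variables (u h : R -> R) (z0 y0 : R).
Hypothesis Ru : Rep u z0 y0 h.
Let Ih : L1 I h. Proof. by have [Lh _] := Ru; exact: L2w_L1 Lh. Qed.

Lemma Rep_derive1 x : -1 < x < 1 -> derive1 u x = (jB x * u x - Yf y0 h x) / jQ x.
Proof. by move=> xI; exact: der_derive1 (Rep_der halpha hbeta Ru xI). Qed.

Lemma Rep_continuous x : -1 < x < 1 -> {for x, continuous u}.
Proof. by move=> xI; exact: der_continuous (Rep_der halpha hbeta Ru xI). Qed.

Lemma Rep_abs_cont c d : -1 < c -> c < d -> d < 1 -> abs_cont c d u.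
Proof.
move=> c1 cd d1; apply: (C1c_abs_cont cd (du := fun x => (jB x * u x - Yf y0 h x) / jQ x)).
  by move=> x /(sub_itv c1 d1) xI; exact: (Rep_der halpha hbeta Ru xI).
move=> x /(sub_itv c1 d1) xI; have Q0 := lt0r_neq0 (jQ_gt0 xI).
apply: continuousM; last exact: der_continuous (derV Q0 (der_jQ x)).
apply: continuousB; last exact: Yf_cont.
exact: der_continuous (derM (der_jB alpha beta x) (Rep_der halpha hbeta Ru xI)).
Qed.

Lemma Rep_abs_cont_derive c d : -1 < c -> c < d -> d < 1 -> abs_cont c d (derive1 u).
Proof.
move=> c1 cd d1.
apply: (@abs_cont_eq _ c d (fun x => (jB x * u x + (-1) * Yf y0 h x) * (jQ x)^-1)).
  by move=> x /(sub_itv c1 d1) xI; rewrite Rep_derive1//; ring.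
apply: abs_contM => //; last exact: jQV_ac.
apply: abs_contD; apply: abs_contM => //; [exact: jB_ac|exact: Rep_abs_cont|exact: abs_cont_cst|].
apply: abs_contD; first exact: abs_cont_cst.
by apply: Ji_abs_cont; exact: L1_patch.
Qed.

(** p u' = w ([jB] u - y), and one more differentiation uses y' = h, which holds a.e. *)
Lemma Rep_ell_ae : {ae mu, forall x, -1 < x < 1 ->
  - (w x)^-1 * derive1 (fun y => pJ alpha beta y * derive1 u y) x = h x - (alpha + beta) * u x}.
Proof.
apply: aeS (Yf_der_ae y0 Ih) => x DY xI; have {}DY := DY xI.
have w0 := w_gt0 alpha beta xI; have q0 := jQ_gt0 xI.
have Du := Rep_der halpha hbeta Ru xI.
have D1 := derM (der_w alpha beta xI) (derB (derM (der_jB alpha beta x) Du) DY).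
have D2 : is_der x (fun y => pJ alpha beta y * derive1 u y) (w x * ((alpha + beta) * u x - h x)).
  apply: (der_itv xI _ (der_val D1 _)).
    by move=> y yI; rewrite pJE// Rep_derive1//; field; rewrite gt_eqF// jQ_gt0.
  by field; rewrite gt_eqF.
by rewrite (der_derive1 D2); field; rewrite gt_eqF.
Qed.

End Backward.

(** The function y = [jB] u - (1 - x^2) u' satisfies y' = k a.e., and - u w has derivative r y.
    Gluing both over compact subintervals gives the integral formulas, and the constants of
    integration are the values at -1. *)
Lemma ell_Rep u h : L2w u -> L2w h ->
  (forall c d, -1 < c -> c < d -> d < 1 -> abs_cont c d u) ->
  (forall c d, -1 < c -> c < d -> d < 1 -> abs_cont c d (derive1 u)) ->
  {ae mu, forall x, -1 < x < 1 ->
    - (w x)^-1 * derive1 (fun y => pJ alpha beta y * derive1 u y) x = h x} ->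
  exists z0 y0, Rep u z0 y0 (fun x => h x + (alpha + beta) * u x).
Proof.
move=> Lu Lh uac duac ell; set k := fun x => h x + (alpha + beta) * u x.
have Lk : L2w k by exact: L2w_lin.
have Ik := L2w_L1 halpha hbeta Lk.
have mid x : -1 < x < 1 -> [/\ -1 < (x - 1) / 2, (x - 1) / 2 < x, x < (x + 1) / 2 & (x + 1) / 2 < 1].
  by move=> /andP[x0 x1]; split; lra.
have Du x : -1 < x < 1 -> is_der x u (derive1 u x).
  move=> xI; have [c1 cx xd d1] := mid x xI.
  have cd := lt_trans cx xd.
  by apply: (abs_cont_C1 cd (uac _ _ c1 cd d1) (duac _ _ c1 cd d1)); rewrite cx.
have duae : {ae mu, forall x, -1 < x < 1 -> derivable (derive1 u) x 1}.
  (* The a.e. statement on (-1, 1) is assembled from countably many subintervals whose closures lie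
     inside. *)
  have H n : {ae mu, forall x, -1 + n.+2%:R^-1 < x < 1 - n.+2%:R^-1 -> derivable (derive1 u) x 1}.
    have n0 : 0 < n.+2%:R^-1 :> R by rewrite invr_gt0.
    have n2 : n.+2%:R^-1 <= 2^-1 :> R by rewrite lef_pV2 ?posrE// ler_nat.
    move: n0 n2; move: (n.+2%:R^-1 : R) => e n0 n2.
    have [cd|dc] := ltP (-1 + e) (1 - e).
      by apply: abs_cont_derivable_ae => //; apply: duac; lra.
    by apply: aeW => x /andP[h1 h2]; exfalso; lra.
  move/(ae_foralln) : H; apply: aeS => x H /andP[x0 x1].
  have m0 : 0 < Num.min (x + 1) (1 - x) by rewrite lt_min; apply/andP; split; lra.
  have : harmonic n @[n --> \oo] --> (0 : R) by exact: cvg_harmonic.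
  move=> /cvgrPdist_lt/(_ _ m0)[n _ /(_ n.+1 (leqnSn _))].
  rewrite sub0r normrN /harmonic/= gtr0_norm ?invr_gt0// lt_min => /andP[h1 h2].
  apply: (H n); move: h1 h2; move: (n.+2%:R^-1 : R) => e h1 h2.
  by apply/andP; split; lra.
pose y x := jB x * u x + (-1) * (jQ x * derive1 u x).
have yac c d : -1 < c -> c < d -> d < 1 -> abs_cont c d y.
  move=> c1 cd d1; apply: abs_contD; apply: abs_contM => //;
    [exact: jB_ac|exact: uac|exact: abs_cont_cst|].
  by apply: abs_contM => //; [exact: jQ_ac|exact: duac].
have Dy : {ae mu, forall x, -1 < x < 1 -> is_der x y ((k \_ I) x)}.
  apply: aeS (aeI duae ell) => x [ddu Ex] xI; have {}Ex := Ex xI.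
  have {}ddu := der_derivable (ddu xI).
  have w0 := w_gt0 alpha beta xI; have q0 := jQ_gt0 xI.
  set d2 := derive1 (derive1 u) x in ddu.
  have G : is_der x (fun y => pJ alpha beta y * derive1 u y)
      (((- 2 * x) * w x - w x * jB x) * derive1 u x + jQ x * w x * d2).
    apply: (der_itv xI _ (der_val (derM (derM (der_jQ x) (der_w alpha beta xI)) ddu) _)).
      by move=> z zI; rewrite pJE.
    by field; rewrite gt_eqF.
  rewrite (der_derive1 G) in Ex.
  apply: (der_val (derD (derM (der_jB alpha beta x) (Du x xI)) (derZ (-1) (derM (der_jQ x) ddu)))).
  rewrite patchI// /k -Ex; field; rewrite gt_eqF//.
have yE := abs_cont_glue (L1_patch Ik) yac Dy.
set y0 := y 0 - Ji (k \_ I) 0 in yE.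
have YE x : -1 < x < 1 -> y x = Yf y0 k x by move=> xI; rewrite yE.
have Iq := L1_rrY halpha hbeta y0 Ik.
set q := fun t => rr t * Yf y0 k t in Iq.
(* Minus the z of the representation, so that its derivative is + r y; the sign is restored in the
   witness for z0. *)
pose z x := (-1) * (u x * w x).
have Dz x : -1 < x < 1 -> is_der x z (q x).
  move=> xI; have q0 := jQ_gt0 xI.
  apply: (der_val (derZ (-1) (derM (Du x xI) (der_w alpha beta xI)))).
  by rewrite /q -YE// /y /rr; field; rewrite gt_eqF.
have cq x : -1 < x < 1 -> {for x, continuous q}.
  move=> xI; have [d Dr] := @der_rr R alpha beta x xI.
  by apply: continuousM; [exact: der_continuous Dr|exact: Yf_cont].
have zac c d : -1 < c -> c < d -> d < 1 -> abs_cont c d z.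
  move=> c1 cd d1; apply: (C1c_abs_cont cd (du := q)) => x /(sub_itv c1 d1); [exact: Dz|exact: cq].
have zE : forall x, -1 < x < 1 -> z x = z 0 - Ji (q \_ I) 0 + Ji (q \_ I) x.
  apply: (abs_cont_glue (L1_patch Iq) zac).
  by apply: aeW => x xI; rewrite patchI//; exact: Dz.
exists (- (z 0 - Ji (q \_ I) 0)), y0; split => // x xI.
have := zE x xI; rewrite /Zf -/q; set a := z 0 - _; move=> E.
have -> : - a - Ji (q \_ I) x = u x * w x by move: E; rewrite /z; lra.
by rewrite mulrCA phiK// mulr1.
Qed.

End JacobiEquivalence.

(** * Boundary limits and the weak equation *)

Section JacobiBoundary.
Variables (R : realType) (alpha beta : R).
Hypotheses (halpha : 0 < alpha < 1) (hbeta : 0 < beta < 1).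
Notation mu := (@lebesgue_measure R).
Notation w := (weight alpha beta).
Notation I := (`]-1, 1[%classic : set R).
Notation phi := (phi alpha beta).
Notation rr := (rr alpha beta).
Notation jB := (jB alpha beta).
Notation Zf := (Zf alpha beta).
Notation Rep := (Rep alpha beta).
Notation L2w := (L2w alpha beta).
Implicit Types (u h f g : R -> R) (x : R).

Let inIP x : I x -> -1 < x < 1. Proof. by rewrite /= in_itv. Qed.
Let mI : measurable I. Proof. exact: measurable_itv. Qed.

Section CvgPointwise.
Context {F : set_system R} {FF : Filter F}.
Implicit Types (a b : R).

Lemma cv_val f a b : f x @[x --> F] --> a -> a = b -> f x @[x --> F] --> b.
Proof. by move=> + <-. Qed.

Lemma cvM f g a b : f x @[x --> F] --> a -> g x @[x --> F] --> b ->
  f x * g x @[x --> F] --> a * b.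
Proof. by move=> fa gb; exact: cvgM. Qed.

Lemma cvD f g a b : f x @[x --> F] --> a -> g x @[x --> F] --> b ->
  f x + g x @[x --> F] --> a + b.
Proof. by move=> fa gb; exact: cvgD. Qed.

Lemma cvB f g a b : f x @[x --> F] --> a -> g x @[x --> F] --> b ->
  f x - g x @[x --> F] --> a - b.
Proof. by move=> fa gb; exact: cvgB. Qed.

Lemma cvN f a : f x @[x --> F] --> a -> - f x @[x --> F] --> - a.
Proof. by move=> fa; exact: cvgN. Qed.

Lemma cvV f a : a != 0 -> f x @[x --> F] --> a -> (f x)^-1 @[x --> F] --> a^-1.
Proof. by move=> a0 fa; exact: cvgV. Qed.

Lemma cvC a : a @[x --> F] --> a.
Proof. exact: cvg_cst. Qed.

End CvgPointwise.

Lemma near_left (P : R -> Prop) : (forall x, -1 < x < 1 -> P x) -> \forall x \near (-1 : R)^'+, P x.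
Proof.
move=> H; near=> x; apply: H; apply/andP; split.
  by near: x; exact: nbhs_right_gt.
by near: x; apply: nbhs_right_lt; lra.
Unshelve. all: by end_near. Qed.

Lemma near_right (P : R -> Prop) : (forall x, -1 < x < 1 -> P x) -> \forall x \near (1 : R)^'-, P x.
Proof.
move=> H; near=> x; apply: H; apply/andP; split.
  by near: x; apply: nbhs_left_gt; lra.
by near: x; exact: nbhs_left_lt.
Unshelve. all: by end_near. Qed.

Lemma cvg_at_left_end f g (l : R) : (forall x, -1 < x < 1 -> f x = g x) ->
  f x @[x --> (-1 : R)^'+] --> l -> g x @[x --> (-1 : R)^'+] --> l.
Proof. by move=> fg; apply: cvg_trans; apply: near_eq_cvg; apply: near_left => x xI; rewrite fg. Qed.

Lemma cvg_at_right_end f g (l : R) : (forall x, -1 < x < 1 -> f x = g x) ->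
  f x @[x --> (1 : R)^'-] --> l -> g x @[x --> (1 : R)^'-] --> l.
Proof. by move=> fg; apply: cvg_trans; apply: near_eq_cvg; apply: near_right => x xI; rewrite fg. Qed.

Lemma powR_at_left (e : R) : 0 < e -> (1 + x) `^ e @[x --> (-1 : R)^'+] --> (0 : R).
Proof.
move=> e0; have := @powR_cvg0 R e e0; move=> H A /H [d d0 HA].
exists d => //= y yd y1; apply: HA => /=; last by lra.
by rewrite (_ : 0 - (1 + y) = -1 - y); [exact: yd|ring].
Qed.

Lemma powR_at_right (e : R) : 0 < e -> (1 - x) `^ e @[x --> (1 : R)^'-] --> (0 : R).
Proof.
move=> e0; have := @powR_cvg0 R e e0; move=> H A /H [d d0 HA].
exists d => //= y yd y1; apply: HA => /=; last by lra.
by rewrite sub0r normrN; exact: yd.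
Qed.

Lemma powRB_at_left (e : R) : (1 - x) `^ e @[x --> (-1 : R)^'+] --> (2 `^ e : R).
Proof.
apply: cvg_at_right_filter; have x0 : 0 < 1 - (-1) :> R by lra.
by have := der_continuous (der_powRB e x0); rewrite /prop_for /continuous_at (_ : 1 - -1 = 2 :> R)//; ring.
Qed.

Lemma powRD_at_right (e : R) : (1 + x) `^ e @[x --> (1 : R)^'-] --> (2 `^ e : R).
Proof.
apply: cvg_at_left_filter; have x0 : 0 < 1 + 1 :> R by lra.
by have := der_continuous (der_powRD e x0); rewrite /prop_for /continuous_at (_ : 1 + 1 = 2 :> R)//; ring.
Qed.

Lemma w_left : w x @[x --> (-1 : R)^'+] --> (0 : R).
Proof.
case/andP: hbeta => b0 _.
by apply: cv_val (cvM (@powRB_at_left alpha) (@powR_at_left _ b0)) _; rewrite mulr0.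
Qed.

Lemma w_right : w x @[x --> (1 : R)^'-] --> (0 : R).
Proof.
case/andP: halpha => a0 _.
by apply: cv_val (cvM (@powR_at_right _ a0) (@powRD_at_right beta)) _; rewrite mul0r.
Qed.

Lemma phi_left : (1 + x) * phi x @[x --> (-1 : R)^'+] --> (0 : R).
Proof.
case/andP: hbeta => b0 b1; have b2 : 0 < 1 - beta by lra.
apply: cvg_at_left_end (cv_val (cvM (@powRB_at_left (- alpha)) (@powR_at_left _ b2)) (mulr0 _)) => x xI; have [x0 x1] := inI xI.
rewrite /phi /weight powRN (_ : 1 - beta = - beta + 1); last by ring.
by rewrite powR_succ// powRN invfM; ring.
Qed.

Lemma phi_right : (1 - x) * phi x @[x --> (1 : R)^'-] --> (0 : R).
Proof.
case/andP: halpha => b0 b1; have b2 : 0 < 1 - alpha by lra.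
apply: cvg_at_right_end (cv_val (cvM (@powR_at_right _ b2) (@powRD_at_right (- beta))) (mul0r _)) => x xI; have [x0 x1] := inI xI.
rewrite /phi /weight powRN (_ : 1 - alpha = - alpha + 1); last by ring.
by rewrite powR_succ// powRN invfM; ring.
Qed.

Section Limits.
Variables (u h : R -> R) (z0 y0 : R).
Hypothesis Ru : Rep u z0 y0 h.
Let Ih : L1 I h. Proof. by have [Lh _] := Ru; exact: L2w_L1 Lh. Qed.
Let Y := Yf y0 h.
Let Z := Zf z0 y0 h.

Let Yl : Y x @[x --> (-1 : R)^'+] --> y0.
Proof. by apply: cvg_at_right_filter; rewrite -[y0](Yf_left y0 h); exact: Yf_cont. Qed.

Let Yr : Y x @[x --> (1 : R)^'-] --> Y 1.
Proof. by apply: cvg_at_left_filter; exact: Yf_cont. Qed.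

Let Zl : Z x @[x --> (-1 : R)^'+] --> z0.
Proof.
apply: cvg_at_right_filter; rewrite -[z0](Zf_left alpha beta z0 y0 h).
exact: (Zf_cont halpha hbeta).
Qed.

Let Zr : Z x @[x --> (1 : R)^'-] --> Z 1.
Proof. by apply: cvg_at_left_filter; exact: (Zf_cont halpha hbeta). Qed.

Let Bl : jB x @[x --> (-1 : R)^'+] --> - (2 * beta).
Proof.
apply: cvg_at_right_filter; have := der_continuous (der_jB alpha beta (-1)).
by rewrite /prop_for /continuous_at (_ : jB (-1) = - (2 * beta))//; rewrite /jB; ring.
Qed.

Let Br : jB x @[x --> (1 : R)^'-] --> 2 * alpha.
Proof.
apply: cvg_at_left_filter; have := der_continuous (der_jB alpha beta 1).
by rewrite /prop_for /continuous_at (_ : jB 1 = 2 * alpha)//; rewrite /jB; ring.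
Qed.

(** This is p u' expressed by z and y. The coefficient w of y vanishes at the endpoints, so only z
    survives in the limit. *)
Let pdE x : -1 < x < 1 -> jB x * Z x - Y x * w x = pJ alpha beta x * derive1 u x.
Proof.
move=> xI; rewrite (Rep_derive1 halpha hbeta Ru)// pJE// -/Y.
have [_ ->//] := Ru; rewrite -/Z /phi.
by field; rewrite !gt_eqF ?w_gt0 ?jQ_gt0.
Qed.

Lemma Rep_f0_left : - (pJ alpha beta x * derive1 u x) @[x --> (-1 : R)^'+] --> 2 * beta * z0.
Proof.
apply: (cvg_at_left_end _ (cv_val (cvN (cvB (cvM Bl Zl) (cvM Yl w_left))) _)) => [x xI|].
  by rewrite -pdE.
by ring.
Qed.

Lemma Rep_f0_right : pJ alpha beta x * derive1 u x @[x --> (1 : R)^'-] --> 2 * alpha * Z 1.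
Proof.
apply: (cvg_at_right_end _ (cv_val (cvB (cvM Br Zr) (cvM Yr w_right)) _)) => [x xI|].
  by rewrite -pdE.
by ring.
Qed.

Let affine_l (a b : R) : a + b * x @[x --> (-1 : R)^'+] --> a - b.
Proof.
apply: cvg_at_right_filter; rewrite -[X in _ --> a + X]mulrN1.
by apply: cvgD; [exact: cvg_cst|apply: cvgM; [exact: cvg_cst|exact: cvg_id]].
Qed.

Let affine_r (a b : R) : a + b * x @[x --> (1 : R)^'-] --> a + b.
Proof.
apply: cvg_at_left_filter; rewrite -[X in _ --> a + X]mulr1.
by apply: cvgD; [exact: cvg_cst|apply: cvgM; [exact: cvg_cst|exact: cvg_id]].
Qed.

(** In terms of y the expression is (y - alpha (1 + x) u) / (beta (1 - x)): the factor 1 / beta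
    cancels the part that blows up, and (1 + x) phi tends to 0 because beta < 1. *)
Lemma Rep_f1_left : - u x - (1 + x) / beta * derive1 u x @[x --> (-1 : R)^'+] --> y0 / (2 * beta).
Proof.
have b0 : beta != 0 by case/andP: hbeta => b0 _; rewrite gt_eqF.
have N0 : beta - (- beta) != 0 by rewrite opprK -mulr2n mulrn_eq0.
have lim : (Y x - alpha * ((1 + x) * phi x) * Z x) / (beta + - beta * x) @[x --> (-1 : R)^'+] -->
    (y0 - alpha * 0 * z0) / (beta - - beta).
  exact: cvM (cvB Yl (cvM (cvM (@cvC _ _ alpha) phi_left) Zl)) (cvV N0 (@affine_l beta (- beta))).
apply: (cvg_at_left_end _ (cv_val lim _)) => [x xI|]; last first.
  by rewrite mulr0 mul0r subr0 opprK (_ : beta + beta = 2 * beta)//; ring.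
rewrite (Rep_derive1 halpha hbeta Ru)// -/Y /jQ /jB.
have [x0 x1] := inI xI; have [_ ->//] := Ru; rewrite -/Z.
rewrite (_ : beta + - beta * x = beta * (1 - x)); last by ring.
by field; rewrite b0 !gt_eqF.
Qed.

Lemma Rep_f1_right : u x - (1 - x) / alpha * derive1 u x @[x --> (1 : R)^'-] --> Y 1 / (2 * alpha).
Proof.
have a0 : alpha != 0 by case/andP: halpha => a0 _; rewrite gt_eqF.
have N0 : alpha + alpha != 0 by rewrite -mulr2n mulrn_eq0.
have lim : (Y x + beta * ((1 - x) * phi x) * Z x) / (alpha + alpha * x) @[x --> (1 : R)^'-] -->
    (Y 1 + beta * 0 * Z 1) / (alpha + alpha).
  exact: cvM (cvD Yr (cvM (cvM (@cvC _ _ beta) phi_right) Zr)) (cvV N0 (@affine_r alpha alpha)).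
apply: (cvg_at_right_end _ (cv_val lim _)) => [x xI|]; last first.
  by rewrite mulr0 mul0r addr0 (_ : alpha + alpha = 2 * alpha)//; ring.
rewrite (Rep_derive1 halpha hbeta Ru)// -/Y /jQ /jB.
have [x0 x1] := inI xI; have [_ ->//] := Ru; rewrite -/Z.
rewrite (_ : alpha + alpha * x = alpha * (1 + x)); last by ring.
by field; rewrite a0 !gt_eqF.
Qed.

End Limits.

(** The Gram-Schmidt coefficient. If e has norm 0 then it vanishes a.e. and a = 0 serves, so
    [Rep_weak] can orthogonalize without an argument for linear independence. *)
Lemma L2w_proj f e : L2w f -> L2w e -> exists a : R,
  \int[mu]_(x in I) ((f x + a * e x) * e x * w x) = 0.
Proof.
move=> Lf Le; have Ife := L2wM Lf Le; have Iee := L2wM Le Le.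
have E a : \int[mu]_(x in I) ((f x + a * e x) * e x * w x) =
    \int[mu]_(x in I) (f x * e x * w x) + a * \int[mu]_(x in I) (e x * e x * w x).
  by rewrite -IntZ// -IntD//; [apply: Int_eq => x _; ring|exact: L1Z].
have [e0|e0] := eqVneq (\int[mu]_(x in I) (e x * e x * w x)) 0; last first.
  exists (- (\int[mu]_(x in I) (f x * e x * w x)) / \int[mu]_(x in I) (e x * e x * w x)).
  by rewrite E mulfVK// subrr.
exists 0; rewrite E mul0r addr0.
have e_ae : {ae mu, forall x, I x -> e x * e x * w x = 0}.
  apply: Int_eq0_ae => // x /inIP xI.
  by rewrite mulr_ge0 ?(ltW (w_gt0 _ _ xI))// -expr2 sqr_ge0.
rewrite (Int_ae_eq (g := fun=> 0) mI Ife)//; first by rewrite Rintegral_cst// mul0r.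
apply: aeS e_ae => x h xI; have := h xI; have w0 := lt0r_neq0 (w_gt0 alpha beta (inIP xI)).
by move/eqP; rewrite mulf_eq0 (negbTE w0) orbF mulf_eq0 orbb => /eqP ->; rewrite mulr0 mul0r.
Qed.

Lemma L2w_int3 f g1 g2 g3 (a b : R) : L2w f -> L2w g1 -> L2w g2 -> L2w g3 ->
  \int[mu]_(x in I) (f x * (g1 x + a * g2 x + b * g3 x) * w x) =
  \int[mu]_(x in I) (f x * g1 x * w x) + a * \int[mu]_(x in I) (f x * g2 x * w x)
  + b * \int[mu]_(x in I) (f x * g3 x * w x).
Proof.
move=> Lf L1 L2 L3; have J1 := L2wM Lf L1; have J2 := L2wM Lf L2; have J3 := L2wM Lf L3.
have K2 := L1Z a mI J2; have K3 := L1Z b mI J3; have K1 := L1D mI J1 K2.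
rewrite -IntZ// -IntZ// -IntD// -IntD//.
by apply: Int_eq => x _; ring.
Qed.

Lemma L2w_eq0 f : L2w f -> \int[mu]_(x in I) (f x * f x * w x) = 0 ->
  {ae mu, forall x, -1 < x < 1 -> f x = 0}.
Proof.
move=> Lf f0; have : {ae mu, forall x, I x -> f x * f x * w x = 0}.
  apply: Int_eq0_ae => //; first exact: L2wM.
  by move=> x /inIP xI; rewrite mulr_ge0 ?(ltW (w_gt0 _ _ xI))// -expr2 sqr_ge0.
apply: aeS => x h xI; have xI' : I x by rewrite /= in_itv.
have w0 := lt0r_neq0 (w_gt0 alpha beta xI).
by have := h xI'; move/eqP; rewrite mulf_eq0 (negbTE w0) orbF mulf_eq0 orbb => /eqP.
Qed.

Lemma Rep_make z0 y0 h : L2w h -> Rep (fun x => phi x * Zf z0 y0 h x) z0 y0 h.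
Proof. by move=> Lh; split. Qed.

Lemma L2w0 : L2w (fun=> 0).
Proof.
split => //; apply: (@L1_eq _ _ (fun=> 0)) => //; first by move=> x _; rewrite expr0n/= mul0r.
by apply: (@L1_bounded _ _ _ 0) => // [|x _]; rewrite ?normr0// lebesgue_measure_itv/=; case: ifP => _; rewrite -?EFinB ltry.
Qed.

(* Testing against {f : Gamma f = 0} determines a function up to the two-dimensional
   kernel of l + alpha + beta. *)
Lemma Rep_weak g k : L2w g -> L2w k ->
  (forall f h, Rep f 0 0 h -> Yf 0 h 1 = 0 -> Zf 0 0 h 1 = 0 ->
     \int[mu]_(x in I) (h x * g x * w x) = \int[mu]_(x in I) (f x * k x * w x)) ->
  exists v z0 y0, Rep v z0 y0 k /\ {ae mu, forall x, -1 < x < 1 -> g x = v x}.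
Proof.
move=> Lg Lk H.
(* A particular solution of (l + alpha + beta) u = k. It remains to show that d = g - u lies a.e. in
   the kernel. *)
pose u x := phi x * Zf 0 0 k x.
have Ru : Rep u 0 0 k by exact: Rep_make.
have Lu := Rep_L2w halpha hbeta Ru.
pose d x := g x + (-1) * u x.
have Ld : L2w d by exact: L2w_lin.
have dH f h : Rep f 0 0 h -> Yf 0 h 1 = 0 -> Zf 0 0 h 1 = 0 ->
    \int[mu]_(x in I) (h x * d x * w x) = 0.
  move=> Rf Y1 Z1; have [Lh _] := Rf.
  have E1 := Rep_energy halpha hbeta Rf Ru; have E2 := Rep_energy halpha hbeta Ru Rf.
  rewrite Y1 !mul0r subr0 add0r in E1; rewrite Z1 mulr0 mul0r subr0 add0r in E2.
  have E3 : \int[mu]_(x in I) (rr x * Yf 0 h x * Yf 0 k x) = \int[mu]_(x in I) (rr x * Yf 0 k x * Yf 0 h x).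
    by apply: Int_eq => x _; ring.
  have E4 : \int[mu]_(x in I) (f x * k x * w x) = \int[mu]_(x in I) (k x * f x * w x).
    by apply: Int_eq => x _; ring.
  have := H f h Rf Y1 Z1; rewrite E4 E2 -E3 -E1 => E5.
  rewrite (Int_eq (g := fun x => h x * g x * w x - h x * u x * w x)).
    by rewrite (IntB mI (L2wM Lh Lg) (L2wM Lh Lu)) [X in X - _]E5 subrr.
  by move=> x _; rewrite /d; ring.
(* Two kernel elements: [p1] is phi itself, with z = 1 and y = 0, and [p2] has y = -1 and z equal to
   the primitive of r that vanishes at -1. *)
pose p1 x := phi x * Zf 1 0 (fun=> 0) x.
pose p2 x := phi x * Zf 0 (-1) (fun=> 0) x.
have R1 : Rep p1 1 0 (fun=> 0) by apply: Rep_make; exact: L2w0.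
have R2 : Rep p2 0 (-1) (fun=> 0) by apply: Rep_make; exact: L2w0.
have Lp1 := Rep_L2w halpha hbeta R1; have Lp2 := Rep_L2w halpha hbeta R2.
have [c Hc] := L2w_proj Lp2 Lp1.
pose p3 x := p2 x + c * p1 x.
have Lp3 : L2w p3 by exact: L2w_lin.
have [a Ha] := L2w_proj Ld Lp1.
pose d1 x := d x + a * p1 x.
have Ld1 : L2w d1 by exact: L2w_lin.
have [b Hb] := L2w_proj Ld1 Lp3.
(* The component of d orthogonal to the kernel. *)
pose d2 x := d1 x + b * p3 x.
have Ld2 : L2w d2 by exact: L2w_lin.
have D1 : \int[mu]_(x in I) (d2 x * p1 x * w x) = 0.
  rewrite (Int_eq (g := fun x => d1 x * p1 x * w x + b * (p3 x * p1 x * w x))); last first.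
    by move=> x _; rewrite /d2; ring.
  by rewrite IntD ?IntZ ?Ha ?Hc ?mulr0 ?addr0//; [exact: L2wM|exact: L2wM|apply: L1Z => //; exact: L2wM].
have D3 : \int[mu]_(x in I) (d2 x * p3 x * w x) = 0 by exact: Hb.
have D2 : \int[mu]_(x in I) (d2 x * p2 x * w x) = 0.
  rewrite (Int_eq (g := fun x => d2 x * p3 x * w x + (- c) * (d2 x * p1 x * w x))); last first.
    by move=> x _; rewrite /p3; ring.
  by rewrite IntD ?IntZ ?D1 ?D3 ?mulr0 ?addr0//; [exact: L2wM|exact: L2wM|apply: L1Z => //; exact: L2wM].
(* Solve (l + alpha + beta) f = d2 with zero data at -1. By the energy identity, orthogonality of d2
   to p1 and then to p2 says that y and then z vanish at 1. So f is an admissible test function, and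
   testing with it gives d2 = 0 a.e. *)
have Rd2 := Rep_make 0 0 Ld2.
have I2 := L2w_L1 halpha hbeta Ld2.
have I0 := L2w_L1 halpha hbeta L2w0.
have Z1E : forall x, Zf 1 0 (fun=> 0) x = 1.
  move=> x; rewrite /Zf (_ : (fun t => _) \_ I = fun=> 0).
    by rewrite /Ji Rintegral_cst// mul0r subr0.
  apply/funext => t; rewrite patchE; case: ifP => // _.
  rewrite /Yf (_ : (fun=> 0) \_ I = fun=> 0) ?/Ji ?Rintegral_cst// ?mul0r ?addr0 ?mulr0//.
  by apply/funext => s; rewrite patchE; case: ifP.
have Y1 : Yf 0 d2 1 = 0.
  have := Rep_energy halpha hbeta Rd2 R1; rewrite D1 !Z1E mulr1 mul0r subr0.
  rewrite (Int_eq (g := fun=> 0)); first by rewrite Rintegral_cst// mul0r addr0.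
  move=> x _; rewrite /Yf (_ : (fun=> 0) \_ I = fun=> 0) ?/Ji ?Rintegral_cst// ?mul0r ?addr0 ?mulr0//.
  by apply/funext => s; rewrite patchE; case: ifP.
have Z1 : Zf 0 0 d2 1 = 0.
  have := Rep_energy halpha hbeta Rd2 R2; rewrite D2 Y1 !mul0r subr0 add0r.
  rewrite (Zf_right halpha hbeta)// sub0r (Int_eq (g := fun x => (-1) * (rr x * Yf 0 d2 x))).
    by rewrite IntZ//; [rewrite mulN1r => <-|exact: (L1_rrY halpha hbeta)].
  move=> x _; rewrite /(Yf (-1)) (_ : (fun=> 0) \_ I = fun=> 0) ?/Ji ?Rintegral_cst// ?mul0r ?addr0.
    by ring.
  by apply/funext => s; rewrite patchE; case: ifP.
have D0 := dH _ _ Rd2 Y1 Z1.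
have DD : \int[mu]_(x in I) (d2 x * d2 x * w x) = 0.
  apply: etrans (L2w_int3 a b Ld2 Ld Lp1 Lp3) _.
  by rewrite [X in X + _ + _]D0 [X in _ + a * X + _]D1 [X in _ + b * X]D3 !mulr0 !addr0.
have d2ae := L2w_eq0 Ld2 DD.
have Rp3 := Rep_lin halpha hbeta c R2 R1.
have Rv := Rep_lin halpha hbeta (- b) (Rep_lin halpha hbeta (- a) Ru R1) Rp3.
have kE x : -1 < x < 1 -> k x + - a * 0 + - b * (0 + c * 0) = k x by move=> _; ring.
have Rk := Rep_eq_h (k := k) kE Rv.
do 3 eexists; split; first exact: Rk.
apply: aeS d2ae => x h xI; have := h xI; rewrite /d2 /d1 /d /p3 => E.
rewrite -[RHS]add0r -E; ring.
Qed.

End JacobiBoundary.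

(** * The boundary triple and the self-adjoint extensions *)

Local Open Scope complex_scope.

(** * Passage to complex-valued functions *)

Section ComplexParts.
Variable R : realType.
Notation Re := (@complex.Re _).
Notation Im := (@complex.Im _).
Implicit Types (x y : R[i]) (r : R).

Lemma ReD x y : Re (x + y) = Re x + Re y. Proof. by case: x; case: y. Qed.
Lemma ImD x y : Im (x + y) = Im x + Im y. Proof. by case: x; case: y. Qed.
Lemma ReN x : Re (- x) = - Re x. Proof. by case: x. Qed.
Lemma ImN x : Im (- x) = - Im x. Proof. by case: x. Qed.
Lemma ReM x y : Re (x * y) = Re x * Re y - Im x * Im y. Proof. by case: x; case: y. Qed.
Lemma ImM x y : Im (x * y) = Re x * Im y + Im x * Re y. Proof. by case: x; case: y. Qed.
Lemma ReJ x : Re x^* = Re x. Proof. by case: x. Qed.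
Lemma ImJ x : Im x^* = - Im x. Proof. by case: x. Qed.
Lemma ReC r : Re r%:C = r. Proof. by []. Qed.
Lemma ImC r : Im r%:C = 0. Proof. by []. Qed.
Lemma Re0 : Re (0 : R[i]) = 0. Proof. by []. Qed.
Lemma Im0 : Im (0 : R[i]) = 0. Proof. by []. Qed.
Lemma Re1 : Re (1 : R[i]) = 1. Proof. by []. Qed.
Lemma Im1 : Im (1 : R[i]) = 0. Proof. by []. Qed.

Lemma ReP r (t : R) : Re (r +i* t) = r. Proof. by []. Qed.
Lemma ImP r (t : R) : Im (r +i* t) = t. Proof. by []. Qed.

Definition cE := (ReP, ImP, ReD, ImD, ReN, ImN, ReM, ImM, ReJ, ImJ, ReC, ImC, Re0, Im0, Re1, Im1).

Lemma cext x y : Re x = Re y -> Im x = Im y -> x = y.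
Proof. by case: x => a b; case: y => c d /= -> ->. Qed.

End ComplexParts.

Section ComplexJacobi.
Variables (R : realType) (alpha beta : R).
Hypotheses (halpha : 0 < alpha < 1) (hbeta : 0 < beta < 1).
Notation Re := (@complex.Re R).
Notation Im := (@complex.Im R).
Notation mu := (@lebesgue_measure R).
Notation w := (weight alpha beta).
Notation I := (`]-1, 1[%classic : set R).
Notation L2w := (L2w alpha beta).
Notation inH := (inH alpha beta).
Notation ip := (ip alpha beta).
Implicit Types (f g h k : R -> R[i]) (x : R).

Let inIP x : I x -> -1 < x < 1. Proof. by rewrite /= in_itv. Qed.
Let mI : measurable I. Proof. exact: measurable_itv. Qed.

Lemma inHP f : inH f <-> L2w (Re \o f) /\ L2w (Im \o f).
Proof.
split=> [[mr mi If]|[[mr Ir] [mi Ii]]].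
  have mm : measurable_fun I (fun x => sqnormc (f x) * w x).
    apply: measurable_funM; last exact: w_meas.
    by apply: measurable_funD; exact: measurable_funX.
  have LI : L1 I (fun x => sqnormc (f x) * w x).
    apply: L1_ge0P => // x /inIP xI; apply: mulr_ge0; last exact: ltW (w_gt0 _ _ xI).
    by rewrite addr_ge0 ?sqr_ge0.
  have key (u : R -> R) : measurable_fun I u -> (forall x, u x ^+ 2 <= sqnormc (f x)) -> L2w u.
    move=> mu_ uf; split => //; apply: (@L1_le _ _ (fun x => sqnormc (f x) * w x)) => //.
      by apply: measurable_funM; [exact: measurable_funX|exact: w_meas].
    move=> x /inIP xI; have w0 := w_gt0 alpha beta xI.
    have u0 : 0 <= u x ^+ 2 * w x by exact: mulr_ge0 (sqr_ge0 _) (ltW w0).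
    by rewrite (ger0_norm u0); exact: ler_wpM2r (ltW w0) _ _ (uf x).
  by split; apply: key => // x; rewrite /sqnormc/= ?lerDl ?lerDr ?sqr_ge0.
split=> //.
have LI : L1 I (fun x => sqnormc (f x) * w x).
  by apply: (@L1_eq _ _ (fun x => (Re \o f) x ^+ 2 * w x + (Im \o f) x ^+ 2 * w x)) => //;
    [move=> x _; rewrite /sqnormc mulrDl|exact: L1D].
exact: L1_lty.
Qed.

Definition rip (u v : R -> R) : R := \int[mu]_(x in I) (u x * v x * w x).

Lemma ipE f g : inH f -> inH g ->
  ip f g = (rip (Re \o f) (Re \o g) + rip (Im \o f) (Im \o g))
    +i* (rip (Im \o f) (Re \o g) - rip (Re \o f) (Im \o g)).
Proof.
move=> /inHP[fr fi] /inHP[gr gi]; rewrite /Defs.ip /cintegral; congr (_ +i* _); rewrite /rip.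
  rewrite -IntD//; [|exact: L2wM|exact: L2wM].
  by apply: Int_eq => x _; rewrite /comp !cE; ring.
rewrite -IntB//; [|exact: L2wM|exact: L2wM].
by apply: Int_eq => x _; rewrite /comp !cE; ring.
Qed.

Lemma ripDl u1 u2 v (c : R) : L2w u1 -> L2w u2 -> L2w v ->
  rip (fun x => u1 x + c * u2 x) v = rip u1 v + c * rip u2 v.
Proof.
move=> Lu1 Lu2 Lv; have J2 := L2wM Lu2 Lv; have J1 := L2wM Lu1 Lv.
rewrite /rip -IntZ// -IntD//; last exact: L1Z.
by apply: Int_eq => x _; ring.
Qed.

Lemma ripC u v : rip u v = rip v u.
Proof. by apply: Int_eq => x _; ring. Qed.

Lemma ipC f g : inH f -> inH g -> ip g f = (ip f g)^*.
Proof.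
move=> Hf Hg; rewrite !ipE//.
by apply: cext; rewrite !cE ![rip (_ \o g) _]ripC; ring.
Qed.

Lemma inH_lin f g (c : R[i]) : inH f -> inH g -> inH (fun x => f x + c * g x).
Proof.
move=> /inHP[fr fi] /inHP[gr gi]; apply/inHP; split.
  apply: (@L2w_eq _ _ _ (fun x => ((Re \o f) x + Re c * (Re \o g) x) + (- Im c) * (Im \o g) x)).
    by move=> x _; rewrite /comp !cE; ring.
  by do 2 apply: L2w_lin => //.
apply: (@L2w_eq _ _ _ (fun x => ((Im \o f) x + Re c * (Im \o g) x) + Im c * (Re \o g) x)).
  by move=> x _; rewrite /comp !cE; ring.
by do 2 apply: L2w_lin => //.
Qed.

Lemma ipDl f1 f2 g (c : R[i]) : inH f1 -> inH f2 -> inH g ->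
  ip (fun x => f1 x + c * f2 x) g = ip f1 g + c * ip f2 g.
Proof.
move=> H1 H2 Hg; have H12 := inH_lin c H1 H2; rewrite !ipE//.
have [/inHP[r1 i1] /inHP[r2 i2] /inHP[gr gi]] := And3 H1 H2 Hg.
have Er v : L2w v -> rip (Re \o (fun x => f1 x + c * f2 x)) v =
    rip (Re \o f1) v + Re c * rip (Re \o f2) v - Im c * rip (Im \o f2) v.
  move=> Lv; rewrite -mulNr -ripDl// -ripDl//; last exact: L2w_lin.
  by apply: Int_eq => x _; rewrite /comp !cE; ring.
have Ei v : L2w v -> rip (Im \o (fun x => f1 x + c * f2 x)) v =
    rip (Im \o f1) v + Re c * rip (Im \o f2) v + Im c * rip (Re \o f2) v.
  move=> Lv; rewrite -ripDl// -ripDl//; last exact: L2w_lin.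
  by apply: Int_eq => x _; rewrite /comp !cE; ring.
rewrite (Er _ gr) (Er _ gi) (Ei _ gr) (Ei _ gi).
by apply: cext; rewrite !cE; ring.
Qed.

Lemma ipDr f g1 g2 (c : R[i]) : inH f -> inH g1 -> inH g2 ->
  ip f (fun x => g1 x + c * g2 x) = ip f g1 + c^* * ip f g2.
Proof.
move=> Hf H1 H2; have H12 := inH_lin c H1 H2.
rewrite (ipC H12 Hf) (ipDl c H1 H2 Hf) (ipC Hf H1) (ipC Hf H2).
by apply: cext; rewrite !cE; ring.
Qed.

Lemma eqH_refl f : eqH f f. Proof. exact: aeW. Qed.

Lemma eqH_sym f g : eqH f g -> eqH g f.
Proof. by apply: aeS => x h xI; rewrite h. Qed.

Lemma eqH_trans f g h : eqH f g -> eqH g h -> eqH f h.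
Proof. by move=> fg gh; apply: aeS (aeI fg gh) => x [h1 h2] xI; rewrite h1// h2. Qed.

Lemma eqH_ip f1 f2 g : inH f1 -> inH f2 -> inH g -> eqH f1 f2 -> ip f1 g = ip f2 g.
Proof.
move=> H1 H2 Hg e; rewrite !ipE//.
have [/inHP[r1 i1] /inHP[r2 i2] /inHP[gr gi]] := And3 H1 H2 Hg.
have key (p : R[i] -> R) v : L2w (p \o f1) -> L2w (p \o f2) -> L2w v -> rip (p \o f1) v = rip (p \o f2) v.
  move=> La Lb Lv; apply: Int_ae_eq => //; [exact: L2wM|exact: L1_meas (L2wM _ _)|].
  by apply: aeS e => x ex xI; rewrite /comp ex.
by rewrite !(key Re)// !(key Im).
Qed.

Lemma eqH_ipr f1 f2 g : inH f1 -> inH f2 -> inH g -> eqH f1 f2 -> ip g f1 = ip g f2.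
Proof. by move=> H1 H2 Hg e; rewrite ipC// [RHS]ipC// (eqH_ip H1 H2 Hg e). Qed.

Lemma sqnormH_ge0 f : inH f -> 0 <= sqnormH alpha beta f.
Proof.
move=> Hf; rewrite /sqnormH ipE//= addr_ge0//; apply: Int_ge0 => x /inIP xI;
  by rewrite mulr_ge0 ?(ltW (w_gt0 _ _ xI))// -expr2 sqr_ge0.
Qed.

Lemma ip_self f : inH f -> ip f f = (sqnormH alpha beta f)%:C.
Proof. by move=> Hf; apply: cext => //; rewrite ipE//= ripC subrr. Qed.

End ComplexJacobi.

(** * Boundary values and Green's identity for complex-valued functions *)

Section ComplexRepresentation.
Variables (R : realType) (alpha beta : R).
Hypotheses (halpha : 0 < alpha < 1) (hbeta : 0 < beta < 1).
Notation Re := (@complex.Re R).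
Notation Im := (@complex.Im R).
Notation mu := (@lebesgue_measure R).
Notation w := (weight alpha beta).
Notation I := (`]-1, 1[%classic : set R).
Notation rr := (rr alpha beta).
Notation Zf := (Zf alpha beta).
Notation Rep := (Rep alpha beta).
Notation inH := (inH alpha beta).
Notation ip := (ip alpha beta).
Notation rip := (rip alpha beta).
Notation ell := (ell alpha beta).
Notation Dmax := (Dmax alpha beta).
Notation s := ((alpha + beta)%:C : R[i]).
Implicit Types (f g h k : R -> R[i]) (x : R).

Let inIP x : I x -> -1 < x < 1. Proof. by rewrite /= in_itv. Qed.
Let Iin x : -1 < x < 1 -> I x. Proof. by rewrite /= in_itv. Qed.
Let mI : measurable I. Proof. exact: measurable_itv. Qed.

(* [CZ1] and [CY1] are the values of z and y at 1, [cen] is the integral of rr y1 (y2)^*. *)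
Definition CRep f (z0 y0 : R[i]) k : Prop :=
  Rep (Re \o f) (Re z0) (Re y0) (Re \o k) /\ Rep (Im \o f) (Im z0) (Im y0) (Im \o k).

Definition CZ1 (z0 y0 : R[i]) k : R[i] :=
  Zf (Re z0) (Re y0) (Re \o k) 1 +i* Zf (Im z0) (Im y0) (Im \o k) 1.

Definition CY1 (y0 : R[i]) k : R[i] :=
  Yf (Re y0) (Re \o k) 1 +i* Yf (Im y0) (Im \o k) 1.

Definition ren (a b : R -> R) : R := \int[mu]_(x in I) (rr x * a x * b x).

Definition cen (y1 : R[i]) k1 (y2 : R[i]) k2 : R[i] :=
  (ren (Yf (Re y1) (Re \o k1)) (Yf (Re y2) (Re \o k2))
   + ren (Yf (Im y1) (Im \o k1)) (Yf (Im y2) (Im \o k2)))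
  +i* (ren (Yf (Im y1) (Im \o k1)) (Yf (Re y2) (Re \o k2))
       - ren (Yf (Re y1) (Re \o k1)) (Yf (Im y2) (Im \o k2))).

Lemma renC a b : ren a b = ren b a.
Proof. by apply: Int_eq => x _; ring. Qed.

Lemma cenC y1 k1 y2 k2 : cen y2 k2 y1 k1 = (cen y1 k1 y2 k2)^*.
Proof.
have E (a b c d a' b' c' d' : R) : a = a' -> b = b' -> c = c' -> d = d' ->
    (a + b) +i* (c - d) = ((a' + b') +i* (d' - c'))^*.
  by move=> -> -> -> ->; apply: cext; rewrite !cE; ring.
by apply: E; exact: renC.
Qed.

Lemma CRep_inH f z0 y0 k : CRep f z0 y0 k -> inH f.
Proof.
by move=> [R1 R2]; apply/(inHP _ _ _); split;
  [exact: (Rep_L2w halpha hbeta R1)|exact: (Rep_L2w halpha hbeta R2)].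
Qed.

Lemma CRep_inHk f z0 y0 k : CRep f z0 y0 k -> inH k.
Proof. by move=> [[L1 _] [L2 _]]; apply/(inHP _ _ _). Qed.

Lemma CRep_eq f g z0 y0 k : (forall x, -1 < x < 1 -> f x = g x) ->
  CRep f z0 y0 k -> CRep g z0 y0 k.
Proof.
move=> fg [R1 R2]; split; [apply: Rep_eq R1|apply: Rep_eq R2] => x xI;
  by rewrite /comp fg.
Qed.

Lemma CRep_lin f1 z1 y1 k1 f2 z2 y2 k2 (c : R[i]) : CRep f1 z1 y1 k1 -> CRep f2 z2 y2 k2 ->
  CRep (fun x => f1 x + c * f2 x) (z1 + c * z2) (y1 + c * y2) (fun x => k1 x + c * k2 x).
Proof.
move=> [R1 I1] [R2 I2]; split.
  have := Rep_lin halpha hbeta (- Im c) (Rep_lin halpha hbeta (Re c) R1 R2) I2.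
  rewrite (_ : Re z1 + _ + _ = Re (z1 + c * z2)); last by rewrite !cE; ring.
  rewrite (_ : Re y1 + _ + _ = Re (y1 + c * y2)); last by rewrite !cE; ring.
  move=> RR; apply: (Rep_eq (u := fun x => (Re \o f1) x + Re c * (Re \o f2) x + (- Im c) * (Im \o f2) x)).
    by move=> x _; rewrite /comp !cE; ring.
  apply: (Rep_eq_h _ RR) => x _.
  by rewrite /comp !cE; ring.
have := Rep_lin halpha hbeta (Im c) (Rep_lin halpha hbeta (Re c) I1 I2) R2.
rewrite (_ : Im z1 + _ + _ = Im (z1 + c * z2)); last by rewrite !cE; ring.
rewrite (_ : Im y1 + _ + _ = Im (y1 + c * y2)); last by rewrite !cE; ring.
move=> RR; apply: (Rep_eq (u := fun x => (Im \o f1) x + Re c * (Im \o f2) x + Im c * (Re \o f2) x)).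
  by move=> x _; rewrite /comp !cE; ring.
apply: (Rep_eq_h _ RR) => x _.
by rewrite /comp !cE; ring.
Qed.

Lemma ellE f x : ell f x =
  (- (w x)^-1 * derive1 (fun y => pJ alpha beta y * derive1 (Re \o f) y) x)
  +i* (- (w x)^-1 * derive1 (fun y => pJ alpha beta y * derive1 (Im \o f) y) x).
Proof.
rewrite /Defs.ell /cderiv.
rewrite (_ : Re \o pderiv alpha beta f = fun y => pJ alpha beta y * derive1 (Re \o f) y); last first.
  by apply/funext => y; rewrite /comp /pderiv /cderiv !cE mul0r subr0.
rewrite (_ : Im \o pderiv alpha beta f = fun y => pJ alpha beta y * derive1 (Im \o f) y); last first.
  by apply/funext => y; rewrite /comp /pderiv /cderiv !cE mul0r addr0.
by move: (w x)^-1 (derive1 _ x) (derive1 _ x) => a b c; apply: cext; rewrite !cE; ring.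
Qed.

Lemma Dmax_CRep f h : Dmax f -> inH h -> eqH h (ell f) ->
  exists z0 y0, CRep f z0 y0 (fun x => h x + s * f x).
Proof.
move=> [/(inHP _ _ _)[fr fi] fac dfac _] /(inHP _ _ _)[hr hi] hl.
have dRe : Re \o cderiv f = derive1 (Re \o f) by apply/funext.
have dIm : Im \o cderiv f = derive1 (Im \o f) by apply/funext.
have [|||z0 [y0 R1]] := ell_Rep halpha hbeta fr hr _ _ _.
- by move=> c d c1 cd d1; have [] := fac c d c1 cd d1.
- by move=> c d c1 cd d1; have [] := dfac c d c1 cd d1; rewrite dRe.
- by apply: aeS hl => x hx xI; rewrite /comp (hx (Iin xI)) ellE ?ReP ?ImP.
have [|||z0' [y0' R2]] := ell_Rep halpha hbeta fi hi _ _ _.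
- by move=> c d c1 cd d1; have [] := fac c d c1 cd d1.
- by move=> c d c1 cd d1; have [] := dfac c d c1 cd d1; rewrite dIm.
- by apply: aeS hl => x hx xI; rewrite /comp (hx (Iin xI)) ellE ?ReP ?ImP.
exists (z0 +i* z0'), (y0 +i* y0'); split.
  by apply: Rep_eq_h R1 => x _; rewrite /comp !cE; ring.
by apply: Rep_eq_h R2 => x _; rewrite /comp !cE; ring.
Qed.

Lemma CRep_eqH f z0 y0 k : CRep f z0 y0 k -> eqH (ell f) (fun x => k x + (- s) * f x).
Proof.
move=> [R1 R2]; apply: aeS (aeI (Rep_ell_ae halpha hbeta R1) (Rep_ell_ae halpha hbeta R2)) => x [E1 E2] /inIP xI.
rewrite ellE; apply: cext; rewrite ?ReP ?ImP.
  apply: etrans (E1 xI) _; rewrite /comp; move: (f x) (k x) => a b.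
  by rewrite !cE; ring.
apply: etrans (E2 xI) _; rewrite /comp; move: (f x) (k x) => a b.
by rewrite !cE; ring.
Qed.

Lemma CRep_Dmax f z0 y0 k : CRep f z0 y0 k -> Dmax f.
Proof.
move=> Rf; have [R1 R2] := Rf.
have dRe : Re \o cderiv f = derive1 (Re \o f) by apply/funext.
have dIm : Im \o cderiv f = derive1 (Im \o f) by apply/funext.
split.
- exact: CRep_inH Rf.
- move=> c d c1 cd d1; split; [exact: (Rep_abs_cont halpha hbeta R1)|exact: (Rep_abs_cont halpha hbeta R2)].
- move=> c d c1 cd d1; rewrite dRe dIm.
  split; [exact: (Rep_abs_cont_derive halpha hbeta R1)|exact: (Rep_abs_cont_derive halpha hbeta R2)].
- exists (fun x => k x + (- s) * f x); last exact: CRep_eqH Rf.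
  by apply: inH_lin; [exact: CRep_inHk Rf|exact: CRep_inH Rf].
Qed.

Lemma Dmax_ex f : Dmax f -> exists z0 y0 k, CRep f z0 y0 k.
Proof.
move=> Df; have [_ _ _ [h Hh hl]] := Df.
by have [z0 [y0 Rf]] := Dmax_CRep Df Hh (eqH_sym hl); exists z0, y0, (fun x => h x + s * f x).
Qed.

Lemma clim_val (F : set_system R) (FF : ProperFilter F) f (a : R[i]) :
  Re (f x) @[x --> F] --> Re a -> Im (f x) @[x --> F] --> Im a -> clim F f = a.
Proof.
move=> cr ci; apply: cext; rewrite /clim !cE.
  exact: (cvg_lim (@Rhausdorff R) cr).
exact: (cvg_lim (@Rhausdorff R) ci).
Qed.

Section GammaValues.
Variables (f k : R -> R[i]) (z0 y0 : R[i]).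
Hypothesis Rf : CRep f z0 y0 k.

Lemma CRep_pderiv_left :
  Re (- pderiv alpha beta f x) @[x --> (-1 : R)^'+] --> Re ((2 * beta)%:C * z0) /\
  Im (- pderiv alpha beta f x) @[x --> (-1 : R)^'+] --> Im ((2 * beta)%:C * z0).
Proof.
have [R1 R2] := Rf; split; rewrite !cE mul0r ?subr0 ?addr0.
  apply: cvg_at_left_end (Rep_f0_left halpha hbeta R1) => x _.
  by rewrite /pderiv /cderiv !cE; ring.
apply: cvg_at_left_end (Rep_f0_left halpha hbeta R2) => x _.
by rewrite /pderiv /cderiv !cE; ring.
Qed.

Lemma CRep_pderiv_right :
  Re (pderiv alpha beta f x) @[x --> (1 : R)^'-] --> Re ((2 * alpha)%:C * CZ1 z0 y0 k) /\
  Im (pderiv alpha beta f x) @[x --> (1 : R)^'-] --> Im ((2 * alpha)%:C * CZ1 z0 y0 k).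
Proof.
have [R1 R2] := Rf; split; rewrite !cE mul0r ?subr0 ?addr0.
  apply: cvg_at_right_end (Rep_f0_right halpha hbeta R1) => x _.
  by rewrite /pderiv /cderiv !cE; ring.
apply: cvg_at_right_end (Rep_f0_right halpha hbeta R2) => x _.
by rewrite /pderiv /cderiv !cE; ring.
Qed.

Lemma CRep_f0_left : f0_left alpha beta f = (2 * beta)%:C * z0.
Proof. by have [h1 h2] := CRep_pderiv_left; exact: clim_val. Qed.

Lemma CRep_f0_right : f0_right alpha beta f = (2 * alpha)%:C * CZ1 z0 y0 k.
Proof. by have [h1 h2] := CRep_pderiv_right; exact: clim_val. Qed.

Lemma CRep_f1_left : f1_left beta f = ((2 * beta)^-1)%:C * y0.
Proof.
have [R1 R2] := Rf; apply: clim_val; rewrite [X in _ --> X]cE mul0r ?subr0 ?addr0 mulrC.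
  apply: cvg_at_left_end (Rep_f1_left halpha hbeta R1) => x _.
  by rewrite /cderiv !cE; ring.
apply: cvg_at_left_end (Rep_f1_left halpha hbeta R2) => x _.
by rewrite /cderiv !cE; ring.
Qed.

Lemma CRep_f1_right : f1_right alpha f = ((2 * alpha)^-1)%:C * CY1 y0 k.
Proof.
have [R1 R2] := Rf; apply: clim_val.
  apply: cv_val (cvg_at_right_end _ (Rep_f1_right halpha hbeta R1)) _ => [x _|].
    by rewrite /cderiv !cE; ring.
  by rewrite /CY1 !cE; ring.
apply: cv_val (cvg_at_right_end _ (Rep_f1_right halpha hbeta R2)) _ => [x _|].
  by rewrite /cderiv !cE; ring.
by rewrite /CY1 !cE; ring.
Qed.

End GammaValues.

Lemma dot2E (a b c d : R[i]) : dot2 (col2 a b) (col2 c d) = a * c^* + b * d^*.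
Proof. by rewrite /dot2 big_ord_recl big_ord1 /col2 !mxE. Qed.

Lemma dot2C (u v : 'cV[R[i]]_2) : dot2 u v = (dot2 v u)^*.
Proof.
rewrite /dot2 !big_ord_recl !big_ord0 !addr0.
move: (u _ _) (v _ _) (u _ _) (v _ _) => a b c d.
by apply: cext; rewrite !cE; ring.
Qed.

Let green_alg (a b c d : 'cV[R[i]]_2) (e : R[i]) :
  dot2 a b + e - (dot2 c d + e^*)^* = dot2 a b - dot2 d c.
Proof.
rewrite (dot2C d c); move: (dot2 a b) (dot2 c d) => p q.
by apply: cext; rewrite !cE; ring.
Qed.

Lemma rip_energy (u1 u2 h1 h2 : R -> R) (z1 y1 z2 y2 : R) : Rep u1 z1 y1 h1 -> Rep u2 z2 y2 h2 ->
  rip h1 u2 = Yf y1 h1 1 * Zf z2 y2 h2 1 - y1 * z2 + ren (Yf y1 h1) (Yf y2 h2).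
Proof. by move=> R1 R2; exact: (Rep_energy halpha hbeta R1 R2). Qed.

Lemma CRep_energy f1 z1 y1 k1 f2 z2 y2 k2 : CRep f1 z1 y1 k1 -> CRep f2 z2 y2 k2 ->
  ip k1 f2 = dot2 (Gamma1 alpha beta f1) (Gamma0 alpha beta f2) + cen y1 k1 y2 k2.
Proof.
move=> R1 R2.
have a0 : alpha != 0 by case/andP: halpha => a0 _; rewrite gt_eqF.
have b0 : beta != 0 by case/andP: hbeta => b0 _; rewrite gt_eqF.
rewrite /Gamma1 /Gamma0 dot2E.
rewrite (CRep_f0_left R2) (CRep_f0_right R2) (CRep_f1_left R1) (CRep_f1_right R1).
rewrite (ipE (CRep_inHk R1) (CRep_inH R2)).
have [[Ra Ia] [Rb Ib]] := (R1, R2).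
rewrite (rip_energy Ra Rb) (rip_energy Ia Ib) (rip_energy Ia Rb) (rip_energy Ra Ib).
rewrite /CY1 /CZ1 /cen; move: (ren _ _) (ren _ _) (ren _ _) (ren _ _) => e1 e2 e3 e4.
move: (Yf _ _ 1) (Yf _ _ 1) (Zf _ _ _ 1) (Zf _ _ _ 1) => ya yb za zb.
by apply: cext; rewrite !cE; field; rewrite a0 b0.
Qed.

(** The energy identity antisymmetrized: its integral term is Hermitian and drops out. *)
Lemma CRep_Green f1 z1 y1 k1 f2 z2 y2 k2 : CRep f1 z1 y1 k1 -> CRep f2 z2 y2 k2 ->
  ip k1 f2 - ip f1 k2 = dot2 (Gamma1 alpha beta f1) (Gamma0 alpha beta f2)
    - dot2 (Gamma0 alpha beta f1) (Gamma1 alpha beta f2).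
Proof.
move=> R1 R2; rewrite (CRep_energy R1 R2).
rewrite (ipC (CRep_inHk R2) (CRep_inH R1)) (CRep_energy R2 R1) (cenC y1 k1).
exact: green_alg.
Qed.

Lemma Rep0 : Rep (fun=> 0) 0 0 (fun=> 0).
Proof.
split; first exact: L2w0.
move=> x _; rewrite /Zf (_ : (fun t => _) \_ I = fun=> 0) /Ji ?Rintegral_cst// ?mul0r ?subr0 ?mulr0//.
apply/funext => t; rewrite patchE; case: ifP => // _.
rewrite /Yf (_ : (fun=> 0) \_ I = fun=> 0) ?/Ji ?Rintegral_cst// ?mul0r ?addr0 ?mulr0//.
by apply/funext => r; rewrite patchE; case: ifP.
Qed.

Lemma Yf00 x : Yf 0 (fun=> 0) x = 0 :> R.
Proof.
rewrite /Yf (_ : (fun=> 0) \_ I = fun=> 0) ?/Ji ?Rintegral_cst// ?mul0r ?addr0//.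
by apply/funext => r; rewrite patchE; case: ifP.
Qed.

Lemma Zf00 x : Zf 0 0 (fun=> 0) x = 0.
Proof.
rewrite /Zf (_ : (fun t => _) \_ I = fun=> 0) /Ji ?Rintegral_cst// ?mul0r ?subr0//.
by apply/funext => t; rewrite patchE; case: ifP => // _; rewrite Yf00 mulr0.
Qed.

(** Real-valued test functions already give the weak equation for the real and for the imaginary
    part of g separately. *)
Lemma CRep_weak g k : inH g -> inH k ->
  (forall f h, CRep f 0 0 h -> CY1 0 h = 0 -> CZ1 0 0 h = 0 -> ip h g = ip f k) ->
  exists v z0 y0, CRep v z0 y0 k /\ eqH g v.
Proof.
move=> Hg Hk H.
have /(inHP _ _ _)[gr gi] := Hg; have /(inHP _ _ _)[kr ki] := Hk.
have key (u h : R -> R) : Rep u 0 0 h -> Yf 0 h 1 = 0 -> Zf 0 0 h 1 = 0 ->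
    rip h (Re \o g) = rip u (Re \o k) /\ rip h (Im \o g) = rip u (Im \o k).
  move=> Ru Y1 Z1.
  have Rc : CRep (fun x => (u x)%:C) 0 0 (fun x => (h x)%:C) by split; [exact: Ru|exact: Rep0].
  have c1 : CY1 0 (fun x => (h x)%:C) = 0.
    by apply: cext; rewrite /CY1 !cE; [exact: Y1|exact: Yf00].
  have c2 : CZ1 0 0 (fun x => (h x)%:C) = 0.
    by apply: cext; rewrite /CZ1 !cE; [exact: Z1|exact: Zf00].
  have := H _ _ Rc c1 c2.
  rewrite (ipE (CRep_inHk Rc) Hg) (ipE (CRep_inH Rc) Hk).
  have r0 v : rip (Im \o (fun x => (h x)%:C)) v = 0.
    rewrite /rip (Int_eq (g := fun=> 0)) ?Rintegral_cst ?mul0r// => x _.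
    by rewrite /comp !cE !mul0r.
  have r0' v : rip (Im \o (fun x => (u x)%:C)) v = 0.
    rewrite /rip (Int_eq (g := fun=> 0)) ?Rintegral_cst ?mul0r// => x _.
    by rewrite /comp !cE !mul0r.
  rewrite !r0 ?r0' !addr0 !sub0r => -[e1 /oppr_inj e2].
  by split.
have [|v1 [z1 [y1 [R1 e1]]]] := Rep_weak halpha hbeta gr kr _.
  by move=> u h Ru Y1 Z1; have [] := key u h Ru Y1 Z1.
have [|v2 [z2 [y2 [R2 e2]]]] := Rep_weak halpha hbeta gi ki _.
  by move=> u h Ru Y1 Z1; have [] := key u h Ru Y1 Z1.
exists (fun x => v1 x +i* v2 x), (z1 +i* z2), (y1 +i* y2); split; first exact: (conj R1 R2).
apply: aeS (aeI e1 e2) => x [h1 h2] /inIP xI.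
by apply: cext; rewrite !cE; [exact: h1|exact: h2].
Qed.

End ComplexRepresentation.

(** * Surjectivity of the boundary maps *)

Section BoundaryValues.
Variables (R : realType) (alpha beta : R).
Hypotheses (halpha : 0 < alpha < 1) (hbeta : 0 < beta < 1).
Notation Re := (@complex.Re R).
Notation Im := (@complex.Im R).
Notation mu := (@lebesgue_measure R).
Notation is_der x f df := (is_derive (x : R) (1 : R) (f : R -> R) (df : R)).
Notation w := (weight alpha beta).
Notation I := (`]-1, 1[%classic : set R).
Notation rr := (rr alpha beta).
Notation Zf := (Zf alpha beta).
Notation L2w := (L2w alpha beta).
Notation CRep := (CRep alpha beta).
Notation CZ1 := (CZ1 alpha beta).
Implicit Types (u U h : R -> R) (x : R).

Let inIP x : I x -> -1 < x < 1. Proof. by rewrite /= in_itv. Qed.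
Let mI : measurable I. Proof. exact: measurable_itv. Qed.

Lemma L1_C0 u U : (forall x, is_der x U (u x)) -> continuous u -> L1 I u.
Proof.
move=> DU cu; have N11 : (-1 : R) < 1 by lra.
have [Iu _] := cc_FTC N11 (fun x _ => DU x) (fun x _ => cu x).
by apply: L1_sub Iu => // x /=; rewrite !in_itv/= => /andP[a b]; rewrite !ltW.
Qed.

Lemma Yf_primitive u U y0 x : (forall x, is_der x U (u x)) -> continuous u ->
  -1 <= x <= 1 -> Yf y0 u x = y0 + (U x - U (-1)).
Proof.
move=> DU cu /andP[]; rewrite le_eqVlt => /predU1P[<- _|x0 x1].
  by rewrite Yf_left subrr addr0.
have [Iu E] := cc_FTC x0 (fun x _ => DU x) (fun x _ => cu x).
have Ip := L1_patch (L1_C0 DU cu).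
rewrite /Yf -E; congr (_ + _); rewrite -[LHS]subr0 -(@Ji_patch_left _ u (-1))//.
rewrite JiB ?ltW// -[LHS]Rintegral_itv_bndo_bndc; last by apply: (L1_sub _ _ _ Ip).
rewrite -[RHS]Rintegral_itv_obnd_cbnd; last first.
  by apply: (L1_sub _ _ _ Iu) => // y /=; rewrite !in_itv/= => /andP[a b]; rewrite ltW.
rewrite -[RHS]Rintegral_itv_bndo_bndc; last first.
  by apply: (L1_sub _ _ _ Iu) => // y /=; rewrite !in_itv/= => /andP[a b]; rewrite !ltW.
apply: Int_eq => y /=; rewrite in_itv/= => /andP[y0' y1]; apply: patchI.
by rewrite y0' (lt_le_trans y1).
Qed.

Lemma L2w_C0 u : continuous u -> L2w u.
Proof.
move=> cu; have N11 : (-1 : R) < 1 by lra.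
have mu_ : measurable_fun I u by apply: continuous_meas_oo => x _; exact: cu.
have [M HM] := cont_bounded N11 (fun x _ => cu x).
split=> //; apply: (@L1_bounded _ _ _ (M ^+ 2 * 4)) => //.
- by rewrite lebesgue_measure_itv/= lte_fin N11 -EFinB ltry.
- by apply: measurable_funM; [exact: measurable_funX|exact: w_meas].
move=> x /inIP xI; have w0 := w_gt0 alpha beta xI; have [x0 x1] := andP xI.
have uM : `|u x| <= M by apply: HM; rewrite !ltW.
rewrite normrM normrX (gtr0_norm w0); apply: ler_pM; [exact: sqr_ge0|exact: ltW| |exact: w_le4].
by apply: lerXn2r; rewrite ?nnegrE// (le_trans _ uM).
Qed.

Lemma Int_w_neq0 : \int[mu]_(x in I) w x != 0.
Proof.
apply/negP => /eqP w0; have L := L2w_C0 (fun x => @cst_continuous R R 1 x).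
have : {ae mu, forall x : R, -1 < x < 1 -> (1 : R) = 0}.
  apply: L2w_eq0 L _; rewrite -w0; apply: Int_eq => x _ /=; ring.
move=> [A [mA A0 HA]].
have : (mu I <= mu A)%E.
  apply: le_measure; rewrite ?inE// => x /inIP xI; apply: HA => /= /(_ xI) /eqP.
  by rewrite oner_eq0.
by rewrite A0 lebesgue_measure_itv/= ifT ?lte_fin -?EFinB ?lee_fin; lra.
Qed.

Let cpoly (a b : R) : continuous (fun x => a + b * x).
Proof. by move=> x; apply: cvgD; [exact: cvg_cst|apply: cvgM; [exact: cvg_cst|exact: cvg_id]]. Qed.

Let dpoly (a b x : R) : is_der x (fun x => a * x + b * (x * x / 2)) (a + b * x).
Proof.
apply: der_val (derD (derZ a (der_id x)) (derZ b (derM (derM (der_id x) (der_id x)) (der_cst 2^-1 x)))) _.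
by field.
Qed.

(** An affine h = p + q x is enough. The value of y at 1 fixes p. The primitive of q x from -1 is -
    q (1 - x^2) / 2, and r times it is - q w / 2, so the value of z at 1 fixes q because the
    integral of w is not 0. *)
Lemma boundary_values_surj (z0 y0 z1 y1 : R) : exists h,
  [/\ L2w h, Yf y0 h 1 = y1 & Zf z0 y0 h 1 = z1].
Proof.
pose p := (y1 - y0) / 2.
pose K := \int[mu]_(x in I) (rr x * Yf y0 (fun x => p + 0 * x) x).
pose q := (z1 - z0 + K) / (\int[mu]_(x in I) w x / 2).
pose h x := p + q * x.
have c0 : continuous (fun x => p + 0 * x) by exact: cpoly.
have cq : continuous h by exact: cpoly.
have L1h : L1 I h := L1_C0 (dpoly p q) cq.
have L10 : L1 I (fun x => p + 0 * x) := L1_C0 (dpoly p 0) c0.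
have Iw : L1 I w.
  apply: (@L1_bounded _ _ _ 4) => //; last first.
  - by move=> x /inIP xI; rewrite gtr0_norm ?w_gt0//; exact: w_le4.
  - exact: w_meas.
  by rewrite lebesgue_measure_itv/= lte_fin ifT ?ltry//; lra.
exists h; split; first exact: L2w_C0.
  rewrite (Yf_primitive _ (dpoly p q)) ?ltexx//; last by lra.
  by rewrite /p; field.
rewrite (Zf_right halpha hbeta)//.
have -> : \int[mu]_(x in I) (rr x * Yf y0 h x) = K + (- (q / 2)) * \int[mu]_(x in I) w x.
  rewrite /K -IntZ// -IntD//; [|exact: (L1_rrY halpha hbeta)|exact: L1Z].
  apply: Int_eq => x /inIP xI; have [x0 x1] := andP xI.
  rewrite (Yf_primitive _ (dpoly p q)) ?(ltW x0) ?(ltW x1)//.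
  rewrite (Yf_primitive _ (dpoly p 0)) ?(ltW x0) ?(ltW x1)//.
  have q0 := lt0r_neq0 (jQ_gt0 xI); rewrite /rr; move: (w x) => wx.
  have := divfK q0 wx; move: (wx / jQ x) => g <-; rewrite /jQ.
  by field.
rewrite /q; have := Int_w_neq0; move: (Rintegral _ _ _) => m m0; field; exact: m0.
Qed.

Lemma CRep_surj (z0 y0 z1 y1 : R[i]) : exists f k,
  [/\ CRep f z0 y0 k, CZ1 z0 y0 k = z1 & CY1 y0 k = y1].
Proof.
have [h1 [L1 Y1 Z1]] := boundary_values_surj (Re z0) (Re y0) (Re z1) (Re y1).
have [h2 [L2 Y2 Z2]] := boundary_values_surj (Im z0) (Im y0) (Im z1) (Im y1).
exists (fun x => (phi alpha beta x * Zf (Re z0) (Re y0) h1 x)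
              +i* (phi alpha beta x * Zf (Im z0) (Im y0) h2 x)), (fun x => h1 x +i* h2 x).
split; first by split; exact: Rep_make.
  by apply: cext; [exact: Z1|exact: Z2].
by apply: cext; [exact: Y1|exact: Y2].
Qed.

Lemma Gamma_surj (u v : 'cV[R[i]]_2) : exists f z0 y0 k,
  [/\ CRep f z0 y0 k, Gamma0 alpha beta f = u & Gamma1 alpha beta f = v].
Proof.
have a0 : alpha != 0 by case/andP: halpha => a0 _; rewrite gt_eqF.
have b0 : beta != 0 by case/andP: hbeta => b0 _; rewrite gt_eqF.
have K (r : R) (z : R[i]) : r != 0 -> r%:C * ((r^-1)%:C * z) = z.
  by move=> r0; apply: cext; rewrite !cE; field.
have K' (r : R) (z : R[i]) : r != 0 -> (r^-1)%:C * (r%:C * z) = z.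
  by move=> r0; apply: cext; rewrite !cE; field.
have b2 : 2 * beta != 0 by rewrite mulf_neq0 ?pnatr_eq0.
have a2 : 2 * alpha != 0 by rewrite mulf_neq0 ?pnatr_eq0.
have colE (c : 'cV[R[i]]_2) : col2 (c 0 0) (c 1 0) = c.
  apply/colP => i; rewrite mxE; case: ifP => [/eqP->//|i0].
  by congr (c _ 0); case: i i0 => -[|[|]]// ? _; exact: val_inj.
have [f [k [Rf Z1 Y1]]] := CRep_surj (((2 * beta)^-1)%:C * u 0 0) ((2 * beta)%:C * - v 0 0)
  (((2 * alpha)^-1)%:C * u 1 0) ((2 * alpha)%:C * v 1 0).
exists f, (((2 * beta)^-1)%:C * u 0 0), ((2 * beta)%:C * - v 0 0), k; split => //.
  by rewrite /Gamma0 (CRep_f0_left halpha hbeta Rf) (CRep_f0_right halpha hbeta Rf) Z1 !K.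
by rewrite /Gamma1 (CRep_f1_left halpha hbeta Rf) (CRep_f1_right halpha hbeta Rf) Y1 !K'// opprK.
Qed.

End BoundaryValues.

(** * Linear relations in the plane *)

Section PlaneRelations.
Variable R : realType.
Notation Re := (@complex.Re R).
Notation Im := (@complex.Im R).
Notation C2 := 'cV[R[i]]_2.
Implicit Types (u v m : C2) (Theta : set (C2 * C2)).

Lemma dot2Dl u v m (c : R[i]) : dot2 (u + c *: v) m = dot2 u m + c * dot2 v m.
Proof. by rewrite /dot2 !big_ord_recl !big_ord0 !addr0 !mxE; ring. Qed.

Lemma dot2Dr u v m (c : R[i]) : dot2 m (u + c *: v) = dot2 m u + c^* * dot2 m v.
Proof. by rewrite [LHS]dot2C dot2Dl rmorphD rmorphM/= -!dot2C. Qed.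

Lemma dot20l m : dot2 0 m = 0.
Proof. by rewrite /dot2 !big_ord_recl !big_ord0 !mxE !mul0r !addr0. Qed.

Lemma dot20r m : dot2 m 0 = 0.
Proof. by rewrite dot2C dot20l rmorph0. Qed.

Lemma dot2_eq0 u : dot2 u u = 0 -> u = 0.
Proof.
move=> u0; have : Re (dot2 u u) = 0 by rewrite u0.
rewrite /dot2 !big_ord_recl !big_ord0 addr0 !cE.
set a := Re (u _ _); set b := Im (u _ _); set c := Re _; set d := Im _ => E.
have sq (x : R) : 0 <= x * x by rewrite -expr2 sqr_ge0.
have := sq a; have := sq b; have := sq c; have := sq d => d2 c2 b2 a2.
have zero (x : R) : x * x <= 0 -> x = 0.
  by move=> x0; apply/eqP; rewrite -sqrf_eq0 expr2; apply/eqP/le_anti; rewrite x0 sq.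
have [a0 b0 c0 d0] : [/\ a = 0, b = 0, c = 0 & d = 0] by split; apply: zero; lra.
apply/colP => i; rewrite mxE; case: (unliftP ord0 i) => [j|] ->; first rewrite (ord1 j).
  by apply: cext; [exact: c0|exact: d0].
by apply: cext; [exact: a0|exact: b0].
Qed.

Let eq_col u v : u 0 0 = v 0 0 -> u (lift 0 0) 0 = v (lift 0 0) 0 -> u = v.
Proof.
by move=> e0 e1; apply/colP => i; case: (unliftP ord0 i) => [j|] ->; rewrite ?(ord1 j).
Qed.

(** One nonzero linear form annihilates both vectors, so their determinant vanishes. *)
Lemma dot2_collinear e u v : e != 0 -> v != 0 -> dot2 u e = 0 -> dot2 v e = 0 ->
  exists c, u = c *: v.
Proof.
move=> e0 v0; rewrite /dot2 !big_ord_recl !big_ord0 !addr0 => ue ve.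
set x := (e 0 0)^* in ue ve; set y := (e (lift ord0 ord0) 0)^* in ue ve.
have det : u 0 0 * v (lift 0 0) 0 = u (lift 0 0) 0 * v 0 0.
  have [x0|x0] := eqVneq x 0; last first.
    apply: (mulIf x0); apply/eqP; rewrite -subr_eq0; apply/eqP.
    transitivity (v (lift 0 0) 0 * (u ord0 0 * x + u (lift ord0 ord0) 0 * y)
      - u (lift 0 0) 0 * (v ord0 0 * x + v (lift ord0 ord0) 0 * y)); first by ring.
    by rewrite ue ve !mulr0 subr0.
  have y0 : y != 0.
    apply: contraNneq e0 => y0; apply/eqP/eq_col; rewrite mxE; apply/eqP; rewrite -conjc_eq0.
      by apply/eqP; exact: x0.
    by apply/eqP; exact: y0.
  apply: (mulIf y0); apply/eqP; rewrite -subr_eq0; apply/eqP.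
  transitivity (v 0 0 * - (u ord0 0 * x + u (lift ord0 ord0) 0 * y)
      + u 0 0 * (v ord0 0 * x + v (lift ord0 ord0) 0 * y)); first by ring.
  by rewrite ue ve !(oppr0, mulr0) addr0.
have [z|z] := eqVneq (v 0 0) 0; last first.
  exists (u 0 0 / v 0 0); apply: eq_col; rewrite mxE; first by rewrite divfK.
  by rewrite mulrAC det mulfK.
have z' : v (lift 0 0) 0 != 0.
  by apply: contraNneq v0 => z'; apply/eqP/eq_col; rewrite mxE.
exists (u (lift 0 0) 0 / v (lift 0 0) 0); apply: eq_col; rewrite mxE; last by rewrite divfK.
by rewrite mulrAC -det mulfK.
Qed.

(** A subspace of C^2 is 0, a line or the plane. If the projection of v onto one nonzero vector of M
    is not enough, M contains a second direction, and then v itself lies in M. *)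
Lemma dot2_projection (M : set C2) v : M 0 ->
  (forall c u1 u2, M u1 -> M u2 -> M (u1 + c *: u2)) ->
  exists2 m, M m & forall u, M u -> dot2 (v - m) u = 0.
Proof.
move=> M0 Ml; have [[e [Me e0]]|none] := pselect (exists e, M e /\ e != 0); last first.
  exists 0 => // u Mu; have [->|u0] := eqVneq u 0; first by rewrite dot20r.
  by case: none; exists u.
have MZ c u : M u -> M (c *: u) by move=> Mu; rewrite -[c *: u]add0r; exact: Ml.
have ee : dot2 e e != 0 by apply: contraNneq e0 => /dot2_eq0 ->.
pose proj u := (dot2 u e / dot2 e e) *: e.
have orth u : dot2 (u - proj u) e = 0.
  by rewrite /proj -scaleNr dot2Dl mulNr mulfVK// subrr.
have [ort|] := pselect (forall u, M u -> dot2 (v - proj v) u = 0).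
  by exists (proj v) => //; exact: MZ.
move=> /existsNP[u /not_implyP[Mu vu]]; exists v; last by move=> ? _; rewrite subrr dot20l.
have Mu' : M (u - proj u) by rewrite /proj -scaleNr; exact: Ml.
have u'0 : u - proj u != 0.
  apply/eqP => /eqP; rewrite subr_eq0 => /eqP uE; apply: vu.
  by rewrite uE -[proj u]add0r dot2Dr orth dot20r mulr0 addr0.
have [c vE] := dot2_collinear e0 u'0 (orth v) (orth u).
rewrite -[v](subrK (proj v)) vE addrC -[_ + _]/(proj v + c *: (u - proj u)).
by apply: Ml => //; exact: MZ.
Qed.

(** Removing from v its projection on mul Theta gives an element of [op_part], so the choice made by
    [op_apply] is a genuine value; by linearity it differs from v by an element of mul Theta. *)
Lemma selfadjoint_relation_op Theta u v : selfadjoint_relation Theta -> Theta (u, v) ->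
  op_part Theta (u, op_apply Theta u) /\ mul_part Theta (v - op_apply Theta u).
Proof.
move=> [[T0 Tl] Tadj] Tuv.
have Ml c u1 u2 : mul_part Theta u1 -> mul_part Theta u2 -> mul_part Theta (u1 + c *: u2).
  by move=> M1 M2; have := Tl c _ _ M1 M2; rewrite /= scaler0 addr0.
have [m Mm ort] := dot2_projection v (T0 : mul_part Theta 0) Ml.
have opm : op_part Theta (u, v - m).
  split=> //; have := Tl (-1) _ _ Tuv Mm.
  by rewrite /= scaler0 addr0 scaleN1r.
have op : op_part Theta (u, op_apply Theta u).
  exact: (@xgetPex _ 0 [set v | op_part Theta (u, v)] (ex_intro _ (v - m) opm)).
split=> //; have := Tl (-1) _ _ Tuv op.1.
by rewrite /= !scaleN1r subrr.
Qed.

(** The pair {0, m} lies in Theta, and a self-adjoint Theta satisfies the adjoint identity on it. *)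
Lemma op_dom_mul_orth Theta u m : selfadjoint_relation Theta -> op_dom Theta u ->
  mul_part Theta m -> dot2 m u = 0.
Proof.
move=> [_ Tadj] [v [Tuv _]] Tm; have : adjoint_relation Theta (u, v) by rewrite -Tadj.
by move=> /(_ _ Tm)/=; rewrite dot20l.
Qed.

Lemma op_apply_part Theta u : selfadjoint_relation Theta -> op_dom Theta u ->
  op_part Theta (u, op_apply Theta u).
Proof. by move=> sT [v [Tuv _]]; have [] := selfadjoint_relation_op sT Tuv. Qed.

Lemma op_apply_symmetric Theta u v : selfadjoint_relation Theta -> op_dom Theta u ->
  op_dom Theta v -> dot2 (op_apply Theta u) v = dot2 u (op_apply Theta v).
Proof.
move=> sT Du Dv; have [_ Tadj] := sT.
have [Tu _] := op_apply_part sT Du; have [Tv _] := op_apply_part sT Dv.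
have : adjoint_relation Theta (v, op_apply Theta v) by rewrite -Tadj.
by move=> /(_ _ Tu).
Qed.

End PlaneRelations.

(** * Self-adjoint extensions as boundary conditions *)

Section Extensions.
Variables (R : realType) (alpha beta : R).
Hypotheses (halpha : 0 < alpha < 1) (hbeta : 0 < beta < 1).
Notation Re := (@complex.Re R).
Notation Im := (@complex.Im R).
Notation mu := (@lebesgue_measure R).
Notation I := (`]-1, 1[%classic : set R).
Notation CZ1 := (CZ1 alpha beta).
Notation CRep := (CRep alpha beta).
Notation inH := (inH alpha beta).
Notation ip := (ip alpha beta).
Notation ell := (ell alpha beta).
Notation Dmax := (Dmax alpha beta).
Notation Gamma0 := (Gamma0 alpha beta).
Notation Gamma1 := (Gamma1 alpha beta).
Notation Lmax := (Lmax alpha beta).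
Notation Lmin := (Lmin alpha beta).
Notation adjoint := (adjoint alpha beta).
Notation s := ((alpha + beta)%:C : R[i]).
Notation C2 := 'cV[R[i]]_2.
Implicit Types (f g h k : R -> R[i]) (u v : C2) (Theta : set (C2 * C2)).

Let Iin (x : R) : -1 < x < 1 -> I x. Proof. by rewrite /= in_itv. Qed.
Let inIP (x : R) : I x -> -1 < x < 1. Proof. by rewrite /= in_itv. Qed.
Let mI : measurable I. Proof. exact: measurable_itv. Qed.

(** Near a point of difference the functions would differ on an open interval, which is not a null
    set. This makes the boundary values of a class well defined. *)
Lemma ae_eq_continuous (f g : R -> R) : (forall x, -1 < x < 1 -> {for x, continuous f}) ->
  (forall x, -1 < x < 1 -> {for x, continuous g}) ->
  {ae mu, forall x : R, -1 < x < 1 -> f x = g x} -> forall x : R, -1 < x < 1 -> f x = g x.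
Proof.
move=> cf cg [A [mA A0 HA]] x xI; apply/eqP; apply: contrapT => /negP fg.
have d0 : f x - g x != 0 by rewrite subr_eq0.
have cfg : f y - g y @[y --> x] --> f x - g x by apply: cvgB; [exact: cf|exact: cg].
have xin : x \in `]-1, 1[ by rewrite in_itv.
have : \forall y \near x, f y - g y != 0 /\ -1 < y < 1.
  near=> y; split; last first.
    have : y \in `]-1, 1[ by near: y; exact: near_in_itvoo.
    by rewrite in_itv.
  by near: y; apply: (cvgr_neq0 _ cfg).
move=> -[d /= d_gt0 Hd].
pose J : set R := [set` `]x - d, x + d[].
have sub : J `<=` A.
  move=> y; rewrite /J /= in_itv/= => /andP[y1 y2]; apply: HA => /= E.
  have [|fy yI] := Hd y; first by rewrite /= ltr_distl; apply/andP; split; lra.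
  by move: fy; rewrite (E yI) subrr eqxx.
have : (mu J <= mu A)%E by apply: le_measure; rewrite ?inE//; exact: measurable_itv.
rewrite A0 /J lebesgue_measure_itv/= ifT ?lte_fin -?EFinB ?lee_fin; lra.
Unshelve. all: by end_near. Qed.

Lemma CY1_lin y1 y2 k1 k2 (c : R[i]) : L1 I (Re \o k1) -> L1 I (Im \o k1) ->
  L1 I (Re \o k2) -> L1 I (Im \o k2) ->
  CY1 (y1 + c * y2) (fun x => k1 x + c * k2 x) = CY1 y1 k1 + c * CY1 y2 k2.
Proof.
move=> r1 i1 r2 i2; have r12 := L1Z (Re c) mI r2; have i12 := L1Z (Im c) mI r2.
rewrite /CY1; apply: cext; [rewrite ReP|rewrite ImP].
  rewrite (_ : Re (y1 + c * y2) = (Re y1 + Re c * Re y2) + - Im c * Im y2); last by rewrite !cE; ring.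
  rewrite (_ : Re \o _ = fun x => ((Re \o k1) x + Re c * (Re \o k2) x) + - Im c * (Im \o k2) x).
    by rewrite Yf_lin ?Yf_lin// ?cE; [ring|exact: L1D].
  by apply/funext => x; rewrite /comp !cE; ring.
rewrite (_ : Im (y1 + c * y2) = (Im y1 + Re c * Im y2) + Im c * Re y2); last by rewrite !cE; ring.
rewrite (_ : Im \o _ = fun x => ((Im \o k1) x + Re c * (Im \o k2) x) + Im c * (Re \o k2) x).
  by rewrite Yf_lin ?Yf_lin// ?cE; [ring|apply: L1D => //; exact: L1Z].
by apply/funext => x; rewrite /comp !cE; ring.
Qed.

Lemma CZ1_lin z1 z2 y1 y2 k1 k2 (c : R[i]) : L1 I (Re \o k1) -> L1 I (Im \o k1) ->
  L1 I (Re \o k2) -> L1 I (Im \o k2) ->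
  CZ1 (z1 + c * z2) (y1 + c * y2) (fun x => k1 x + c * k2 x) = CZ1 z1 y1 k1 + c * CZ1 z2 y2 k2.
Proof.
move=> r1 i1 r2 i2; have r12 := L1Z (Re c) mI r2; have r12' := L1D mI r1 r12;
  have i12 := L1D mI i1 (L1Z (Re c) mI i2).
rewrite /CZ1; apply: cext; [rewrite ReP|rewrite ImP].
  rewrite (_ : Re (z1 + c * z2) = (Re z1 + Re c * Re z2) + - Im c * Im z2); last by rewrite !cE; ring.
  rewrite (_ : Re (y1 + c * y2) = (Re y1 + Re c * Re y2) + - Im c * Im y2); last by rewrite !cE; ring.
  rewrite (_ : Re \o _ = fun x => ((Re \o k1) x + Re c * (Re \o k2) x) + - Im c * (Im \o k2) x).
    rewrite (Zf_lin halpha hbeta _ _ _ _ _ _ r12' i2) (Zf_lin halpha hbeta _ _ _ _ _ _ r1 r2).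
    by move: (Zf _ _ _ _ _ _) (Zf _ _ _ _ _ _) (Zf _ _ _ _ _ _) (Zf _ _ _ _ _ _) => a b d e; rewrite !cE; ring.
  by apply/funext => x; rewrite /comp !cE; ring.
rewrite (_ : Im (z1 + c * z2) = (Im z1 + Re c * Im z2) + Im c * Re z2); last by rewrite !cE; ring.
rewrite (_ : Im (y1 + c * y2) = (Im y1 + Re c * Im y2) + Im c * Re y2); last by rewrite !cE; ring.
rewrite (_ : Im \o _ = fun x => ((Im \o k1) x + Re c * (Im \o k2) x) + Im c * (Re \o k2) x).
  rewrite (Zf_lin halpha hbeta _ _ _ _ _ _ i12 r2) (Zf_lin halpha hbeta _ _ _ _ _ _ i1 i2).
  by move: (Zf _ _ _ _ _ _) (Zf _ _ _ _ _ _) (Zf _ _ _ _ _ _) (Zf _ _ _ _ _ _) => a b d e; rewrite !cE; ring.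
by apply/funext => x; rewrite /comp !cE; ring.
Qed.

Lemma CRep_Gamma0 f z0 y0 k : CRep f z0 y0 k ->
  Gamma0 f = col2 ((2 * beta)%:C * z0) ((2 * alpha)%:C * CZ1 z0 y0 k).
Proof.
by move=> Rf; rewrite /Defs.Gamma0 (CRep_f0_left halpha hbeta Rf) (CRep_f0_right halpha hbeta Rf).
Qed.

Lemma CRep_Gamma1 f z0 y0 k : CRep f z0 y0 k ->
  Gamma1 f = col2 (- (((2 * beta)^-1)%:C * y0)) (((2 * alpha)^-1)%:C * CY1 y0 k).
Proof.
by move=> Rf; rewrite /Defs.Gamma1 (CRep_f1_left halpha hbeta Rf) (CRep_f1_right halpha hbeta Rf).
Qed.

Lemma CRep_L1 f z0 y0 k : CRep f z0 y0 k -> L1 I (Re \o k) /\ L1 I (Im \o k).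
Proof. by move=> [[L1k _] [L2k _]]; split; exact: (L2w_L1 halpha hbeta). Qed.

Lemma CRep_Gamma_lin f1 z1 y1 k1 f2 z2 y2 k2 (c : R[i]) : CRep f1 z1 y1 k1 -> CRep f2 z2 y2 k2 ->
  Gamma0 (fun x => f1 x + c * f2 x) = Gamma0 f1 + c *: Gamma0 f2 /\
  Gamma1 (fun x => f1 x + c * f2 x) = Gamma1 f1 + c *: Gamma1 f2.
Proof.
move=> R1 R2; have R12 := CRep_lin halpha hbeta c R1 R2.
have [a1 b1] := CRep_L1 R1; have [a2 b2] := CRep_L1 R2.
rewrite !(CRep_Gamma0 R1, CRep_Gamma0 R2, CRep_Gamma0 R12, CRep_Gamma1 R1, CRep_Gamma1 R2, CRep_Gamma1 R12).
rewrite CZ1_lin// CY1_lin//.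
move: (CZ1 _ _ _) (CZ1 _ _ _) (CY1 _ _) (CY1 _ _) => p1 p2 q1 q2.
by split; apply/colP => i; rewrite !mxE; case: ifP => _; ring.
Qed.

Local Opaque Defs.Gamma0 Defs.Gamma1 Defs.ell Defs.ip.

(** The graph of Lmax with boundary values attached. They are read off a regular representative [f0]
    of the class of f, and by [graph_inj] they do not depend on it. *)
Definition boundary_graph f h u v : Prop := [/\ inH f, inH h &
  exists f0, [/\ Dmax f0, Gamma0 f0 = u, Gamma1 f0 = v, eqH f f0 & eqH h (ell f0)]].

Lemma CRep_graph f z0 y0 k : CRep f z0 y0 k ->
  boundary_graph f (fun x => k x + (- s) * f x) (Gamma0 f) (Gamma1 f).
Proof.
move=> Rf; have Hf := CRep_inH halpha hbeta Rf; split => //.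
  by apply: inH_lin => //; exact: CRep_inHk Rf.
exists f; split => //; [exact: (CRep_Dmax halpha hbeta Rf)|exact: eqH_refl|].
exact: eqH_sym (CRep_eqH halpha hbeta Rf).
Qed.

Lemma Dmax_eq_in f f' : Dmax f -> Dmax f' -> eqH f f' -> forall x, -1 < x < 1 -> f x = f' x.
Proof.
move=> D D' e x xI; have [z [y [k [R1 R2]]]] := Dmax_ex halpha hbeta D.
have [z' [y' [k' [R1' R2']]]] := Dmax_ex halpha hbeta D'.
apply: cext.
  apply: (ae_eq_continuous (f := Re \o f) (g := Re \o f')) xI => [t tI|t tI|].
  - exact: (Rep_continuous halpha hbeta R1).
  - exact: (Rep_continuous halpha hbeta R1').
  by apply: aeS e => t et tI; rewrite /comp (et (Iin tI)).
apply: (ae_eq_continuous (f := Im \o f) (g := Im \o f')) xI => [t tI|t tI|].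
- exact: (Rep_continuous halpha hbeta R2).
- exact: (Rep_continuous halpha hbeta R2').
by apply: aeS e => t et tI; rewrite /comp (et (Iin tI)).
Qed.

Lemma Gamma_eq f f' : Dmax f -> Dmax f' -> eqH f f' ->
  [/\ Gamma0 f = Gamma0 f', Gamma1 f = Gamma1 f' & eqH (ell f) (ell f')].
Proof.
move=> D D' e; have fE := Dmax_eq_in D D' e.
have [z [y [k Rf]]] := Dmax_ex halpha hbeta D; have Rf' := CRep_eq fE Rf.
rewrite (CRep_Gamma0 Rf) (CRep_Gamma0 Rf') (CRep_Gamma1 Rf) (CRep_Gamma1 Rf'); split => //.
apply: eqH_trans (CRep_eqH halpha hbeta Rf) (eqH_sym (eqH_trans (CRep_eqH halpha hbeta Rf') _)).
by apply: aeW => x xI; rewrite fE// inIP.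
Qed.

Lemma graph_inj f h u v h' u' v' : boundary_graph f h u v -> boundary_graph f h' u' v' ->
  [/\ u = u', v = v' & eqH h h'].
Proof.
move=> [_ _ [f1 [D1 <- <- e1 l1]]] [_ _ [f2 [D2 <- <- e2 l2]]].
have [-> -> le] := Gamma_eq D1 D2 (eqH_trans (eqH_sym e1) e2).
by split=> //; exact: eqH_trans l1 (eqH_trans le (eqH_sym l2)).
Qed.

Lemma graph_eqH f h u v f' h' : boundary_graph f h u v -> inH f' -> inH h' ->
  eqH f' f -> eqH h' h -> boundary_graph f' h' u v.
Proof.
move=> [_ _ [f1 [D1 G0 G1 e1 l1]]] Hf' Hh' ef eh; split => //.
by exists f1; split=> //; [exact: eqH_trans ef e1|exact: eqH_trans eh l1].
Qed.

Lemma graph_CRep f h u v : boundary_graph f h u v -> exists f0 z0 y0,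
  [/\ CRep f0 z0 y0 (fun x => h x + s * f0 x), Gamma0 f0 = u, Gamma1 f0 = v & eqH f f0].
Proof.
move=> [_ Hh [f0 [D0 G0 G1 e0 l0]]].
by have [z0 [y0 R0]] := Dmax_CRep halpha hbeta D0 Hh l0; exists f0, z0, y0.
Qed.

Lemma graph_lin f h u v f' h' u' v' (c : R[i]) : boundary_graph f h u v ->
  boundary_graph f' h' u' v' ->
  boundary_graph (fun x => f x + c * f' x) (fun x => h x + c * h' x) (u + c *: u') (v + c *: v').
Proof.
move=> B1 B2; have [Hf Hh _] := B1; have [Hf' Hh' _] := B2.
have [f1 [z1 [y1 [R1 <- <- e1]]]] := graph_CRep B1.
have [f2 [z2 [y2 [R2 <- <- e2]]]] := graph_CRep B2.
have [<- <-] := CRep_Gamma_lin c R1 R2.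
apply: (graph_eqH (CRep_graph (CRep_lin halpha hbeta c R1 R2))); [exact: inH_lin|exact: inH_lin| |].
  by apply: aeS (aeI e1 e2) => x [h1 h2] xI; rewrite h1// h2.
by apply: aeW => x xI; ring.
Qed.

Lemma graph_Green f h u v f' h' u' v' : boundary_graph f h u v ->
  boundary_graph f' h' u' v' -> ip h f' - ip f h' = dot2 v u' - dot2 u v'.
Proof.
move=> B1 B2; have [Hf Hh _] := B1; have [Hf' Hh' _] := B2.
have [f1 [z1 [y1 [R1 <- <- e1]]]] := graph_CRep B1.
have [f2 [z2 [y2 [R2 <- <- e2]]]] := graph_CRep B2.
have H1 := CRep_inH halpha hbeta R1; have H2 := CRep_inH halpha hbeta R2.
have := CRep_Green halpha hbeta R1 R2.
rewrite ipDl// ipDr// -(eqH_ipr Hf' H2 Hh e2) -(eqH_ip Hf H1 Hh' e1) => <-.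
rewrite (_ : (s^*)%R = s); last by apply: cext; rewrite ?ReJ ?ImJ ?oppr0.
by ring.
Qed.

Lemma graph_surj u v : exists f h, boundary_graph f h u v.
Proof.
have [f [z0 [y0 [k [Rf <- <-]]]]] := Gamma_surj halpha hbeta u v.
by exists f, (fun x => k x + (- s) * f x); exact: CRep_graph Rf.
Qed.

(** Used to show that the adjoints met below act as Lmax. Adding (alpha + beta) g to k turns the
    hypothesis into the weak equation of the regular system. *)
Lemma graph_weak g k : inH g -> inH k ->
  (forall f h, boundary_graph f h 0 0 -> ip h g = ip f k) -> exists u v, boundary_graph g k u v.
Proof.
move=> Hg Hk H; have Hks : inH (fun x => k x + s * g x) by exact: inH_lin.
have [|v [z0 [y0 [Rv e]]]] := CRep_weak halpha hbeta Hg Hks.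
  move=> f h Rf Y0 Z0; have Hf := CRep_inH halpha hbeta Rf; have Hh := CRep_inHk Rf.
  have := CRep_graph Rf.
  have -> : Gamma0 f = 0.
    apply/colP => i; rewrite (CRep_Gamma0 Rf) Z0 !mulr0 !mxE.
    by case: ifP.
  have -> : Gamma1 f = 0.
    apply/colP => i; rewrite (CRep_Gamma1 Rf) Y0 !mulr0 oppr0 !mxE.
    by case: ifP.
  move=> /H; rewrite ipDl// ipDr//.
  rewrite (_ : (s^*)%R = s); last by apply: cext; rewrite ?ReJ ?ImJ ?oppr0.
  by move=> <-; ring.
have Hv := CRep_inH halpha hbeta Rv.
exists (Gamma0 v), (Gamma1 v); apply: (graph_eqH (CRep_graph Rv)) => //.
apply: aeS e => x ex xI; rewrite ex//; ring.
Qed.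

Lemma LmaxP f h : Lmax f h <-> exists u v, boundary_graph f h u v.
Proof.
split=> [[Hf Hh [f0 [D0 _ e0 l0]]]|[u [v [Hf Hh [f0 [D0 _ _ e0 l0]]]]]].
  by exists (Gamma0 f0), (Gamma1 f0); split => //; exists f0.
by split => //; exists f0.
Qed.

Definition LTheta Theta f h : Prop := exists u v, boundary_graph f h u v /\ Theta (u, v).

(** Green's identity translates the adjoint in H into the adjoint of Theta. In the converse
    direction, tests with zero boundary values put (f, h) into Lmax; by surjectivity every pair of
    Theta then occurs as boundary values of a test, which puts (u, v) into the adjoint of Theta. *)
Lemma LTheta_adjoint Theta f h : selfadjoint_relation Theta ->
  LTheta Theta f h <-> adjoint (LTheta Theta) f h.
Proof.
move=> [[T0 _] Tadj]; split=> [[u [v [B Tuv]]]|[Hf Hh H]].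
  have [Hf Hh _] := B; split => // f' h' [u' [v' [B' Tuv']]].
  have : adjoint_relation Theta (u, v) by rewrite -Tadj.
  move=> /(_ _ Tuv')/= E; apply/eqP; rewrite -subr_eq0 (graph_Green B' B) E subrr.
  exact: eqxx.
have [f' h' B|u [v B]] := graph_weak Hf Hh _; first by apply: H; exists 0, 0.
exists u, v; split => //; rewrite Tadj => -[u' v'] Tuv' /=.
have [f' [h' B']] := graph_surj u' v'.
have := graph_Green B' B; rewrite (H f' h'); last by exists u', v'.
by rewrite subrr => /esym/eqP; rewrite subr_eq0 => /eqP.
Qed.

Lemma LTheta_extension Theta : selfadjoint_relation Theta ->
  selfadjoint_extension alpha beta Lmin (LTheta Theta).
Proof.
move=> sT; have [[_ Tl] _] := sT; split; first split.
- move=> f h f' h' c [u [v [B Tuv]]] [u' [v' [B' Tuv']]].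
  by do 2 eexists; split; [exact: graph_lin B B'|exact: (Tl c _ _ Tuv Tuv')].
- move=> f h h' [u [v [B _]]] [u' [v' [B' _]]].
  by have [] := graph_inj B B'.
- by move=> f h; exact: LTheta_adjoint.
move=> f h [Hf Hh H]; apply/(LTheta_adjoint _ _ sT); split => // f' h' [u [v [B _]]].
by apply: H; apply/LmaxP; exists u, v.
Qed.

Lemma Lmin_graph f h : boundary_graph f h 0 0 -> Lmin f h.
Proof.
move=> B; have [Hf Hh _] := B; split => // f' h' /LmaxP[u [v B']].
by apply/eqP; rewrite -subr_eq0 (graph_Green B' B) !dot20r subrr eqxx.
Qed.

Definition boundary_relation (S : (R -> R[i]) -> (R -> R[i]) -> Prop) : set (C2 * C2) :=
  [set p | exists f h, S f h /\ boundary_graph f h p.1 p.2].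

Lemma extension_graph S f h : selfadjoint_extension alpha beta Lmin S -> S f h ->
  exists u v, boundary_graph f h u v.
Proof.
move=> [[_ _ Sadj] LS] Sfh; have [Hf Hh H] := (Sadj f h).1 Sfh.
by apply: graph_weak => // f' h' B; apply: H; apply: LS; exact: Lmin_graph.
Qed.

(** Symmetry of S gives one inclusion through Green's identity. For the other, a function whose
    boundary values lie in the adjoint relation satisfies the adjoint identity against all of S,
    hence belongs to S. *)
Lemma boundary_relation_selfadjoint S : selfadjoint_extension alpha beta Lmin S ->
  selfadjoint_relation (boundary_relation S).
Proof.
move=> sS; have [[Sl _ Sadj] LS] := sS; split.
  split.
    have [f [h B]] := graph_surj 0 0; exists f, h; split => //.
    by apply: LS; exact: Lmin_graph.
  move=> c [u v] [u' v'] [f [h [Sf B]]] [f' [h' [Sf' B']]] /=.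
  by do 2 eexists; split; [exact: Sl c Sf Sf'|exact: graph_lin].
apply/seteqP; split=> [[u v] [f [h [Sf B]]] [u' v'] [f' [h' [Sf' B']]] /=|[u v] H].
  have [_ _ E] := (Sadj f h).1 Sf.
  by have := graph_Green B' B; rewrite (E _ _ Sf') subrr => /esym/eqP; rewrite subr_eq0 => /eqP.
have [g [k B]] := graph_surj u v; exists g, k; split => //; apply/Sadj.
have [Hg Hk _] := B; split => // f h Sf.
have [u' [v' B']] := extension_graph sS Sf.
apply/eqP; rewrite -subr_eq0 (graph_Green B' B) subr_eq0; apply/eqP.
by apply: (H (u', v')); exists f, h.
Qed.

Lemma extension_LTheta S f h : selfadjoint_extension alpha beta Lmin S ->
  S f h <-> LTheta (boundary_relation S) f h.
Proof.
move=> sS; have [[Sl _ Sadj] LS] := sS.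
split=> [Sf|[u [v [B [f' [h' [Sf' B']]]]]]].
  by have [u [v B]] := extension_graph sS Sf; exists u, v; split => //; exists f, h.
(* The difference of two pairs with the same boundary values lies in Lmin, hence in S. *)
have D := graph_lin (-1) B B'; rewrite !scaleN1r !subrr in D.
have := Sl _ _ _ _ 1 Sf' (LS _ _ (Lmin_graph D)).
rewrite (_ : (fun x => f' x + _) = f); last by apply/funext => x; ring.
by rewrite (_ : (fun x => h' x + _) = h)//; apply/funext => x; ring.
Qed.

Lemma dom_LTheta Theta : dom (LTheta Theta) =
  classesH alpha beta [set f | Dmax f /\ Theta (Gamma0 f, Gamma1 f)].
Proof.
apply/seteqP; split=> [f [h [u [v [[Hf Hh [f0 [D0 G0 G1 e0 l0]]] Tuv]]]]|f [Hf [f0 [D0 T0] e0]]].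
  by split => //; exists f0 => //; split => //; rewrite G0 G1.
have [_ _ _ [h Hh hl]] := D0; exists h, (Gamma0 f0), (Gamma1 f0); split => //.
by split => //; exists f0; split => //; exact: eqH_sym.
Qed.

End Extensions.

(** * The form domain *)

Section WeightedL2.
Variable R : realType.
Notation mu := (@lebesgue_measure R).
Variables (D : set R) (mD : measurable D) (rho : R -> R).
Hypotheses (Irho : L1 D rho) (rho_gt0 : forall x, D x -> 0 < rho x).
Implicit Types (d v : R -> R).

Let mrho : measurable_fun D rho. Proof. exact: L1_meas Irho. Qed.

(** Integrate rho |d| <= c rho / 2 + rho d^2 / (2 c) with c = e / (r + 1), where r is the integral
    of rho; the + 1 keeps the first term strictly below e / 2. *)
Lemma L2_L1_small (e : R) : 0 < e -> exists2 dl, 0 < dl &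
  forall d, L1 D (fun x => rho x * d x) -> L1 D (fun x => rho x * d x ^+ 2) ->
    \int[mu]_(x in D) (rho x * d x ^+ 2) < dl -> \int[mu]_(x in D) `|rho x * d x| < e.
Proof.
move=> e0; have rho0 : 0 <= \int[mu]_(x in D) rho x by apply: Int_ge0 => x /rho_gt0/ltW.
set r := Rintegral _ _ _ in rho0; pose c := e / (r + 1).
have r1 : 0 < r + 1 by exact: ltr_wpDl.
have c0 : 0 < c by exact: divr_gt0.
exists (c * e); first exact: mulr_gt0.
move=> d I1 I2 small.
have J : L1 D (fun x => c / 2 * rho x + (2 * c)^-1 * (rho x * d x ^+ 2)).
  by apply: L1D => //; exact: L1Z.
apply: (@le_lt_trans _ _ (\int[mu]_(x in D) (c / 2 * rho x + (2 * c)^-1 * (rho x * d x ^+ 2)))).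
  apply: Int_le => // [|x /rho_gt0 r0]; first exact: L1_norm.
  rewrite normrM (gtr0_norm r0) -subr_ge0.
  have -> : c / 2 * rho x + (2 * c)^-1 * (rho x * d x ^+ 2) - rho x * `|d x| =
      rho x * (2 * c)^-1 * (c - `|d x|) ^+ 2.
    by rewrite -[d x ^+ 2]real_normK ?num_real//; field; rewrite gt_eqF.
  by rewrite mulr_ge0 ?sqr_ge0// mulr_ge0 ?ltW// invr_gt0 mulr_gt0.
rewrite IntD ?IntZ//; [|exact: L1Z|exact: L1Z].
rewrite -/r; have h1 : c / 2 * r < e / 2.
  rewrite /c (_ : e / (r + 1) / 2 * r = e / 2 * (r / (r + 1))); last by field; rewrite gt_eqF.
  by rewrite gtr_pMr ?divr_gt0// ltr_pdivrMr// mul1r ltrDl.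
have h2 : (2 * c)^-1 * \int[mu]_(x in D) (rho x * d x ^+ 2) <= e / 2.
  rewrite ler_pdivrMl; last by rewrite mulr_gt0.
  by rewrite (_ : _ * (e / 2) = c * e); [exact: ltW|field].
by rewrite [ltRHS](splitr e) ltr_leD.
Qed.

Variable v : nat -> R -> R.
Hypotheses (mv : forall n, measurable_fun D (v n))
  (Iv2 : forall n, L1 D (fun x => rho x * v n x ^+ 2)).

Lemma L2_L1 d : measurable_fun D d -> L1 D (fun x => rho x * d x ^+ 2) ->
  L1 D (fun x => rho x * d x).
Proof.
move=> md Id; apply: (@L1_le _ _ (fun x => rho x + rho x * d x ^+ 2)) => //.
- exact: measurable_funM.
- move=> x /rho_gt0 r0; rewrite normrM (gtr0_norm r0) -{2}[rho x]mulr1 -mulrDr.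
  apply: ler_wpM2l; first exact: ltW.
  rewrite -[d x ^+ 2](real_normK (num_real (d x))).
  have := normr_ge0 (d x); have := sqr_ge0 (`|d x| - 1); move: `|d x| => y.
  by rewrite !expr2; nra.
- exact: L1D.
Qed.

Lemma L2D d1 d2 (c : R) : measurable_fun D d1 -> measurable_fun D d2 ->
  L1 D (fun x => rho x * d1 x ^+ 2) -> L1 D (fun x => rho x * d2 x ^+ 2) ->
  L1 D (fun x => rho x * (d1 x + c * d2 x) ^+ 2).
Proof.
move=> m1 m2 I1 I2.
apply: (@L1_le _ _ (fun x => 2 * (rho x * d1 x ^+ 2) + 2 * c ^+ 2 * (rho x * d2 x ^+ 2))) => //.
- apply: measurable_funM => //; apply: measurable_funX; apply: measurable_funD => //.
  exact: measurable_funM.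
- move=> x /rho_gt0 r0; rewrite normrM (gtr0_norm r0) (ger0_norm (sqr_ge0 _)) -subr_ge0.
  rewrite (_ : _ - _ = rho x * (d1 x - c * d2 x) ^+ 2); last by ring.
  by rewrite mulr_ge0 ?sqr_ge0// ltW.
- by apply: L1D => //; exact: L1Z.
Qed.

Let L2B d1 d2 : measurable_fun D d1 -> measurable_fun D d2 ->
  L1 D (fun x => rho x * d1 x ^+ 2) -> L1 D (fun x => rho x * d2 x ^+ 2) ->
  L1 D (fun x => rho x * (d1 x - d2 x) ^+ 2).
Proof.
move=> m1 m2 I1 I2; apply: L1_eq (L2D (-1) m1 m2 I1 I2) => // x _.
by rewrite mulN1r.
Qed.

Hypothesis vC : forall e, 0 < e -> exists N : nat, forall m n : nat, (N <= m)%N -> (N <= n)%N ->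
  \int[mu]_(x in D) (rho x * (v m x - v n x) ^+ 2) < e.

Let bounded : exists C N, 0 < C /\ forall n, (N <= n)%N -> \int[mu]_(x in D) (rho x * v n x ^+ 2) <= C.
Proof.
have [N HN] := vC ltr01; set I0 := \int[mu]_(x in D) (rho x * v N x ^+ 2).
have I00 : 0 <= I0 by apply: Int_ge0 => x /rho_gt0 r0; rewrite mulr_ge0 ?sqr_ge0// ltW.
exists (2 * 1 + 2 * I0), N; split; first by lra.
move=> n Nn; have IB := L2B (mv n) (mv N) (Iv2 n) (Iv2 N).
apply: (@le_trans _ _ (\int[mu]_(x in D) (2 * (rho x * (v n x - v N x) ^+ 2) + 2 * (rho x * v N x ^+ 2)))).
  apply: Int_le => // [|x /rho_gt0 r0]; first by apply: L1D => //; exact: L1Z.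
  rewrite -subr_ge0 (_ : _ - _ = rho x * (v n x - 2 * v N x) ^+ 2); last by ring.
  by rewrite mulr_ge0 ?sqr_ge0// ltW.
rewrite IntD ?IntZ//; [|exact: L1Z|exact: L1Z].
by rewrite lerD2r ler_pM2l// ltW// HN.
Qed.

(** Completeness of L^1 is used twice: for rho v_n, whose limit defines eta, and along a subsequence
    for rho v_n^2, whose limit is a.e. rho eta^2 and shows that this is integrable. *)
Lemma L2_complete : measurable_fun D (fun x => (rho x)^-1) -> exists eta : R -> R, [/\ measurable_fun D eta, L1 D (fun x => rho x * eta x ^+ 2) &
  \int[mu]_(x in D) `|rho x * (v n x - eta x)| @[n --> \oo] --> 0].
Proof.
move=> mV; have [C [N0 [C0 HC]]] := bounded.
have IvB m n := L2B (mv m) (mv n) (Iv2 m) (Iv2 n).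
have [|zt [sg [Izt sgk ae cv]]] := L1_complete mD (fun n => L2_L1 (mv n) (Iv2 n)) _.
  move=> e e0; have [dl dl0 H] := L2_L1_small e0; have [N HN] := vC dl0.
  exists N => m n Nm Nn; rewrite (Int_eq (g := fun x => `|rho x * (v m x - v n x)|)); last first.
    by move=> x _; rewrite mulrBr.
  apply: H => //; last exact: HN.
  by apply: L2_L1 => //; exact: measurable_funB.
(* The offset N0 keeps the squared norms below C. *)
pose v2 k x := rho x * v (sg (N0 + k)%N) x ^+ 2.
have sgle k : (N0 + k <= sg (N0 + k))%N by exact: sgk.
have [|z2 [tau [Iz2 tauk ae2 _]]] := @L1_complete _ _ mD v2 (fun n => Iv2 _) _.
  (* The squares differ by (a - b) (a + b). In the weighted arithmetic-geometric inequality this c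
     makes the two terms contribute at most e / 2 and 2 c C = e / 4. *)
  move=> e e0; pose c := e / (8 * C).
  have c0 : 0 < c by rewrite divr_gt0// mulr_gt0.
  have ce : 0 < c * e by exact: mulr_gt0.
  have [N HN] := vC ce.
  exists N => m n Nm Nn; rewrite /v2.
  set a := v (sg (N0 + m)%N); set b := v (sg (N0 + n)%N).
  have ma : measurable_fun D a by exact: mv.
  have mb : measurable_fun D b by exact: mv.
  have Ia : L1 D (fun x => rho x * a x ^+ 2) by exact: Iv2.
  have Ib : L1 D (fun x => rho x * b x ^+ 2) by exact: Iv2.
  have Iab := L2B ma mb Ia Ib.
  have Na : (N0 <= sg (N0 + m))%N by apply: leq_trans (sgle m); rewrite leq_addr.
  have Nb : (N0 <= sg (N0 + n))%N by apply: leq_trans (sgle n); rewrite leq_addr.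
  have Na' : (N <= sg (N0 + m))%N by apply: leq_trans (sgle m); rewrite (leq_trans Nm)// leq_addl.
  have Nb' : (N <= sg (N0 + n))%N by apply: leq_trans (sgle n); rewrite (leq_trans Nn)// leq_addl.
  have J : L1 D (fun x => (2 * c)^-1 * (rho x * (a x - b x) ^+ 2)
     + c * (rho x * a x ^+ 2 + rho x * b x ^+ 2)).
    by apply: L1D => //; apply: L1Z => //; exact: L1D.
  apply: (@le_lt_trans _ _ (\int[mu]_(x in D) ((2 * c)^-1 * (rho x * (a x - b x) ^+ 2)
     + c * (rho x * a x ^+ 2 + rho x * b x ^+ 2)))).
    apply: Int_le => // [|x /rho_gt0 r0]; first by apply: L1_norm => //; exact: L1B.
    rewrite -mulrBr normrM (gtr0_norm r0) subr_sqr normrM.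
    apply: (@le_trans _ _ (rho x * ((2 * c)^-1 * `|a x - b x| ^+ 2 + c / 2 * `|a x + b x| ^+ 2))).
      apply: ler_wpM2l; first exact: ltW.
      move: `|a x - b x| `|a x + b x| => p q; rewrite -subr_ge0.
      rewrite (_ : _ - _ = (2 * c)^-1 * (p - c * q) ^+ 2); last by field; rewrite gt_eqF.
      by rewrite mulr_ge0 ?sqr_ge0// invr_ge0 mulr_ge0// ltW.
    rewrite !real_normK ?num_real// -subr_ge0.
    rewrite (_ : _ - _ = c / 2 * rho x * (a x - b x) ^+ 2); last by field; rewrite gt_eqF.
    by rewrite mulr_ge0 ?sqr_ge0// mulr_ge0 ?ltW// divr_gt0.
  rewrite IntD ?IntZ ?IntD//; [|exact: L1D|exact: L1Z|by apply: L1Z => //; exact: L1D].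
  have h1 := HN _ _ Na' Nb'; have h2 := HC _ Na; have h3 := HC _ Nb.
  rewrite -/a -/b in h1 h2 h3.
  apply: (@lt_le_trans _ _ ((2 * c)^-1 * (c * e) + c * (C + C))).
    apply: ltr_leD; first by rewrite ltr_pM2l// invr_gt0 mulr_gt0.
    by rewrite ler_pM2l//; exact: lerD.
  by rewrite /c le_eqVlt; apply/orP; right; rewrite -subr_gt0 (_ : _ - _ = e / 4) ?divr_gt0//; field; rewrite !gt_eqF.
pose eta x := zt x / rho x.
have meta : measurable_fun D eta by apply: measurable_funM => //; exact: L1_meas Izt.
exists eta; split => //.
  apply: (L1_ae_eq mD Iz2); first by apply: measurable_funM => //; exact: measurable_funX.
  apply: aeS (aeI ae ae2) => x [h1 h2] Dx; have r0 := rho_gt0 Dx.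
  have sub : v2 (tau k) x @[k --> \oo] --> rho x * eta x ^+ 2.
    have c1 : (rho x * v (sg (N0 + tau k)%N) x) @[k --> \oo] --> zt x.
      apply: (cvg_comp _ _ _ (h1 Dx)).
      move=> B [n _ HB]; exists n => // k /= nk; apply: HB => /=.
      by apply: leq_trans nk _; apply: leq_trans (tauk k) _; rewrite leq_addl.
    have c2 : (rho x * v (sg (N0 + tau k)%N) x) * (rho x * v (sg (N0 + tau k)%N) x) / rho x
        @[k --> \oo] --> zt x * zt x / rho x.
      by apply: cvgM; [by apply: cvgM; exact: c1|exact: cvg_cst].
    rewrite (_ : rho x * eta x ^+ 2 = zt x * zt x / rho x); last first.
      by rewrite /eta; move: (zt x) => y; field; rewrite gt_eqF.
    apply: cvg_trans c2; apply: near_eq_cvg; apply: nearW => k; rewrite /v2.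
    by move: (v (sg (N0 + tau k)%N) x) => y; field; rewrite gt_eqF.
  exact: (cvg_unique _ (h2 Dx) sub).
apply: cvg_trans cv; apply: near_eq_cvg; apply: nearW => n; apply: Int_eq => x /rho_gt0 r0.
by rewrite mulrBr /eta [rho x * (zt x / _)]mulrCA mulfV ?mulr1// gt_eqF.
Qed.

End WeightedL2.

(** * Limits in the energy norm *)

Section EnergyLimit.
Variables (R : realType) (alpha beta : R).
Hypotheses (halpha : 0 < alpha < 1) (hbeta : 0 < beta < 1).
Notation mu := (@lebesgue_measure R).
Notation w := (weight alpha beta).
Notation I := (`]-1, 1[%classic : set R).
Notation phi := (phi alpha beta).
Notation rr := (rr alpha beta).
Notation jB := (jB alpha beta).
Notation Zf := (Zf alpha beta).
Notation Rep := (Rep alpha beta).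
Notation L2w := (L2w alpha beta).
Implicit Types (f : R -> R) (x : R).

Let inIP x : I x -> -1 < x < 1. Proof. by rewrite /= in_itv. Qed.
Let mI : measurable I. Proof. exact: measurable_itv. Qed.

Lemma cvg_of_bound (s a : nat -> R) (c : R) : (forall n, `|s n - c| <= a n) ->
  a n @[n --> \oo] --> 0 -> s n @[n --> \oo] --> c.
Proof.
move=> sa /cvgr0Pnorm_lt a0; apply/cvgrPdist_lt => e /a0; apply: filterS => n an.
by rewrite distrC; apply: le_lt_trans (sa n) _; apply: le_lt_trans (ler_norm _) an.
Qed.

Lemma le0_of_bound (A : R) (a : nat -> R) : (forall n, A <= a n) ->
  a n @[n --> \oo] --> 0 -> A <= 0.
Proof.
move=> Aa a0; apply: contrapT => /negP; rewrite -ltNge => A0.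
have [n _ /(_ n (leqnn n))/= an] := (@cvgr0Pnorm_lt _ _ _ _ _ a).1 a0 _ A0.
by move: (le_lt_trans (Aa n) (le_lt_trans (ler_norm _) an)); rewrite ltxx.
Qed.

Lemma Ji_patch_dist f1 f2 x : L1 I f1 -> L1 I f2 ->
  `|Ji (f1 \_ I) x - Ji (f2 \_ I) x| <= \int[mu]_(t in I) `|f1 t - f2 t|.
Proof.
move=> I1 I2; have I12 := L1B mI I1 I2.
rewrite -[- Ji _ _]mulN1r -Ji_lin; [|exact: L1_patch|exact: L1_patch].
rewrite (_ : (fun t => _) = (fun t => f1 t - f2 t) \_ I); last first.
  apply/funext => t; rewrite !patchE; case: ifP => _; first by rewrite mulN1r.
  by rewrite -[point]/(0 : R) mulr0 addr0.
apply: le_trans (Ji_le _ (L1_patch I12)) _; rewrite Int_patch.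
apply: Int_le => // [||t _].
- by apply: L1_norm => //; exact: L1_patch.
- by apply: L1_patch; exact: L1_norm.
by rewrite !patchE; case: ifP => _ //; rewrite -[point]/(0 : R) normr0.
Qed.

Lemma Zf_dist (z0 y1 y2 x : R) (h1 h2 : R -> R) : L1 I h1 -> L1 I h2 ->
  `|Zf z0 y1 h1 x - Zf z0 y2 h2 x| <=
  \int[mu]_(t in I) `|rr t * Yf y1 h1 t - rr t * Yf y2 h2 t|.
Proof.
move=> I1 I2; have J1 := L1_rrY halpha hbeta y1 I1; have J2 := L1_rrY halpha hbeta y2 I2.
apply: le_trans (Ji_patch_dist x J1 J2); rewrite /Zf.
by move: (Ji _ x) (Ji _ x) => b a; rewrite (_ : z0 - a - (z0 - b) = b - a) 1?distrC//; ring.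
Qed.

Lemma Int_phi_gt0 : 0 < \int[mu]_(x in I) phi x.
Proof.
have I4 : L1 I (fun=> 4^-1 : R).
  apply: (@L1_bounded _ _ _ 1) => //; last by move=> x _; rewrite ger0_norm; lra.
  by rewrite lebesgue_measure_itv/= ifT ?lte_fin -?EFinB ?ltry//; lra.
have := Int_le mI I4 (L1_phi halpha hbeta); rewrite Rintegral_cst//= => H.
apply: lt_le_trans (H _) => [|x /inIP xI].
  by rewrite lebesgue_measure_itv/= ifT ?lte_fin -?EFinB/=; lra.
by rewrite /phi lef_pV2 ?posrE ?w_gt0//; exact: w_le4.
Qed.

Section Limit.
Variables (u : nat -> R -> R) (z : nat -> R) (h : nat -> R -> R) (g : R -> R).
Hypotheses (Ru : forall n, Rep (u n) (z n) 0 (h n)) (Lg : L2w g)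
  (cg : forall x, -1 < x < 1 -> {for x, continuous g})
  (ug : \int[mu]_(x in I) ((u n x - g x) ^+ 2 * w x) @[n --> \oo] --> 0)
  (uC : forall e, 0 < e -> exists N : nat, forall m n : nat, (N <= m)%N -> (N <= n)%N ->
     \int[mu]_(x in I) (rr x * (Yf 0 (h m) x - Yf 0 (h n) x) ^+ 2) < e).

Let Ih n : L1 I (h n). Proof. by have [Lh _] := Ru n; exact: L2w_L1 Lh. Qed.

Let mYf n : measurable_fun I (Yf 0 (h n)).
Proof. by apply: continuous_meas_oo => x _; exact: Yf_cont. Qed.

Let L1_ug : \int[mu]_(x in I) `|u n x - g x| @[n --> \oo] --> 0.
Proof.
apply/cvgr0Pnorm_lt => e e0.
(* Take rho = phi and d = w (u n - g): since phi w = 1, rho d is u n - g and rho d^2 is (u n - g)^2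
   w. *)
have [dl dl0 H] := L2_L1_small mI (L1_phi halpha hbeta) (fun x xI => phi_gt0 alpha beta (inIP xI)) e0.
move/cvgr0Pnorm_lt: ug => /(_ _ dl0); apply: filterS => n un.
rewrite ger0_norm; last by apply: Int_ge0.
have Lug : L2w (fun x => u n x - g x).
  by apply: L2w_eq (L2w_lin (-1) (Rep_L2w halpha hbeta (Ru n)) Lg) => x _; rewrite mulN1r.
have [_ Iug] := Lug.
have E x : I x -> phi x * (w x * (u n x - g x)) = u n x - g x.
  by move=> /inIP xI; rewrite mulrA /phi mulVf ?mul1r// gt_eqF// w_gt0.
have E2 x : I x -> phi x * (w x * (u n x - g x)) ^+ 2 = (u n x - g x) ^+ 2 * w x.
  by move=> xI; rewrite expr2 mulrA E//; ring.
rewrite -(Int_eq (f := fun x => `|phi x * (w x * (u n x - g x))|)); last by move=> x /E ->.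
apply: H.
- by apply: L1_eq (L2w_L1 halpha hbeta Lug) => // x /E ->.
- by apply: L1_eq Iug => // x /E2 ->.
rewrite (Int_eq E2); exact: le_lt_trans (ler_norm _) un.
Qed.

(** Convergence of y in L^2(r) makes the integrals of r y converge uniformly in the upper limit. The
    free constants z n are then recovered from the integral of u n over (-1, 1), because the
    integral of phi is positive. *)
Lemma energy_limit : exists (eta : R -> R) (c0 : R), [/\ measurable_fun I eta,
  L1 I (fun x => rr x * eta x ^+ 2),
  forall x, -1 < x < 1 -> g x = phi x * (c0 - Ji ((fun t => rr t * eta t) \_ I) x),
  z n @[n --> \oo] --> c0 &
  Zf (z n) 0 (h n) 1 @[n --> \oo] --> c0 - Ji ((fun t => rr t * eta t) \_ I) 1].
Proof.
have Ir := L1_rr halpha hbeta; have Ip := L1_phi halpha hbeta.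
have r_gt0 x : I x -> 0 < rr x by move=> /inIP; exact: rr_gt0.
have IY n : L1 I (fun x => rr x * Yf 0 (h n) x) by exact: L1_rrY.
have IY2 n : L1 I (fun x => rr x * Yf 0 (h n) x ^+ 2).
  by apply: L1_eq (L1_rYY halpha hbeta 0 0 (Ih n) (Ih n)) => // x _; rewrite expr2 mulrA.
have mrV : measurable_fun I (fun x => (rr x)^-1).
  apply: (@eq_measurable_fun _ _ _ _ _ (fun x => jQ x * phi x)).
    by move=> x /set_mem _; rewrite /rr invf_div /phi.
  apply: measurable_funM; last exact: L1_meas Ip.
  by apply: continuous_meas_oo => x _; exact: der_continuous (der_jQ x).
have [eta [meta Ieta2 deta]] := L2_complete mI Ir r_gt0 mYf IY2 uC mrV.
have Ieta := L2_L1 mI Ir r_gt0 meta Ieta2.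
pose J := Ji ((fun t => rr t * eta t) \_ I).
pose Jn n := Ji ((fun t => rr t * Yf 0 (h n) t) \_ I).
pose dn n := \int[mu]_(x in I) `|rr x * (Yf 0 (h n) x - eta x)|.
have dJ n x : `|Jn n x - J x| <= dn n.
  apply: le_trans (Ji_patch_dist _ (IY n) Ieta) _.
  by rewrite le_eqVlt; apply/orP; left; apply/eqP; apply: Int_eq => t _; rewrite mulrBr.
have K0 := Int_phi_gt0; set K := Rintegral _ _ _ in K0.
pose en n := \int[mu]_(x in I) `|u n x - g x|.
have e0 : en n @[n --> \oo] --> 0 := L1_ug.
have d0 : dn n @[n --> \oo] --> 0 := deta.
have uE n x : I x -> u n x = phi x * (z n - Jn n x) by move=> /inIP xI; have [_ ->] := Ru n.
have IJ v : L1 setT v -> L1 I (fun x => phi x * Ji v x).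
  move=> Iv; apply: (@L1_eq _ _ (fun x => Ji v x * phi x)) => //; first by move=> x _; rewrite mulrC.
  apply: (L1_mul_bounded mI Ip) => [|x _]; last exact: Ji_le.
  by apply: measurable_funTS; exact: Ji_measurable.
have IJe : L1 I (fun x => phi x * J x) by apply: IJ; exact: L1_patch.
have IJn n : L1 I (fun x => phi x * Jn n x) by apply: IJ; exact: L1_patch.
have Iu n := L2w_L1 halpha hbeta (Rep_L2w halpha hbeta (Ru n)).
have Ig := L2w_L1 halpha hbeta Lg.
have Idn n : L1 I (fun x => `|u n x - g x|) by apply: L1_norm => //; exact: L1B.
have Iug n : L1 I (fun x => `|u n x - g x| + dn n * phi x).
  by apply: L1D => //; exact: L1Z.
have dn0 n : 0 <= dn n by exact: Int_ge0.
have bnd n : `|z n * K - \int[mu]_(x in I) (g x + phi x * J x)| <= en n + dn n * K.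
  have Iz : L1 I (fun x => z n * phi x) by exact: L1Z.
  have IgJ : L1 I (fun x => g x + phi x * J x) by exact: L1D.
  rewrite /K -IntZ// -IntB//; apply: le_trans (Int_norm mI _) _; first exact: L1B.
  rewrite /en -IntZ// -IntD//; last exact: L1Z.
  apply: Int_le => // [|x xI]; first by apply: L1_norm => //; exact: L1B.
  have p0 := phi_gt0 alpha beta (inIP xI).
  have -> : z n * phi x - (g x + phi x * J x) = (u n x - g x) + phi x * (Jn n x - J x).
    by rewrite (uE n x xI); ring.
  apply: le_trans (ler_normD _ _) _; rewrite lerD2l normrM (gtr0_norm p0) mulrC.
  by apply: ler_wpM2r (dJ n x); exact: ltW.
have bnd0 : en n + dn n * K @[n --> \oo] --> 0.
  rewrite [X in _ --> X](_ : 0 = 0 + 0 * K); last by rewrite mul0r addr0.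
  by apply: cvgD => //; apply: cvgM => //; exact: cvg_cst.
(* The constant that g = phi (c0 - J) forces after integration over (-1, 1). *)
pose c0 := (\int[mu]_(x in I) (g x + phi x * J x)) / K.
have zc : z n @[n --> \oo] --> c0.
  apply: (@cvg_of_bound _ (fun n => (en n + dn n * K) / K)) => [n|].
    rewrite ler_pdivlMr// -{1}(gtr0_norm K0) -normrM mulrBl /c0 divfK ?gt_eqF//.
  rewrite [X in _ --> X](_ : 0 = 0 / K); last by rewrite mul0r.
  by apply: cvgM => //; exact: cvg_cst.
have Zc x : z n - Jn n x @[n --> \oo] --> c0 - J x.
  by apply: cvgB => //; apply: cvg_of_bound d0 => n; exact: dJ.
exists eta, c0; split => //; last exact: Zc.
have cJ : continuous J by apply: Ji_cont; exact: L1_patch.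
have ae : {ae mu, forall x, I x -> `|g x - phi x * (c0 - J x)| = 0}.
  have IcJ : L1 I (fun x => phi x * (c0 - J x)).
    apply: (@L1_eq _ _ (fun x => c0 * phi x - phi x * J x)) => //; first by move=> x _; ring.
    by apply: L1B => //; exact: L1Z.
  have Id : L1 I (fun x => `|g x - phi x * (c0 - J x)|) by apply: L1_norm => //; exact: L1B.
  apply: Int_eq0_ae => //; apply/le_anti; rewrite Int_ge0// andbT.
  apply: (@le0_of_bound _ (fun n => en n + dn n * K + `|z n - c0| * K)) => [n|]; last first.
    rewrite [X in _ --> X](_ : 0 = 0 + 0 * K); last by rewrite mul0r addr0.
    apply: cvgD => //; apply: cvgM; last exact: cvg_cst.
    apply/cvgr0Pnorm_lt => e ep; move/cvgrPdist_lt: zc => /(_ _ ep).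
    by apply: filterS => n; rewrite normr_id distrC.
  have I2 : L1 I (fun x => `|z n - c0| * phi x) by exact: L1Z.
  have I3 : L1 I (fun x => dn n * phi x) by exact: L1Z.
  rewrite /en /K -(IntZ (dn n) mI Ip) -(IntD mI (Idn n) I3) -(IntZ _ mI Ip) -(IntD mI (Iug n) I2).
  apply: Int_le => // [|x xI]; first exact: L1D.
  have p0 := phi_gt0 alpha beta (inIP xI).
  have -> : g x - phi x * (c0 - J x) = - (u n x - g x) + - (phi x * (Jn n x - J x)) + phi x * (z n - c0).
    by rewrite (uE n x xI); ring.
  apply: le_trans (ler_normD _ _) _; rewrite normrM (gtr0_norm p0) [phi x * `|_|]mulrC lerD2r.
  apply: le_trans (ler_normD _ _) _; rewrite !normrN lerD2l normrM (gtr0_norm p0) mulrC.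
  by apply: ler_wpM2r (dJ n x); exact: ltW.
apply: ae_eq_continuous => // [x xI|].
  apply: cvgM; first exact: der_continuous (der_phi alpha beta xI).
  by apply: cvgB; [exact: cvg_cst|exact: cJ].
apply: aeS ae => x hx xI; apply/eqP; rewrite -subr_eq0 -normr_eq0; apply/eqP/hx.
by rewrite /= in_itv.
Qed.

End Limit.

Lemma pderiv_limit g eta c0 : L1 I (fun x => rr x * eta x) ->
  (forall x, -1 < x < 1 -> g x = phi x * (c0 - Ji ((fun t => rr t * eta t) \_ I) x)) ->
  {ae mu, forall x, -1 < x < 1 -> pJ alpha beta x * derive1 g x =
    jB x * (c0 - Ji ((fun t => rr t * eta t) \_ I) x) - w x * eta x}.
Proof.
move=> Ieta gE; apply: aeS (Ji_ae_derive (L1_patch Ieta)) => x Dx xI.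
have D0 := derM (der_phi alpha beta xI) (derB (der_cst c0 x) Dx).
rewrite (der_derive1 (der_itv xI (fun y yI => esym (gE y yI)) D0)) patchI// pJE//.
have w0 := w_gt0 alpha beta xI; have q0 := jQ_gt0 xI.
rewrite /rr /phi; move: (Ji _ x) => J; move: (eta x) (jQ x) (w x) (jB x) q0 w0 => e q W B q0 w0.
by field; rewrite !gt_eqF.
Qed.

End EnergyLimit.

(** * Approximate limits *)

Section ApproximateLimits.
Variable R : realType.
Notation Re := (@complex.Re R).
Notation Im := (@complex.Im R).
Notation mu := (@lebesgue_measure R).
Variable J : R -> set R.
Hypotheses (mJ : forall h, measurable (J h)) (muJ : forall h, 0 < h -> mu (J h) = h%:E).
Implicit Types (f : R -> R[i]) (l : R[i]).

Definition ap_cvg f l : Prop := forall e : R, 0 < e ->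
  fine (mu (J h `&` off_limit f l e)) / h @[h --> 0^'+] --> (0 : R).

(* [lebesgue_measure] is an outer measure on arbitrary sets, hence monotone there. *)
Lemma le_lebesgue_measure (A B : set R) : A `<=` B -> (mu A <= mu B)%E.
Proof.
rewrite /lebesgue_measure /= /lebesgue_stieltjes_measure /= /measure_extension => AB.
exact: le_outer_measure.
Qed.

Lemma fine_J_le h (A : set R) : 0 < h -> A `<=` J h -> mu A \is a fin_num /\ 0 <= fine (mu A).
Proof.
move=> h0 AJ; have le := le_lebesgue_measure AJ; rewrite muJ// in le.
by rewrite fine_ge0// ge0_fin_numE// (le_lt_trans le)// ltry.
Qed.

Lemma sqnormc_ge0 (x : R[i]) : 0 <= sqnormc x.
Proof. by rewrite addr_ge0 ?sqr_ge0. Qed.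

Lemma sqnormcD (x y : R[i]) : sqnormc (x + y) <= 2 * sqnormc x + 2 * sqnormc y.
Proof.
rewrite /sqnormc !cE -subr_ge0.
rewrite (_ : _ - _ = (Re x - Re y) ^+ 2 + (Im x - Im y) ^+ 2); last by ring.
by rewrite addr_ge0 ?sqr_ge0.
Qed.

Variables (f : R -> R[i]) (l : R[i]).
Hypothesis small : forall e eps : R, 0 < e -> 0 < eps -> \forall h \near 0^'+,
  exists M, [/\ measurable M, J h `&` off_limit f l e `<=` M & (mu M <= (eps * h)%:E)%E].

(** The set where f is off the limit need not be measurable, since f is arbitrary; [small] therefore
    provides measurable covers, and monotonicity of the outer measure does the rest. *)
Lemma ap_cvg_small : ap_cvg f l.
Proof.
move=> e e0; apply/cvgr0Pnorm_lt => eps eps0; have eps2 : 0 < eps / 2 by exact: divr_gt0.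
have := small e0 eps2; apply: filterS2 (nbhs_right_gt (0 : R)) => h h0 [M [mM sM leM]].
have [fA A0] := fine_J_le h0 (@subIsetl _ (J h) (off_limit f l e)).
rewrite ger0_norm; last by rewrite divr_ge0// ltW.
apply: (@le_lt_trans _ _ (eps / 2)); last by rewrite ltr_pdivrMr// ltr_pMr//; lra.
rewrite ler_pdivrMr// -lee_fin fineK//.
exact: le_trans (le_lebesgue_measure sM) leM.
Qed.

(** If l' differed from l, the points where f is within half their distance of l would be off l'. By
    [small] these fill at least 3/4 of J h, which contradicts density 0. *)
Lemma ap_cvg_unique l' : ap_cvg f l' -> l' = l.
Proof.
move=> fl'; apply: contrapT => ll'.
have d0 : 0 < sqnormc (l - l').
  rewrite lt_neqAle sqnormc_ge0 andbT; apply/eqP => /esym/eqP.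
  rewrite /sqnormc paddr_eq0 ?sqr_ge0// !sqrf_eq0 !cE !subr_eq0 => /andP[/eqP e1 /eqP e2].
  by apply: ll'; apply: cext.
pose e := Num.sqrt (sqnormc (l - l')) / 2.
have e0 : 0 < e by rewrite divr_gt0// sqrtr_gt0.
have e2 : e ^+ 2 = sqnormc (l - l') / 4.
  by rewrite /e expr_div_n sqr_sqrtr ?sqnormc_ge0//; congr (_ / _); ring.
have q0 : 0 < 4^-1 :> R by [].
have := fl' e e0; move/cvgr0Pnorm_lt => /(_ _ q0) near1.
have near2 := small e0 q0.
have [h [h0 h1 [M [mM sM leM]]]] : exists h, [/\ 0 < h,
    `|fine (mu (J h `&` off_limit f l' e)) / h| < 4^-1 &
    exists M, [/\ measurable M, J h `&` off_limit f l e `<=` M & (mu M <= (4^-1 * h)%:E)%E]].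
  apply: (@filter_ex _ (0^'+ : set_system R)); near=> h; split.
  - by near: h; exact: nbhs_right_gt.
  - by near: h.
  - by near: h.
have [fA A0] := fine_J_le h0 (@subIsetl _ (J h) (off_limit f l' e)).
have sub : J h `\` M `<=` J h `&` off_limit f l' e.
  move=> x [Jx nMx]; split => //; rewrite /off_limit /=.
  have : ~ (off_limit f l e x) by move=> off; apply: nMx; exact: sM.
  move/negP; rewrite /= -ltNge => s1; rewrite leNgt; apply/negP => s2.
  have := sqnormcD (l - f x) (f x - l'); rewrite (_ : l - f x + _ = l - l'); last by ring.
  have -> : sqnormc (l - f x) = sqnormc (f x - l) by rewrite /sqnormc !cE; ring.
  by move: s1 s2; rewrite e2; lra.
have le1 := le_lebesgue_measure sub.
have mJM : (mu (J h `&` M) <= (4^-1 * h)%:E)%E.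
  by apply: le_trans leM; apply: le_lebesgue_measure => x [].
have E : mu (J h) = (mu (J h `\` M) + mu (J h `&` M))%E by apply: (measureDI mu (mJ h) mM).
have le2 : (h%:E <= mu (J h `&` off_limit f l' e) + (4^-1 * h)%:E)%E.
  by rewrite -(muJ h0) E; apply: leeD.
move: le2; rewrite -(fineK fA) -EFinD lee_fin => le2.
move: h1; rewrite ger0_norm; last by rewrite divr_ge0// ltW.
by rewrite ltr_pdivrMr//; move: le2; move: (fine _) => F; lra.
Unshelve. all: by end_near. Qed.

Lemma ap_lim_val : xget 0 [set l | ap_cvg f l] = l.
Proof. by apply: ap_cvg_unique; exact: (@xgetPex _ 0 [set l | ap_cvg f l] (ex_intro _ l ap_cvg_small)). Qed.

End ApproximateLimits.

(** * Traces at the endpoints on the form domain *)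

Section BoundaryTraces.
Variables (R : realType) (alpha beta : R).
Hypotheses (halpha : 0 < alpha < 1) (hbeta : 0 < beta < 1).
Notation Re := (@complex.Re R).
Notation Im := (@complex.Im R).
Notation mu := (@lebesgue_measure R).
Notation w := (weight alpha beta).
Notation I := (`]-1, 1[%classic : set R).
Notation rr := (rr alpha beta).
Implicit Types (f : R -> R[i]) (x h : R).

Let inIP x : I x -> -1 < x < 1. Proof. by rewrite /= in_itv. Qed.
Let mI : measurable I. Proof. exact: measurable_itv. Qed.

Section OneSide.
Variables (J : R -> set R) (F : set_system R).
Context {FF : Filter F}.
Hypotheses (mJ : forall h, measurable (J h)) (muJ : forall h, 0 < h -> mu (J h) = h%:E)
  (JF : forall P : R -> Prop, (\forall x \near F, P x) ->
     \forall h \near 0^'+, forall x, J h x -> P x)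
  (JI : \forall h \near 0^'+, J h `<=` I)
  (JQ : \forall h \near 0^'+, forall x, J h x -> jQ x <= 2 * h)
  (wF : w x @[x --> F] --> (0 : R)).

(** Close to the endpoint no point is off the limit, so the empty set is a cover. *)
Lemma off_limit_cvg f (l : R[i]) (e eps : R) : 0 < e -> 0 < eps ->
  Re (f x) @[x --> F] --> Re l -> Im (f x) @[x --> F] --> Im l ->
  \forall h \near 0^'+,
  exists M, [/\ measurable M, J h `&` off_limit f l e `<=` M & (mu M <= (eps * h)%:E)%E].
Proof.
move=> e0 eps0 fr fi; have e2 : 0 < e / 2 by rewrite divr_gt0.
move/cvgrPdist_lt: fr => /(_ _ e2)/JF nr; move/cvgrPdist_lt: fi => /(_ _ e2)/JF ni.
near=> h; exists set0; split => //; last first.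
  by rewrite measure0 lee_fin mulr_ge0// ltW//; near: h; exact: nbhs_right_gt.
move=> x [Jx]; rewrite /off_limit /= => off; apply/negP: off; rewrite -ltNge.
have h1 : `|Re l - Re (f x)| < e / 2 by have := Jx; move: (x); near: h.
have h2 : `|Im l - Im (f x)| < e / 2 by have := Jx; move: (x); near: h.
have key (d : R) : `|d| < e / 2 -> d ^+ 2 < e ^+ 2 / 2.
  move=> de; rewrite -(real_normK (num_real d)); move: de (normr_ge0 d); move: `|d| => y.
  by rewrite !expr2 => y1 y0; nra.
have := key _ h1; have := key _ h2; rewrite /sqnormc !cE => k2 k1.
rewrite -[X in X ^+ 2 + _]opprB -[X in _ + X ^+ 2]opprB !sqrrN [ltRHS]splitr.
exact: ltrD.
Unshelve. all: by end_near. Qed.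

(* As w^2 = rr (1 - x^2) w and 1 - x^2 <= 2 h on J h, Chebyshev's inequality bounds the measure
   of {|w e1| >= c} in J h by o(h). *)
Lemma off_limit_energy f (l : R[i]) (A B e1 e2 : R -> R) :
  measurable_fun I e1 -> measurable_fun I e2 ->
  L1 I (fun x => rr x * e1 x ^+ 2) -> L1 I (fun x => rr x * e2 x ^+ 2) ->
  {ae mu, forall x, -1 < x < 1 -> Re (f x) = A x + w x * e1 x} ->
  {ae mu, forall x, -1 < x < 1 -> Im (f x) = B x + w x * e2 x} ->
  A x @[x --> F] --> Re l -> B x @[x --> F] --> Im l ->
  forall e eps : R, 0 < e -> 0 < eps -> \forall h \near 0^'+,
  exists M, [/\ measurable M, J h `&` off_limit f l e `<=` M & (mu M <= (eps * h)%:E)%E].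
Proof.
move=> m1 m2 I1 I2 fr fi Al Bl e eps e0 eps0.
pose G x := w x ^+ 2 * (e1 x ^+ 2 + e2 x ^+ 2).
pose S x := rr x * e1 x ^+ 2 + rr x * e2 x ^+ 2.
have IS : L1 I S by exact: L1D.
have S0 x : I x -> 0 <= S x.
  by move=> /inIP xI; have r0 := ltW (rr_gt0 alpha beta xI); rewrite addr_ge0// mulr_ge0// sqr_ge0.
have C0 : 0 <= \int[mu]_(x in I) S x by exact: Int_ge0.
set C := Rintegral _ _ _ in C0.
have mG : measurable_fun I G.
  apply: measurable_funM; first by apply: measurable_funX; exact: w_meas.
  by apply: measurable_funD; exact: measurable_funX.
(* Where A and B are within e / 4 of their limits, being off by e forces G >= 3 e^2 / 8, which
   exceeds this threshold. *)
pose c := e ^+ 2 / 4; have c0 : 0 < c by rewrite divr_gt0// exprn_gt0.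
(* With w < [dl] near the endpoint, Chebyshev bounds c times the measure of M' by 2 h dl (C + 1) =
   eps c h. *)
pose dl := eps * c / (2 * (C + 1)).
have C1 : 0 < C + 1 by exact: ltr_wpDl.
have dl0 : 0 < dl by rewrite divr_gt0 ?mulr_gt0.
have [N [mN N0 HN]] := aeI fr fi.
have e4 : 0 < e / 4 by rewrite divr_gt0.
move/cvgrPdist_lt: Al => /(_ _ e4)/JF nA; move/cvgrPdist_lt: Bl => /(_ _ e4)/JF nB.
move/cvgrPdist_lt: wF => /(_ _ dl0)/JF nw.
near=> h; pose M' := J h `&` (G @^-1` [set y | c <= y]).
have h0 : 0 < h by near: h; exact: nbhs_right_gt.
have JhI : J h `<=` I by near: h.
have mM' : measurable M'.
  have := measurable_funS mI JhI mG; move=> /(_ (mJ h) [set` `[c, +oo[] (measurable_itv _)).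
  rewrite (_ : G @^-1` [set` `[c, +oo[] = G @^-1` [set y | c <= y])//.
  by apply/seteqP; split => x /=; rewrite in_itv/= andbT.
exists (N `|` M'); split; first exact: measurableU.
  move=> x [Jx off]; have xI := inIP (JhI _ Jx).
  have [Nx|nN] := pselect (N x); [by left|right; split => //=].
  have [Ex Ey] : (-1 < x < 1 -> Re (f x) = A x + w x * e1 x) /\ (-1 < x < 1 -> Im (f x) = B x + w x * e2 x).
    by apply: contrapT => nE; apply: nN; exact: HN.
  move: off; rewrite /off_limit /= /sqnormc !cE (Ex xI) (Ey xI) /c /G.
  have h1 : `|Re l - A x| < e / 4 by have := Jx; move: (x); near: h.
  have h2 : `|Im l - B x| < e / 4 by have := Jx; move: (x); near: h.
  have key (d : R) : `|d| < e / 4 -> d ^+ 2 <= e ^+ 2 / 16.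
    move=> de; rewrite -(real_normK (num_real d)); move: de (normr_ge0 d); move: `|d| => y.
    by rewrite !expr2 => y1 y0; nra.
  have := key _ h1; have := key _ h2; move: (w x) (e1 x) (e2 x) (A x) (B x) (Re l) (Im l).
  move=> W p q a b lr li k2 k1 off.
  have : (a + W * p - lr) ^+ 2 + (b + W * q - li) ^+ 2 <=
    2 * ((lr - a) ^+ 2 + (li - b) ^+ 2) + 2 * (W ^+ 2 * (p ^+ 2 + q ^+ 2)).
    rewrite -subr_ge0 (_ : _ - _ = (a - W * p - lr) ^+ 2 + (b - W * q - li) ^+ 2); last by ring.
    by rewrite addr_ge0 ?sqr_ge0.
  move=> U; have := le_trans off U; have := sqr_ge0 e; move: k1 k2.
  by move: (W ^+ 2 * _) ((lr - a) ^+ 2) ((li - b) ^+ 2) (e ^+ 2) => X Y Z T; lra.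
have M'J : M' `<=` J h by move=> x [].
have fM : mu M' \is a fin_num by have [] := fine_J_le muJ h0 M'J.
have leU : (mu (N `|` M') <= mu N + mu M')%E by apply: measureU2.
apply: le_trans leU _; rewrite N0 add0e -(fineK fM) lee_fin.
have M'I : M' `<=` I by move=> x /M'J/JhI.
have IM : L1 M' (fun=> c).
  apply: (@L1_bounded _ _ _ c) => //; first by rewrite -(fineK fM) ltry.
  by move=> x _; rewrite gtr0_norm.
have ISM : L1 M' S by apply: L1_sub IS.
have : \int[mu]_(x in M') c <= \int[mu]_(x in M') (2 * h * dl * S x).
  apply: Int_le => // [|x [Jx cG]]; first exact: L1Z.
  apply: le_trans cG _; have xI := inIP (JhI _ Jx); have w0 := w_gt0 alpha beta xI.
  have q0 := jQ_gt0 xI.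
  have -> : G x = jQ x * w x * S x.
    by rewrite /G /S /rr; move: (w x) (jQ x) (e1 x) (e2 x) q0 => W q a b q0; field; rewrite gt_eqF.
  apply: ler_wpM2r; first exact: S0 (JhI _ Jx).
  apply: ler_pM; [exact: ltW|exact: ltW| |].
    by have := Jx; move: (x); near: h.
  rewrite -[w x](gtr0_norm w0) -normrN -sub0r ltW//.
  by have := Jx; move: (x); near: h.
rewrite Rintegral_cst// (IntZ _ mM' ISM) => H.
have H2 : \int[mu]_(x in M') S x <= C + 1.
  by apply: le_trans (Int_subset mM' mI M'I IS S0) _; rewrite lerDl.
rewrite -(ler_pM2l c0); apply: le_trans H _.
apply: (@le_trans _ _ (2 * h * dl * (C + 1))).
  by apply: ler_wpM2l H2; rewrite mulr_ge0 ?ltW// mulr_gt0.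
rewrite /dl le_eqVlt; apply/orP; left; apply/eqP; move: C1; move: (C + 1) => K K0.
by field; rewrite gt_eqF.
Unshelve. all: by end_near. Qed.

End OneSide.

Let Jl h : set R := [set` `]-1, -1 + h[].
Let Jr h : set R := [set` `]1 - h, 1[].

Let muJl h : 0 < h -> mu (Jl h) = h%:E.
Proof. by move=> h0; rewrite lebesgue_measure_itv/= lte_fin ltrDl h0 -EFinB; congr _%:E; ring. Qed.

Let muJr h : 0 < h -> mu (Jr h) = h%:E.
Proof. by move=> h0; rewrite lebesgue_measure_itv/= lte_fin gtrBl h0 -EFinB; congr _%:E; ring. Qed.

Let mJl h : measurable (Jl h). Proof. exact: measurable_itv. Qed.
Let mJr h : measurable (Jr h). Proof. exact: measurable_itv. Qed.

Let JFl (P : R -> Prop) : (\forall x \near (-1 : R)^'+, P x) ->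
  \forall h \near 0^'+, forall x, Jl h x -> P x.
Proof.
move=> [d /= d0 H]; near=> h => x; rewrite /Jl /= in_itv/= => /andP[x1 x2]; apply: H => //=.
have hd : h < d by near: h; exact: nbhs_right_lt.
by rewrite ltr_distlC; apply/andP; split; lra.
Unshelve. all: by end_near. Qed.

Let JFr (P : R -> Prop) : (\forall x \near (1 : R)^'-, P x) ->
  \forall h \near 0^'+, forall x, Jr h x -> P x.
Proof.
move=> [d /= d0 H]; near=> h => x; rewrite /Jr /= in_itv/= => /andP[x1 x2]; apply: H => //=.
have hd : h < d by near: h; exact: nbhs_right_lt.
by rewrite ltr_distlC; apply/andP; split; lra.
Unshelve. all: by end_near. Qed.

Let JIl : \forall h \near 0^'+, Jl h `<=` I.
Proof.
near=> h => x; rewrite /Jl /= !in_itv/= => /andP[-> x2]/=.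
have h1 : h < 2 by near: h; exact: nbhs_right_lt.
lra.
Unshelve. all: by end_near. Qed.

Let JIr : \forall h \near 0^'+, Jr h `<=` I.
Proof.
near=> h => x; rewrite /Jr /= !in_itv/= => /andP[x2 ->]; rewrite andbT.
have h1 : h < 2 by near: h; exact: nbhs_right_lt.
lra.
Unshelve. all: by end_near. Qed.

Let JQl : \forall h \near 0^'+, forall x, Jl h x -> jQ x <= 2 * h.
Proof.
near=> h => x; rewrite /Jl /= !in_itv/= => /andP[x1 x2]; rewrite /jQ.
have h1 : h < 2 by near: h; exact: nbhs_right_lt.
by apply: ler_pM; lra.
Unshelve. all: by end_near. Qed.

Let JQr : \forall h \near 0^'+, forall x, Jr h x -> jQ x <= 2 * h.
Proof.
near=> h => x; rewrite /Jr /= !in_itv/= => /andP[x1 x2]; rewrite /jQ mulrC.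
have h1 : h < 2 by near: h; exact: nbhs_right_lt.
by apply: ler_pM; lra.
Unshelve. all: by end_near. Qed.

Lemma BmulE (c : 'cV[R[i]]_2) g : Bmul alpha beta c g = dot2 c (Lambda alpha beta g).
Proof.
rewrite /dot2 big_ord_recl big_ord1 !mxE /=.
by rewrite (_ : lift ord0 ord0 = 1 :> 'I_2)//; exact: val_inj.
Qed.

(** For such f the ordinary limits of p f' exist, and approximate limits agree with them. *)
Lemma CRep_Lambda f z0 y0 k : CRep alpha beta f z0 y0 k ->
  Lambda alpha beta f = Gamma0 alpha beta f.
Proof.
move=> Rf; rewrite (CRep_Gamma0 halpha hbeta Rf); congr col2.
  have [fr fi] := CRep_pderiv_left halpha hbeta Rf.
  apply: (ap_lim_val mJl muJl) => e eps e0 eps0.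
  exact: (off_limit_cvg JFl e0 eps0 fr fi).
have [fr fi] := CRep_pderiv_right halpha hbeta Rf.
apply: (ap_lim_val mJr muJr) => e eps e0 eps0.
exact: (off_limit_cvg JFr e0 eps0 fr fi).
Qed.

Section Trace.
Variables (g : R -> R[i]) (e1 e2 : R -> R) (c1 c2 : R).
Notation Ji1 := (Ji ((fun t => rr t * e1 t) \_ I)).
Notation Ji2 := (Ji ((fun t => rr t * e2 t) \_ I)).
Hypotheses (m1 : measurable_fun I e1) (m2 : measurable_fun I e2)
  (I1 : L1 I (fun x => rr x * e1 x ^+ 2)) (I2 : L1 I (fun x => rr x * e2 x ^+ 2))
  (g1 : forall x, -1 < x < 1 -> Re (g x) = phi alpha beta x * (c1 - Ji1 x))
  (g2 : forall x, -1 < x < 1 -> Im (g x) = phi alpha beta x * (c2 - Ji2 x)).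

Let L1e1 : L1 I (fun x => rr x * e1 x).
Proof. exact: (L2_L1 mI (L1_rr halpha hbeta) (fun x xI => rr_gt0 alpha beta (inIP xI)) m1 I1). Qed.

Let L1e2 : L1 I (fun x => rr x * e2 x).
Proof. exact: (L2_L1 mI (L1_rr halpha hbeta) (fun x xI => rr_gt0 alpha beta (inIP xI)) m2 I2). Qed.

Let pd1 := pderiv_limit L1e1 (g := Re \o g) g1.
Let pd2 := pderiv_limit L1e2 (g := Im \o g) g2.

Let affB_left : jB alpha beta x @[x --> (-1 : R)^'+] --> - (2 * beta).
Proof.
apply: cvg_at_right_filter; have := der_continuous (der_jB alpha beta (-1)).
by rewrite /prop_for /continuous_at (_ : jB alpha beta (-1) = - (2 * beta))//; rewrite /jB; ring.
Qed.

Let affB_right : jB alpha beta x @[x --> (1 : R)^'-] --> 2 * alpha.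
Proof.
apply: cvg_at_left_filter; have := der_continuous (der_jB alpha beta 1).
by rewrite /prop_for /continuous_at (_ : jB alpha beta 1 = 2 * alpha)//; rewrite /jB; ring.
Qed.

Let Jleft (v : R -> R) (c : R) : L1 setT v -> c - Ji v x @[x --> (-1 : R)^'+] --> c - Ji v (-1).
Proof.
move=> Iv; have lim : Ji v x @[x --> (-1 : R)^'+] --> Ji v (-1).
  by apply: cvg_at_right_filter; exact: Ji_cont.
exact: cvB (@cvC _ _ _ c) lim.
Qed.

Let Jright (v : R -> R) (c : R) : L1 setT v -> c - Ji v x @[x --> (1 : R)^'-] --> c - Ji v 1.
Proof.
move=> Iv; have lim : Ji v x @[x --> (1 : R)^'-] --> Ji v 1.
  by apply: cvg_at_left_filter; exact: Ji_cont.
exact: cvB (@cvC _ _ _ c) lim.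
Qed.

Lemma Lambda_trace : Lambda alpha beta g =
  col2 ((2 * beta)%:C * (c1 +i* c2)) ((2 * alpha)%:C * ((c1 - Ji1 1) +i* (c2 - Ji2 1))).
Proof.
have P1 := L1_patch L1e1; have P2 := L1_patch L1e2.
congr col2.
  apply: (ap_lim_val mJl muJl) => e eps e0 eps0; apply: (off_limit_energy mJl muJl JFl JIl JQl (w_left alpha hbeta)
    (A := fun x => - (jB alpha beta x * (c1 - Ji1 x))) (B := fun x => - (jB alpha beta x * (c2 - Ji2 x)))
    m1 m2 I1 I2 _ _ _ _ e0 eps0).
  - apply: aeS pd1 => x E xI; rewrite /pderiv /cderiv !cE mul0r subr0 (E xI); ring.
  - apply: aeS pd2 => x E xI; rewrite /pderiv /cderiv !cE mul0r addr0 (E xI); ring.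
  - apply: cv_val (cvN (cvM affB_left (@Jleft _ c1 P1))) _.
    by rewrite Ji_patch_left// !cE; ring.
  - apply: cv_val (cvN (cvM affB_left (@Jleft _ c2 P2))) _.
    by rewrite Ji_patch_left// !cE; ring.
(* At 1 the functional reads + p g', so the energy terms enter with the opposite sign. *)
apply: (ap_lim_val mJr muJr) => e eps e0 eps0; apply: (off_limit_energy mJr muJr JFr JIr JQr (w_right beta halpha)
  (A := fun x => jB alpha beta x * (c1 - Ji1 x)) (B := fun x => jB alpha beta x * (c2 - Ji2 x))
  (e1 := fun x => - e1 x) (e2 := fun x => - e2 x) _ _ _ _ _ _ _ _ e0 eps0).
- exact: measurableT_comp.
- exact: measurableT_comp.
- by apply: L1_eq I1 => // x _; rewrite sqrrN.
- by apply: L1_eq I2 => // x _; rewrite sqrrN.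
- apply: aeS pd1 => x E xI; rewrite /pderiv /cderiv !cE mul0r subr0 (E xI); ring.
- apply: aeS pd2 => x E xI; rewrite /pderiv /cderiv !cE mul0r addr0 (E xI); ring.
- by apply: cv_val (cvM affB_right (@Jright _ c1 P1)) _; rewrite !cE; ring.
- by apply: cv_val (cvM affB_right (@Jright _ c2 P2)) _; rewrite !cE; ring.
Qed.

End Trace.
End BoundaryTraces.

(** * Nonnegative Hermitian forms and complex sequences *)

Section HermitianForms.
Variable R : realType.
Notation Re := (@complex.Re R).
Notation Im := (@complex.Im R).
Notation func := (R -> R[i]).
Variables (P : set func) (B : func -> func -> R[i]).
Hypotheses (Plin : forall f g (c : R[i]), P f -> P g -> P (fun x => f x + c * g x))
  (Bl : forall f g k (c : R[i]), P f -> P g -> P k ->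
     B (fun x => f x + c * g x) k = B f k + c * B g k)
  (Bh : forall f g, P f -> P g -> B g f = (B f g)^*)
  (Bpos : forall f, P f -> 0 <= Re (B f f)).
Implicit Types (f g d : func).

Lemma herm_linr f g k (c : R[i]) : P f -> P g -> P k ->
  B k (fun x => f x + c * g x) = B k f + c^* * B k g.
Proof.
move=> Pf Pg Pk; rewrite (Bh (Plin c Pf Pg) Pk) Bl// (Bh Pf Pk) (Bh Pg Pk).
by move: (B f k) (B g k) => x y; apply: cext; rewrite !cE; ring.
Qed.

Lemma herm_square d f (c : R[i]) : P d -> P f ->
  Re (B (fun x => d x + c * f x) (fun x => d x + c * f x)) =
  Re (B d d) + 2 * Re (c * B f d) + sqnormc c * Re (B f f).
Proof.
move=> Pd Pf; have Pdf := Plin c Pd Pf.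
rewrite Bl// !herm_linr// (Bh Pf Pd) /sqnormc.
by move: (B d d) (B f f) (B f d) => p q r; rewrite !cE; ring.
Qed.

Lemma herm_parallelogram f g : P f -> P g ->
  Re (B (fun x => f x + (-1) * g x) (fun x => f x + (-1) * g x)) <=
  2 * Re (B f f) + 2 * Re (B g g).
Proof.
move=> Pf Pg; have := Bpos (Plin 1 Pf Pg).
rewrite !herm_square// /sqnormc; move: (B f f) (B g g) (B g f) => p q r; rewrite !cE => h.
rewrite -subr_ge0; apply: le_trans h _; rewrite le_eqVlt; apply/orP; left; apply/eqP; ring.
Qed.

(** Positivity of B on d + c f for c = tau, - tau, i tau and - i tau bounds the real and imaginary
    part of B(f, d) from both sides. The choice tau = e / (F + 1) also covers B(f, f) = 0. *)
Lemma herm_small f (e : R) : P f -> 0 < e -> exists2 dl : R, 0 < dl &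
  forall d, P d -> Re (B d d) < dl -> `|Re (B f d)| < e /\ `|Im (B f d)| < e.
Proof.
move=> Pf e0; have F0 := Bpos Pf; set F := Re (B f f) in F0.
have F1 : 0 < F + 1 by lra.
pose tau := e / (F + 1); have tau0 : 0 < tau by rewrite divr_gt0.
exists (tau * e) => [|d Pd dd]; first exact: mulr_gt0.
have key (c : R[i]) : sqnormc c = tau ^+ 2 -> - (2 * Re (c * B f d)) < 2 * (tau * e).
  move=> cE'; have := Bpos (Plin c Pd Pf); rewrite herm_square// cE' -/F => h.
  have : tau ^+ 2 * F < tau * e.
    rewrite expr2 -mulrA ltr_pM2l// /tau mulrAC ltr_pdivrMr//; move: e0 F0; nra.
  by move: h dd; move: (tau ^+ 2 * F) (Re (B d d)) (Re (c * _)) (tau * e) => p q r k; lra.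
have sg (s : R) : s ^+ 2 = 1 -> sqnormc ((s * tau)%:C : R[i]) = tau ^+ 2 /\ sqnormc ((0 +i* (s * tau)) : R[i]) = tau ^+ 2.
  by move=> s1; rewrite /sqnormc !cE expr0n/= addr0 add0r exprMn s1 mul1r.
have [s1 s2] := sg 1 (expr1n _ _); have [s3 s4] := sg (-1) (etrans (sqrrN _) (expr1n _ _)).
have := key _ s1; have := key _ s2; have := key _ s3; have := key _ s4.
rewrite !cE !mul0r !mul1r !mulN1r !subr0 !sub0r; move: (Re (B f d)) (Im (B f d)) => p q.
by rewrite !ltr_norml => h4 h3 h2 h1; split; apply/andP; split; rewrite -(ltr_pM2l tau0); lra.
Qed.

End HermitianForms.

Section ComplexSequences.
Variable R : realType.
Notation Re := (@complex.Re R).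
Notation Im := (@complex.Im R).
Implicit Types (s : nat -> R[i]) (l : R[i]).

Definition ccvg s l : Prop := Re (s n) @[n --> \oo] --> Re l /\ Im (s n) @[n --> \oo] --> Im l.

Lemma ccvg_unique s l l' : ccvg s l -> ccvg s l' -> l = l'.
Proof. by move=> [r i] [r' i']; apply: cext; [exact: cvg_unique r r'|exact: cvg_unique i i']. Qed.

Lemma ccvg_lin s1 s2 l1 l2 (c : R[i]) : ccvg s1 l1 -> ccvg s2 l2 ->
  ccvg (fun n => s1 n + c * s2 n) (l1 + c * l2).
Proof.
move=> [r1 i1] [r2 i2]; split; under eq_fun do rewrite !cE; rewrite !cE.
  by apply: cvgD => //; apply: cvgB; (apply: cvgM => //; exact: cvg_cst).
by apply: cvgD => //; apply: cvgD; (apply: cvgM => //; exact: cvg_cst).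
Qed.

Lemma ccvg_conj s l : ccvg s l -> ccvg (fun n => (s n)^*) l^*.
Proof.
move=> [r i]; split; under eq_fun do rewrite !cE; rewrite !cE //.
exact: cvgN.
Qed.

Lemma ccvg_cst l : ccvg (fun=> l) l.
Proof. by split; exact: cvg_cst. Qed.

Lemma ccvg_eq s s' l : (forall n, s n = s' n) -> ccvg s l -> ccvg s' l.
Proof. by move=> /funext ->. Qed.

Lemma ccvgZ s l (c : R[i]) : ccvg s l -> ccvg (fun n => c * s n) (c * l).
Proof.
move=> sl; rewrite -[c * l]add0r; apply: ccvg_eq (ccvg_lin c (ccvg_cst 0) sl) => n.
by rewrite add0r.
Qed.

End ComplexSequences.

(** * The closed form of A_0 and the operators A_Theta *)

Section FormDomain.
Variables (R : realType) (alpha beta : R).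
Hypotheses (halpha : 0 < alpha < 1) (hbeta : 0 < beta < 1).
Notation Re := (@complex.Re R).
Notation Im := (@complex.Im R).
Notation mu := (@lebesgue_measure R).
Notation is_der x f df := (is_derive (x : R) (1 : R) (f : R -> R) (df : R)).
Notation w := (weight alpha beta).
Notation I := (`]-1, 1[%classic : set R).
Notation phi := (phi alpha beta).
Notation rr := (rr alpha beta).
Notation Zf := (Zf alpha beta).
Notation CRep := (CRep alpha beta).
Notation inH := (inH alpha beta).
Notation ip := (ip alpha beta).
Notation sqnormH := (sqnormH alpha beta).
Notation Dmax := (Dmax alpha beta).
Notation Gamma0 := (Gamma0 alpha beta).
Notation Gamma1 := (Gamma1 alpha beta).
Notation Lambda := (Lambda alpha beta).
Notation A0 := (A0 alpha beta).
Notation s := ((alpha + beta)%:C : R[i]).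
Notation func := (R -> R[i]).
Variables (D : set func) (t : func -> func -> R[i]).
Hypotheses (DAC : forall f, D f -> AC_loc f) (ht : associated_form alpha beta A0 D t).
Implicit Types (f g h k : func) (x : R).

Let inIP x : I x -> -1 < x < 1. Proof. by rewrite /= in_itv. Qed.
Let Iin x : -1 < x < 1 -> I x. Proof. by rewrite /= in_itv. Qed.
Let mI : measurable I. Proof. exact: measurable_itv. Qed.

Let DH f : D f -> inH f. Proof. by case: ht => -[H _] _ _ _; exact: H. Qed.
Let Dlin f g (c : R[i]) : D f -> D g -> D (fun x => f x + c * g x).
Proof. by case: ht => -[_ [H _]] _ _ _; exact: H. Qed.
Let tl f g k (c : R[i]) : D f -> D g -> D k -> t (fun x => f x + c * g x) k = t f k + c * t g k.
Proof. by case: ht => -[_ [_ [H _]]] _ _ _; exact: H. Qed.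
Let th f g : D f -> D g -> t g f = (t f g)^*.
Proof. by case: ht => -[_ [_ [_ [H _]]]] _ _ _; exact: H. Qed.
Let tA0 f h g : A0 f h -> D f -> D g -> t f g = ip h g.
Proof. by case: ht => _ _ H _; exact: H. Qed.

Lemma D_continuous f x : D f -> -1 < x < 1 ->
  {for x, continuous (Re \o f)} /\ {for x, continuous (Im \o f)}.
Proof.
move=> Df /andP[x0 x1]; have a1 : -1 < (x - 1) / 2 by lra.
have a2 : (x - 1) / 2 < (x + 1) / 2 by lra.
have a3 : (x + 1) / 2 < 1 by lra.
have [ar ai] := DAC Df a1 a2 a3.
have xm : (x - 1) / 2 < x < (x + 1) / 2 by apply/andP; split; lra.
by split; [exact: (abs_cont_continuous ar xm)|exact: (abs_cont_continuous ai xm)].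
Qed.

Lemma D_eq_in f f0 : D f -> Dmax f0 -> eqH f0 f -> forall x, -1 < x < 1 -> f0 x = f x.
Proof.
move=> Df D0 e x xI; have [z [y [k [R1 R2]]]] := Dmax_ex halpha hbeta D0.
apply: cext.
  apply: (ae_eq_continuous (f := Re \o f0) (g := Re \o f)) xI => [u uI|u uI|].
  - exact: (Rep_continuous halpha hbeta R1).
  - by have [] := D_continuous Df uI.
  by apply: aeS e => u eu uI; rewrite /comp (eu (Iin uI)).
apply: (ae_eq_continuous (f := Im \o f0) (g := Im \o f)) xI => [u uI|u uI|].
- exact: (Rep_continuous halpha hbeta R2).
- by have [] := D_continuous Df uI.
by apply: aeS e => u eu uI; rewrite /comp (eu (Iin uI)).
Qed.

Lemma CRep_eq_in f z0 y0 k k' : (forall x, -1 < x < 1 -> k x = k' x) -> CRep f z0 y0 k -> CRep f z0 y0 k'.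
Proof.
by move=> kk [R1 R2]; split; [apply: Rep_eq_h R1|apply: Rep_eq_h R2] => x xI; rewrite /comp kk.
Qed.

Lemma CY1_eq_in y0 k k' : (forall x, -1 < x < 1 -> k x = k' x) -> CY1 y0 k = CY1 y0 k'.
Proof.
move=> kk; rewrite /CY1 /Yf; congr ((_ + Ji _ _) +i* (_ + Ji _ _)); apply/funext => x;
  by rewrite !patchE; case: ifPn => // /set_mem/inIP xI; rewrite /comp kk.
Qed.

Lemma Gamma1_eq0 f : Gamma1 f = 0 <-> f1_left beta f = 0 /\ f1_right alpha f = 0.
Proof.
split=> [G|[l r]].
  have := congr1 (fun c : 'cV[R[i]]_2 => c 0 0) G; have := congr1 (fun c : 'cV[R[i]]_2 => c 1 0) G.
  by rewrite !mxE /= => -> /eqP; rewrite oppr_eq0 => /eqP ->.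
by apply/colP => i; rewrite !mxE l r oppr0; case: ifP.
Qed.

Local Opaque Defs.Gamma0 Defs.Gamma1 Defs.ell Defs.ip Defs.Lambda.

Lemma A0_CRep f h : A0 f h -> D f -> exists z0,
  CRep f z0 0 (fun x => h x + s * f x) /\ CY1 0 (fun x => h x + s * f x) = 0.
Proof.
move=> [Hf Hh [f0 [D0 /Gamma1_eq0 G1 e0 l0]]] Df.
have [z0 [y0 R0]] := Dmax_CRep halpha hbeta D0 Hh l0.
have fE := D_eq_in Df D0 (eqH_sym e0).
have : CRep f z0 y0 (fun x => h x + s * f0 x) := CRep_eq fE R0.
have kE x : -1 < x < 1 -> h x + s * f0 x = h x + s * f x by move=> xI; rewrite fE.
move=> /(CRep_eq_in kE) Rf; exists z0.
have a0 : alpha != 0 by case/andP: halpha => a0 _; rewrite gt_eqF.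
have b0 : beta != 0 by case/andP: hbeta => b0 _; rewrite gt_eqF.
have G : Gamma1 f = 0.
  by rewrite (CRep_Gamma1 halpha hbeta Rf) -(CY1_eq_in _ kE) -(CRep_Gamma1 halpha hbeta R0).
rewrite (CRep_Gamma1 halpha hbeta Rf) in G.
have E0 := congr1 (fun c : 'cV[R[i]]_2 => c 0 0) G; have E1 := congr1 (fun c : 'cV[R[i]]_2 => c 1 0) G.
have K (r : R) (z : R[i]) : r != 0 -> (r^-1)%:C * z = 0 -> z = 0.
  by move=> r0 /eqP; rewrite mulf_eq0 => /predU1P[/eqP|/eqP//]; rewrite eq_complex /= invr_eq0 (negbTE r0).
move: E0 E1; rewrite !mxE /= => /eqP; rewrite oppr_eq0 => /eqP/K y00 /K Y00.
have y0E : y0 = 0 by apply: y00; rewrite mulf_neq0 ?pnatr_eq0.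
by rewrite y0E in Rf Y00; split => //; apply: Y00; rewrite mulf_neq0 ?pnatr_eq0.
Qed.

Lemma CRep_A0 f z0 k : CRep f z0 0 k -> CY1 0 k = 0 -> A0 f (fun x => k x + (- s) * f x).
Proof.
move=> Rf Y0; have [Hf Hh _] := CRep_graph halpha hbeta Rf; split => //.
exists f; split => //; [exact: (CRep_Dmax halpha hbeta Rf)| |exact: eqH_refl|].
  apply/Gamma1_eq0; rewrite (CRep_Gamma1 halpha hbeta Rf) Y0 !mulr0 oppr0.
  by apply/colP => i; rewrite !mxE; case: ifP.
exact: eqH_sym (CRep_eqH halpha hbeta Rf).
Qed.

Lemma D_of_A0 f z0 k : CRep f z0 0 k -> CY1 0 k = 0 ->
  exists2 f0, D f0 & forall x, -1 < x < 1 -> f x = f0 x.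
Proof.
move=> Rf Y0; case: ht => _ sub _ _.
have [|_ [f0 D0 e]] := sub f; first by exists (fun x => k x + (- s) * f x); exact: CRep_A0 Rf Y0.
by exists f0 => //; apply: D_eq_in => //; exact: (CRep_Dmax halpha hbeta Rf).
Qed.

Definition Yen k : R := \int[mu]_(x in I) (rr x * Yf 0 (Re \o k) x ^+ 2)
  + \int[mu]_(x in I) (rr x * Yf 0 (Im \o k) x ^+ 2).

(** The boundary term of the energy identity is a product with Gamma1 f, which is 0 here; the shift
    by alpha + beta accounts for the last term. *)
Lemma form_energy f z0 k : D f -> CRep f z0 0 k -> CY1 0 k = 0 ->
  Re (t f f) = Yen k - (alpha + beta) * sqnormH f.
Proof.
move=> Df Rf Y0; have Hf := DH Df; have Hk := CRep_inHk Rf.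
rewrite (tA0 (CRep_A0 Rf Y0) Df Df) (ipDl _ Hk Hf Hf) (ip_self Hf).
rewrite (CRep_energy halpha hbeta Rf Rf) {1}(CRep_Gamma1 halpha hbeta Rf) Y0 !mulr0 oppr0.
rewrite (_ : col2 0 0 = 0) ?dot20l; last by apply/colP => i; rewrite !mxE; case: ifP.
have -> (c : R[i]) (a b : R) : Re (0 + c + - a%:C * b%:C) = Re c - a * b by rewrite !cE; ring.
by congr (_ + _ - _); apply: Int_eq => x _; rewrite expr2 mulrA.
Qed.

Lemma form_energyB f1 z1 k1 f2 z2 k2 : D f1 -> D f2 -> CRep f1 z1 0 k1 -> CRep f2 z2 0 k2 ->
  CY1 0 k1 = 0 -> CY1 0 k2 = 0 ->
  Re (t (f1 \- f2) (f1 \- f2)) =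
    \int[mu]_(x in I) (rr x * (Yf 0 (Re \o k1) x - Yf 0 (Re \o k2) x) ^+ 2)
  + \int[mu]_(x in I) (rr x * (Yf 0 (Im \o k1) x - Yf 0 (Im \o k2) x) ^+ 2)
  - (alpha + beta) * sqnormH (f1 \- f2).
Proof.
move=> D1 D2 R1 R2 Y1 Y2.
have [r1 i1] := CRep_L1 halpha hbeta R1; have [r2 i2] := CRep_L1 halpha hbeta R2.
have subE : f1 \- f2 = fun x => f1 x + (-1) * f2 x by apply/funext => x; rewrite mulN1r.
have R12 := CRep_lin halpha hbeta (-1) R1 R2; rewrite mulr0 addr0 in R12.
have D12 := Dlin (-1) D1 D2; rewrite !subE.
rewrite (form_energy D12 R12); last first.
  have := CY1_lin 0 0 (-1) r1 i1 r2 i2.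
  by rewrite Y1 Y2 !mulr0 !addr0.
have E (p : R[i] -> R) : p 0 = 0 -> (forall a b, p (a + (-1) * b) = p a + (-1) * p b) ->
    L1 I (p \o k1) -> L1 I (p \o k2) -> forall x,
    Yf 0 (p \o (fun x => k1 x + (-1) * k2 x)) x = Yf 0 (p \o k1) x - Yf 0 (p \o k2) x.
  move=> p0 pl L1 L2 x; rewrite -[X in Yf X _ _](addr0 0) -[X in Yf (_ + X) _ _](mulr0 (-1)).
  rewrite (_ : p \o _ = fun x => (p \o k1) x + (-1) * (p \o k2) x); last first.
    by apply/funext => y; rewrite /comp pl.
  by rewrite Yf_lin// mulN1r.
by rewrite /Yen; congr (_ + _ - _); apply: Int_eq => x _; rewrite E// => a b; rewrite !cE; ring.
Qed.

(** For sg = 1 or -1 this is 1 at the endpoint sg and 0 at the other. *)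
Let ramp (sg x : R) := (1 + sg * x) / 2.

Lemma inHB f g : inH f -> inH g -> inH (f \- g).
Proof.
move=> Hf Hg; rewrite (_ : f \- g = fun x => f x + (-1) * g x); first exact: inH_lin.
by apply/funext => x; rewrite mulN1r.
Qed.

Lemma sqnormH_eqH f g : inH f -> inH g -> eqH f g -> sqnormH f = sqnormH g.
Proof. by move=> Hf Hg e; rewrite /Defs.sqnormH (eqH_ip Hf Hg Hf e) (eqH_ipr Hf Hg Hg e). Qed.

Lemma sqnormH_dist f g k : inH f -> inH g -> inH k ->
  sqnormH (f \- g) <= 2 * sqnormH (f \- k) + 2 * sqnormH (g \- k).
Proof.
move=> Hf Hg Hk; have := @herm_parallelogram R inH ip (fun f g c => @inH_lin _ _ _ f g c)
  (fun f g k c => @ipDl _ _ _ f g k c) (fun f g Hf Hg => ipC Hf Hg) (fun f => @sqnormH_ge0 _ _ _ f)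
  _ _ (inHB Hf Hk) (inHB Hg Hk).
rewrite (_ : (fun x => _ + _) = f \- g)//.
by apply/funext => x /=; ring.
Qed.

Lemma sqnormHE f : inH f -> sqnormH f =
  \int[mu]_(x in I) (Re (f x) * Re (f x) * w x) + \int[mu]_(x in I) (Im (f x) * Im (f x) * w x).
Proof. by move=> Hf; rewrite /Defs.sqnormH ipE// ReP. Qed.

Lemma sqnormH_real (v1 v2 : R -> R) : L2w alpha beta v1 -> L2w alpha beta v2 ->
  sqnormH ((fun x => (v1 x)%:C) \- (fun x => (v2 x)%:C)) =
  \int[mu]_(x in I) ((v1 x - v2 x) ^+ 2 * w x).
Proof.
move=> L1v L2v; have L0 := L2w0 alpha beta.
have H1 : inH (fun x => (v1 x)%:C) by apply/inHP.
have H2 : inH (fun x => (v2 x)%:C) by apply/inHP.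
rewrite (sqnormHE (inHB H1 H2)) [X in _ + X](_ : _ = 0) ?addr0.
  by apply: Int_eq => x _; rewrite /= expr2.
by rewrite (Int_eq (g := fun=> 0)) ?Rintegral_cst ?mul0r// => x _ /=; rewrite subr0 !mul0r.
Qed.

(* The solution with y = (1 + sg x) / 2 is not in dom A0, but y is the limit in L^2(rr) of
   y - y^(n+1), which vanishes at both endpoints. *)
Section Ramp.
Variable sg : R.
Hypothesis sg_cases : sg = 1 \/ sg = -1.

Let sT x : R := ramp sg x.
Let yn n x : R := sT x - sT x ^+ n.+1.
Let kn n x : R := sg / 2 - n.+1%:R * (sg / 2) * sT x ^+ n.
Let zf x := Zf 0 (ramp sg (-1)) (fun=> sg / 2) x.
Let zn n x := Zf 0 0 (kn n) x.
Let en n := \int[mu]_(x in I) (rr x * sT x ^+ n.+1).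

Let sT_in x : -1 < x < 1 -> 0 < sT x < 1.
Proof. by move=> /andP[a b]; rewrite /sT /ramp; case: sg_cases => ->; apply/andP; split; lra. Qed.

Let dsT x : is_der x sT (sg / 2).
Proof.
have := derM (derD (der_cst 1 x) (derZ sg (der_id x))) (der_cst 2^-1 x).
by move/der_val; apply; ring.
Qed.

Let dsTn n x : is_der x (fun x => sT x ^+ n.+1) (n.+1%:R * (sg / 2) * sT x ^+ n).
Proof.
elim: n => [|n IH]; first by apply: der_val (dsT x) _; rewrite expr0; ring.
rewrite (_ : (fun x => sT x ^+ n.+2) = fun x => sT x * sT x ^+ n.+1); last first.
  by apply/funext => y; rewrite exprS.
by apply: der_val (derM (dsT x) IH) _; rewrite exprS -[in RHS]natr1; ring.
Qed.

Let dyn n x : is_der x (yn n) (kn n x).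
Proof. exact: derB (dsT x) (dsTn n x). Qed.

Let csTn n : continuous (fun x => sT x ^+ n).
Proof.
case: n => [|n] x; last exact: der_continuous (dsTn n x).
by rewrite (_ : (fun x => sT x ^+ 0) = fun=> 1)//; exact: cvg_cst.
Qed.

Let ckn n : continuous (kn n).
Proof.
move=> x; apply: cvgB; first exact: cvg_cst.
by apply: cvgM; [exact: cvg_cst|exact: csTn].
Qed.

Let end_val (x : R) : x = -1 \/ x = 1 -> sT x = 0 \/ sT x = 1.
Proof.
by rewrite /sT /ramp => -[] ->; case: sg_cases => ->; [left|right|right|left]; lra.
Qed.

Let yn_end n (x : R) : x = -1 \/ x = 1 -> yn n x = 0.
Proof.
by move/end_val; rewrite /yn => -[] ->; rewrite ?expr0n ?expr1n ?subrr ?subr0.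
Qed.

Let YnE n x : -1 <= x <= 1 -> Yf 0 (kn n) x = yn n x.
Proof.
move=> xI; rewrite (Yf_primitive _ (dyn n) (@ckn n) xI) (@yn_end n (-1)) ?subr0 ?add0r//.
by left.
Qed.

Let YE x : -1 <= x <= 1 -> Yf (ramp sg (-1)) (fun=> sg / 2) x = sT x.
Proof.
move=> xI; rewrite (Yf_primitive _ dsT _ xI); last by move=> y; exact: cvg_cst.
by rewrite addrC subrK.
Qed.

Let L1_sTn n : L1 I (fun x => rr x * sT x ^+ n).
Proof.
apply: (@L1_le _ _ rr) => //; last exact: (L1_rr halpha hbeta).
- apply: measurable_funM; first exact: L1_meas (L1_rr halpha hbeta).
  by apply: continuous_meas_oo => x _; exact: csTn.
- move=> x /inIP xI; have r0 := rr_gt0 alpha beta xI; have /andP[s0 s1] := sT_in xI.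
  by rewrite normrM (gtr0_norm r0) normrX (gtr0_norm s0) ger_pMr// exprn_ile1// ltW.
Qed.

Let en0 : en n @[n --> \oo] --> 0.
Proof.
have -> : 0 = \int[mu]_(x in I) (0 : R) by rewrite Rintegral_cst// mul0r.
apply: (@Int_dominated _ _ _ _ rr) => //; last first.
- move=> n x /inIP xI; have r0 := rr_gt0 alpha beta xI; have /andP[s0 s1] := sT_in xI.
  by rewrite normrM (gtr0_norm r0) normrX (gtr0_norm s0) ger_pMr// exprn_ile1// ltW.
- exact: (L1_rr halpha hbeta).
- apply: aeW => x /inIP xI; have /andP[s0 s1] := sT_in xI.
  rewrite [X in _ --> X](_ : 0 = rr x * sT x * 0); last by rewrite mulr0.
  under eq_fun do rewrite exprS mulrA.
  apply: cvgM; [exact: cvg_cst|apply: cvg_expr].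
  by rewrite gtr0_norm.
- by move=> n; exact: L1_meas (L1_sTn n.+1).
Qed.

Let znB n x : `|zn n x - zf x| <= en n.
Proof.
have csg : continuous (fun _ : R => sg / 2 : R) by move=> y; exact: cvg_cst.
apply: le_trans (Zf_dist halpha hbeta 0 0 (ramp sg (-1)) x (L1_C0 (dyn n) (@ckn n)) (L1_C0 dsT csg)) _.
rewrite le_eqVlt; apply/orP; left; apply/eqP.
apply: Int_eq => u /inIP uI; have r0 := rr_gt0 alpha beta uI; have /andP[s0 _] := sT_in uI.
have uI' : -1 <= u <= 1 by case/andP: uI => a b; rewrite !ltW.
rewrite -mulrBr YE// YnE// /yn addrC addKr normrM (gtr0_norm r0) normrN.
by rewrite ger0_norm// exprn_ge0// ltW.
Qed.

Let Lk : L2w alpha beta (fun=> sg / 2).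
Proof. by apply: (L2w_C0 halpha hbeta) => x; exact: cvg_cst. Qed.

Let vn n x := phi x * zn n x.
Let vf x := phi x * zf x.

Let Rvn n : Rep alpha beta (vn n) 0 0 (kn n).
Proof. by apply: Rep_make; exact: (L2w_C0 halpha hbeta (@ckn n)). Qed.
Let Rvf : Rep alpha beta vf 0 (ramp sg (-1)) (fun=> sg / 2). Proof. exact: Rep_make. Qed.

Let Cvn n : CRep (fun x => (vn n x)%:C) 0 0 (fun x => (kn n x)%:C).
Proof. by split; [exact: Rvn|exact: Rep0]. Qed.

Let Cvf : CRep (fun x => (vf x)%:C) 0 (ramp sg (-1))%:C (fun=> (sg / 2)%:C).
Proof. by split; [exact: Rvf|exact: Rep0]. Qed.

Let Yn1 n : CY1 0 (fun x => (kn n x)%:C) = 0.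
Proof.
apply: cext; [|exact: Yf00].
have N11 : -1 <= (1 : R) <= 1 by apply/andP; split; lra.
by have := YnE n N11; rewrite yn_end//; right.
Qed.

Let vnB n : sqnormH ((fun x => (vn n x)%:C) \- (fun x => (vf x)%:C))
  <= en n ^+ 2 * \int[mu]_(x in I) phi x.
Proof.
have Ip := L1_phi halpha hbeta.
have L1' := Rep_L2w halpha hbeta (Rvn n); have L2' := Rep_L2w halpha hbeta Rvf.
rewrite sqnormH_real// -IntZ//; apply: Int_le => // [||x /inIP xI].
- have [_] := L2w_lin (-1) L1' L2'; apply: L1_eq => // x _; by rewrite mulN1r.
- exact: L1Z.
have p0 := phi_gt0 alpha beta xI; have w0 := w_gt0 alpha beta xI.
rewrite /vn /vf -mulrBr (_ : (phi x * _) ^+ 2 * w x = (zn n x - zf x) ^+ 2 * phi x); last first.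
  by rewrite /phi; move: (w x) w0 (zn n x - zf x) => W W0 d; field; rewrite gt_eqF.
apply: ler_wpM2r; first exact: ltW.
rewrite -(real_normK (num_real (zn n x - zf x))).
by apply: lerXn2r (znB n x); rewrite nnegrE// (le_trans _ (znB n x)).
Qed.

(** The approximants converge in H and are Cauchy for the form, because (p - q)^2 <= p + q on [0, 1]
    bounds their energy distance by [en m + en n]. Closedness then places a representative of the
    limit in D. *)
Lemma D_ramp : exists f0, [/\ D f0, CRep f0 0 (ramp sg (-1))%:C (fun=> (sg / 2)%:C) &
  CY1 (ramp sg (-1))%:C (fun=> (sg / 2)%:C) = (ramp sg 1)%:C].
Proof.
have N11 : -1 <= (1 : R) <= 1 by apply/andP; split; lra.
have [|u Hu] := @choice _ _ (fun n (f : func) => D f /\ forall x, -1 < x < 1 -> (vn n x)%:C = f x) _.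
  by move=> n; have [f0 Df0 e] := D_of_A0 (Cvn n) (Yn1 n); exists f0.
have Ru n : CRep (u n) 0 0 (fun x => (kn n x)%:C) by apply: CRep_eq (Cvn n); have [] := Hu n.
have Du n : D (u n) by have [] := Hu n.
pose v : func := fun x => (vf x)%:C.
have Hv : inH v := CRep_inH halpha hbeta Cvf.
have K0 := ltW (Int_phi_gt0 halpha hbeta); set K := Rintegral _ _ _ in K0.
have uv n : sqnormH (u n \- v) <= en n ^+ 2 * K.
  apply: le_trans (vnB n); rewrite le_eqVlt; apply/orP; left; apply/eqP.
  have H1 : inH (u n \- v) by exact: (inHB (DH (Du n)) Hv).
  have H2 : inH ((fun x => (vn n x)%:C) \- v) by exact: (inHB (CRep_inH halpha hbeta (Cvn n)) Hv).
  apply: sqnormH_eqH => //; apply: aeW => x /inIP xI.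
  have [_ E] := Hu n; exact: (congr1 (fun y => y - v x) (esym (E x xI))).
have uv0 n : 0 <= sqnormH (u n \- v) by apply: sqnormH_ge0; exact: (inHB (DH (Du n)) Hv).
have e20 : en n ^+ 2 * K @[n --> \oo] --> 0.
  rewrite [X in _ --> X](_ : 0 = 0 * 0 * K); last by rewrite !mul0r.
  under eq_fun do rewrite expr2.
  by apply: cvgM; [apply: cvgM; exact: en0|exact: cvg_cst].
have uvc : sqnormH (u n \- v) @[n --> \oo] --> 0.
  by apply: cvg_of_bound e20 => n; rewrite subr0 ger0_norm.
case: ht => -[_ [_ [_ [_ [_ clos]]]]] _ _ _.
have [e e0|f0 [Df0 vf0 _]] := clos u v Du Hv uvc.
  have en_n := en0; have e20' := e20.
  pose sab := alpha + beta; have sab0 : 0 < sab.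
    by case/andP: halpha => a0 _; case/andP: hbeta => b0 _; exact: addr_gt0.
  have e4 : 0 < e / 4 by rewrite divr_gt0.
  (* The squared distance of u m and u n is at most twice the sum of their squared distances to v,
     so this tolerance keeps its product with alpha + beta below e / 2. *)
  have e8 : 0 < e / 4 / (2 * sab) by rewrite divr_gt0// mulr_gt0.
  have [N HN] : exists N : nat, forall n, (N <= n)%N -> en n < e / 4 /\ sqnormH (u n \- v) < e / 4 / (2 * sab).
    have /cvgr0Pnorm_lt/(_ _ e4) n1 := en0; have /cvgr0Pnorm_lt/(_ _ e8) n2 := uvc.
    have [N _ HN] : \forall n \near \oo, en n < e / 4 /\ sqnormH (u n \- v) < e / 4 / (2 * sab).
      near=> n; split; (apply: le_lt_trans (ler_norm _) _); by near: n.
    by exists N => n Nn; exact: HN.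
  exists N => m n Nm Nn; have [m1 m2] := HN m Nm; have [n1 n2] := HN n Nn.
  rewrite (form_energyB (Du m) (Du n) (Ru m) (Ru n) (Yn1 m) (Yn1 n)).
  have -> : \int[mu]_(x in I) (rr x * (Yf 0 (Im \o (fun x => (kn m x)%:C)) x
      - Yf 0 (Im \o (fun x => (kn n x)%:C)) x) ^+ 2) = 0.
    rewrite (Int_eq (g := fun=> 0)) ?Rintegral_cst ?mul0r// => x _.
    by rewrite subrr expr0n/= mulr0.
  rewrite addr0; set A := Rintegral _ _ _.
  have A0' : 0 <= A.
    by apply: Int_ge0 => x /inIP xI; rewrite mulr_ge0 ?sqr_ge0// ltW// rr_gt0.
  have A1 : A <= en m + en n.
    rewrite /en -IntD//; apply: Int_le => // [||x /inIP xI].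
    - have Ir := L1_rr halpha hbeta; have r_gt0 x : I x -> 0 < rr x by move=> /inIP; exact: rr_gt0.
      have IY2 i : L1 I (fun x => rr x * Yf 0 (kn i) x ^+ 2).
        by apply: L1_eq (L1_rYY halpha hbeta 0 0 (L1_C0 (dyn i) (@ckn i)) (L1_C0 (dyn i) (@ckn i))) => // x _;
          rewrite expr2 mulrA.
      have mY i : measurable_fun I (Yf 0 (kn i)).
        by apply: continuous_meas_oo => x _; apply: Yf_cont; exact: L1_C0 (dyn i) (@ckn i).
      by apply: L1_eq (L2D mI Ir r_gt0 (-1) (mY m) (mY n) (IY2 m) (IY2 n)) => // x _; rewrite mulN1r.
    - exact: L1D.
    have xI' : -1 <= x <= 1 by case/andP: xI => a b; rewrite !ltW.
    have r0 := rr_gt0 alpha beta xI; have /andP[s0 s1] := sT_in xI.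
    rewrite -mulrDr; apply: ler_wpM2l; first exact: ltW.
    rewrite [Yf 0 (Re \o _) x](YnE m xI') [Yf 0 (Re \o _) x](YnE n xI') /yn.
    have pm : 0 <= sT x ^+ m.+1 <= 1 by rewrite exprn_ge0 ?exprn_ile1 ?ltW.
    have pn : 0 <= sT x ^+ n.+1 <= 1 by rewrite exprn_ge0 ?exprn_ile1 ?ltW.
    move: pm pn; move: (sT x) (sT x ^+ n.+1) (sT x ^+ m.+1) => r q p /andP[p0 p1] /andP[q0 q1].
    rewrite (_ : r - p - (r - q) = q - p); last by ring.
    by rewrite expr2; nra.
  have Hmn : inH (u m \- u n) by exact: (inHB (DH (Du m)) (DH (Du n))).
  have B0 := sqnormH_ge0 Hmn.
  have B1 : sqnormH (u m \- u n) <= 2 * sqnormH (u m \- v) + 2 * sqnormH (u n \- v).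
    exact: sqnormH_dist (DH (Du m)) (DH (Du n)) Hv.
  have B2 : sab * sqnormH (u m \- u n) < e / 2.
    rewrite -ltr_pdivlMl// mulrC; apply: le_lt_trans B1 _.
    move: m2 n2; rewrite (_ : e / 4 / (2 * sab) = e / 2 / sab / 4); last by field; rewrite gt_eqF.
    by move: (e / 2 / sab) (sqnormH _) (sqnormH _) => p q r; lra.
  have B3 : 0 <= sab * sqnormH (u m \- u n) by rewrite mulr_ge0// ltW.
  rewrite -/sab; move: B2 B3 A1 A0' m1 n1; move: A (sab * _) (en m) (en n) => p q r r'.
  by move=> *; rewrite ltr_norml; apply/andP; split; lra.
exists f0; split; first exact: Df0.
  by apply: CRep_eq Cvf; apply: D_eq_in => //; exact: (CRep_Dmax halpha hbeta Cvf).
by apply: cext; [exact: YE|exact: Yf00].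
Unshelve. all: by end_near. Qed.

End Ramp.

(** Subtracting suitable multiples of the two ramps makes y vanish at both endpoints, which leaves
    an element of dom A0; both the ramps and that element have representatives in D. *)
Lemma D_CRep f z0 y0 k : CRep f z0 y0 k -> exists2 f0, D f0 & forall x, -1 < x < 1 -> f x = f0 x.
Proof.
move=> Rf; have [E1 [D1 R1 Y1]] := D_ramp (or_introl (erefl 1)).
have [E2 [D2 R2 Y2]] := D_ramp (or_intror (erefl (-1))).
have r1 : ramp 1 (-1) = 0 by rewrite /ramp; field.
have r2 : ramp (-1) (-1) = 1 by rewrite /ramp; field.
have r3 : ramp 1 1 = 1 by rewrite /ramp; field.
have r4 : ramp (-1) 1 = 0 by rewrite /ramp; field.
rewrite r1 r3 in R1 Y1; rewrite r2 r4 in R2 Y2.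
set c := CY1 y0 k.
have R12 := CRep_lin halpha hbeta (- y0) (CRep_lin halpha hbeta (- c) Rf R1) R2.
have [a1 b1] := CRep_L1 halpha hbeta Rf; have [a2 b2] := CRep_L1 halpha hbeta R1.
have [a3 b3] := CRep_L1 halpha hbeta R2.
have [a4 b4] := CRep_L1 halpha hbeta (CRep_lin halpha hbeta (- c) Rf R1).
have Y0 := CY1_lin (y0 + - c * 0) 1 (- y0) a4 b4 a3 b3.
rewrite (CY1_lin y0 0 (- c) a1 b1 a2 b2) Y1 Y2 -/c mulr0 addr0 mulr1 subrr in Y0.
have y00 : y0 + - c * (0 : R)%:C + - y0 * (1 : R)%:C = 0 by rewrite mulr0 addr0 mulr1 subrr.
rewrite y00 in R12; rewrite mulr0 addr0 mulr1 subrr in Y0.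
have [f' D' fE] := D_of_A0 R12 Y0.
exists (fun x => (f' x + c * E1 x) + y0 * E2 x); first by apply: Dlin => //; exact: Dlin.
by move=> x xI; rewrite -fE//; ring.
Qed.

Lemma A0_graph f h : A0 f h -> D f -> boundary_graph alpha beta f h (Gamma0 f) 0.
Proof.
move=> Afh Df; have [z0 [Rf Y0]] := A0_CRep Afh Df.
have := CRep_graph halpha hbeta Rf.
have -> : Gamma1 f = 0.
  by rewrite (CRep_Gamma1 halpha hbeta Rf) Y0 !mulr0 oppr0; apply/colP => i; rewrite !mxE; case: ifP.
have [Hf Hh _] := Afh.
move/graph_eqH; apply => //; first exact: eqH_refl.
by apply: aeW => x _; ring.
Qed.

(** The parallelogram inequality makes y of the approximants Cauchy in L^2(r); [energy_limit] and
    [Lambda_trace] then identify the limit of their Gamma0 with Lambda g. *)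
Lemma form_approx g : D g -> exists (u h : nat -> func),
  [/\ forall n, D (u n) /\ A0 (u n) (h n),
      sqnormH (u n \- g) @[n --> \oo] --> 0,
      Re (t (u n \- g) (u n \- g)) @[n --> \oo] --> 0 &
      forall i, ccvg (fun n => Gamma0 (u n) i 0) (Lambda g i 0)].
Proof.
move=> Dg; case: ht => -[_ [_ [_ [_ [[m Hm] _]]]]] _ _ core.
have [u [Hu ug tg]] := core g Dg.
have Du n : D (u n) by have [] := Hu n.
have [|h Hh] := @choice _ _ (fun n (k : func) => A0 (u n) k) _.
  by move=> n; have [_ []] := Hu n => k; exists k.
have [|z Hz] := @choice _ _ (fun n z0 => CRep (u n) z0 0 (fun x => h n x + s * u n x) /\
  CY1 0 (fun x => h n x + s * u n x) = 0) _.
  by move=> n; exact: A0_CRep.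
pose k n x := h n x + s * u n x.
have Ru n : CRep (u n) (z n) 0 (k n) by have [] := Hz n.
have Y0 n : CY1 0 (k n) = 0 by have [] := Hz n.
exists u, h; split => //.
have Hug n : inH (u n \- g) by exact: (inHB (DH (Du n)) (DH Dg)).
have dE f1 f2 : f1 \- f2 = fun x : R => f1 x + (-1) * f2 x by apply/funext => x; rewrite mulN1r.
(* Subtracting the lower bound m makes the form nonnegative. *)
pose B f1 f2 := t f1 f2 + (- m)%:C * ip f1 f2.
have Bl f1 f2 f3 c : D f1 -> D f2 -> D f3 -> B (fun x => f1 x + c * f2 x) f3 = B f1 f3 + c * B f2 f3.
  by move=> d1 d2 d3; rewrite /B tl// ipDl; [ring|exact: DH..].
have Bh f1 f2 : D f1 -> D f2 -> B f2 f1 = (B f1 f2)^*.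
  move=> d1 d2; rewrite /B (th d1 d2) (ipC (DH d1) (DH d2)).
  by move: (t _ _) (ip _ _) => p q; apply: cext; rewrite !cE; ring.
have BE f1 : D f1 -> Re (B f1 f1) = Re (t f1 f1) - m * sqnormH f1.
  by move=> d1; rewrite /B (ip_self (DH d1)) !cE; ring.
have Bpos f1 : D f1 -> 0 <= Re (B f1 f1) by move=> d1; rewrite BE// subr_ge0 Hm.
pose sab := alpha + beta.
(* The energy of a difference is its B-norm plus m + alpha + beta times its squared norm in H; the
   absolute value covers both signs of that factor. *)
pose a n := 2 * (Re (t (u n \- g) (u n \- g)) - m * sqnormH (u n \- g))
  + `|m + sab| * (2 * sqnormH (u n \- g)).
have a0 : a n @[n --> \oo] --> 0.
  rewrite [X in _ --> X](_ : 0 = 2 * (0 - m * 0) + `|m + sab| * (2 * 0)); last by ring.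
  apply: cvgD; apply: cvgM; try exact: cvg_cst.
    by apply: cvgB => //; apply: cvgM => //; exact: cvg_cst.
  by apply: cvgM => //; exact: cvg_cst.
pose Er i j := \int[mu]_(x in I) (rr x * (Yf 0 (Re \o k i) x - Yf 0 (Re \o k j) x) ^+ 2).
pose Ei i j := \int[mu]_(x in I) (rr x * (Yf 0 (Im \o k i) x - Yf 0 (Im \o k j) x) ^+ 2).
have Er0 i j : 0 <= Er i j.
  by apply: Int_ge0 => x /inIP xI; rewrite mulr_ge0 ?sqr_ge0// ltW// rr_gt0.
have Ei0 i j : 0 <= Ei i j.
  by apply: Int_ge0 => x /inIP xI; rewrite mulr_ge0 ?sqr_ge0// ltW// rr_gt0.
have Eb i j : Er i j + Ei i j <= a i + a j.
  have En := form_energyB (Du i) (Du j) (Ru i) (Ru j) (Y0 i) (Y0 j).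
  have Dij : D (u i \- u j) by rewrite dE; exact: Dlin.
  have Dig : D (u i \- g) by rewrite dE; exact: Dlin.
  have Djg : D (u j \- g) by rewrite dE; exact: Dlin.
  have par := herm_parallelogram Dlin Bl Bh Bpos Dig Djg.
  rewrite (_ : (fun x => _ + _) = u i \- u j) in par; last by apply/funext => x /=; ring.
  rewrite !BE// in par.
  have S0 := sqnormH_ge0 (DH Dij); have S1 := sqnormH_dist (DH (Du i)) (DH (Du j)) (DH Dg).
  have S2 := ler_wpM2l (normr_ge0 (m + sab)) S1.
  have S3 := ler_wpM2r S0 (ler_norm (m + sab)).
  rewrite -/(Er i j) -/(Ei i j) -/sab in En; rewrite /a.
  move: En par S2 S3; move: (Re (t (u i \- u j) _)) (Re (t (u i \- g) _)) (Re (t (u j \- g) _)).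
  move: (sqnormH _) (sqnormH _) (sqnormH _) (Er i j) (Ei i j) `|m + sab| => s1 s2 s3 e1 e2 M t1 t2 t3.
  by move=> -> par S2 S3; lra.
have EC (E : nat -> nat -> R) : (forall i j, E i j <= a i + a j) -> forall e, 0 < e ->
    exists N : nat, forall i j : nat, (N <= i)%N -> (N <= j)%N -> E i j < e.
  move=> Ea e e0; have e2 : 0 < e / 2 by rewrite divr_gt0.
  have /cvgr0Pnorm_lt/(_ _ e2)[N _ HN] := a0.
  exists N => i j Ni Nj; apply: le_lt_trans (Ea i j) _; rewrite [ltRHS](splitr e).
  by apply: ltrD; [exact: le_lt_trans (ler_norm _) (HN i Ni)|exact: le_lt_trans (ler_norm _) (HN j Nj)].
have [/inHP[gr gi] cg] := (DH Dg, fun x (xI : -1 < x < 1) => D_continuous Dg xI).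
have sqE n := sqnormHE (Hug n).
have comp_cvg (p : R[i] -> R) : (forall n, \int[mu]_(x in I) ((p (u n x) - p (g x)) ^+ 2 * w x) <= sqnormH (u n \- g)) ->
    \int[mu]_(x in I) ((p (u n x) - p (g x)) ^+ 2 * w x) @[n --> \oo] --> 0.
  move=> pb; apply: cvg_of_bound ug => n; rewrite subr0 ger0_norm//.
  by apply: Int_ge0 => x /inIP xI; rewrite mulr_ge0 ?sqr_ge0// ltW// w_gt0.
have sqpos (q : R -> R) : 0 <= \int[mu]_(x in I) (q x * q x * w x).
  by apply: Int_ge0 => x /inIP xI; rewrite -expr2 mulr_ge0 ?sqr_ge0// ltW// w_gt0.
have br n : \int[mu]_(x in I) ((Re (u n x) - Re (g x)) ^+ 2 * w x) <= sqnormH (u n \- g).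
  rewrite sqE; apply: ler_wpDr; first exact: sqpos.
  by rewrite le_eqVlt; apply/orP; left; apply/eqP; apply: Int_eq => x _; rewrite /= !cE expr2.
have bi n : \int[mu]_(x in I) ((Im (u n x) - Im (g x)) ^+ 2 * w x) <= sqnormH (u n \- g).
  rewrite sqE; apply: ler_wpDl; first exact: sqpos.
  by rewrite le_eqVlt; apply/orP; left; apply/eqP; apply: Int_eq => x _; rewrite /= !cE expr2.
have Erb i j : Er i j <= a i + a j.
  by apply: (@le_trans _ _ (Er i j + Ei i j)); [rewrite lerDl; exact: Ei0|exact: Eb].
have Eib i j : Ei i j <= a i + a j.
  by apply: (@le_trans _ _ (Er i j + Ei i j)); [rewrite lerDr; exact: Er0|exact: Eb].
have [eta1 [c1 [m1 I1 g1 z1 Z1]]] := energy_limit halpha hbeta (fun n => (Ru n).1) gr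
  (fun x xI => (cg x xI).1) (comp_cvg Re br) (EC Er Erb).
have [eta2 [c2 [m2 I2 g2 z2 Z2]]] := energy_limit halpha hbeta (fun n => (Ru n).2) gi
  (fun x xI => (cg x xI).2) (comp_cvg Im bi) (EC Ei Eib).
rewrite (Lambda_trace halpha hbeta m1 m2 I1 I2 g1 g2).
have G0 n := CRep_Gamma0 halpha hbeta (Ru n).
move=> i; under eq_fun do rewrite G0.
rewrite mxE; under eq_fun do rewrite mxE.
by case: ifP => _; apply: ccvgZ; split.
Qed.

Lemma form_Dmax f z0 y0 k g : D f -> CRep f z0 y0 k -> D g ->
  t f g = ip (fun x => k x + (- s) * f x) g - dot2 (Gamma1 f) (Lambda g).
Proof.
move=> Df Rf Dg; have [u [h [Hu ug tg Gc]]] := form_approx Dg.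
have Bf := CRep_graph halpha hbeta Rf; have [Hf Hk _] := Bf.
set h0 := (fun x => _) in Bf Hk *.
(* On dom A0 the form is the conjugate of <A0 (u n), f>, and Green's identity with Gamma1 (u n) = 0
   moves the operator over to f. *)
have tE n : t f (u n) = ip h0 (u n) + (-1) * dot2 (Gamma1 f) (Gamma0 (u n)).
  have [Du Au] := Hu n; have Gr := graph_Green halpha hbeta Bf (A0_graph Au Du).
  have [_ Hh _] := Au.
  rewrite dot20r subr0 in Gr; rewrite -Gr (th Du Df) (tA0 Au Du Df) -(ipC Hh (DH Df)).
  ring.
have dE f1 f2 : f1 \- f2 = fun x : R => f1 x + (-1) * f2 x by apply/funext => x; rewrite mulN1r.
have Hug n : inH (u n \- g) by have [Du _] := Hu n; exact: (inHB (DH Du) (DH Dg)).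
have Dug n : D (u n \- g) by have [Du _] := Hu n; rewrite dE; exact: Dlin.
(* Applied to the inner product and to the form shifted by m. Adding m times the former to the
   latter gives convergence for t, which itself may fail to be nonnegative. *)
have herm_cvg (P : set func) (B : func -> func -> R[i])
    (Plin : forall f g (c : R[i]), P f -> P g -> P (fun x => f x + c * g x))
    (Bl : forall f g k (c : R[i]), P f -> P g -> P k ->
       B (fun x => f x + c * g x) k = B f k + c * B g k)
    (Bh : forall f g, P f -> P g -> B g f = (B f g)^*)
    (Bpos : forall f, P f -> 0 <= Re (B f f)) F :
    P F -> P g -> (forall n, P (u n)) -> Re (B (u n \- g) (u n \- g)) @[n --> \oo] --> 0 ->
    ccvg (fun n => B F (u n)) (B F g).
  move=> PF Pg Pu B0.
  have P0 n : P (u n \- g) by rewrite dE; exact: Plin.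
  have E n : B F (u n) - B F g = B F (u n \- g).
    by rewrite dE (herm_linr Plin Bl Bh) ?rmorphN1 ?mulN1r.
  split; apply/cvgrPdist_lt => e e0; have [dl dl0 H] := herm_small Plin Bl Bh Bpos PF e0;
    move/cvgr0Pnorm_lt: B0 => /(_ _ dl0); apply: filterS => n bn;
    have [h1 h2] := H _ (P0 n) (le_lt_trans (ler_norm _) bn);
    rewrite distrC -?ReN -?ImN -?ReD -?ImD E.
    exact: h1.
  exact: h2.
have ip_cvg F : inH F -> ccvg (fun n => ip F (u n)) (ip F g).
  move=> HF; apply: (herm_cvg inH ip) => //.
  - by move=> *; exact: inH_lin.
  - by move=> *; exact: ipDl.
  - by move=> *; exact: ipC.
  - by move=> *; exact: sqnormH_ge0.
  - exact: DH.
  - by move=> n; have [Du _] := Hu n; exact: DH.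
case: ht => -[_ [_ [_ [_ [[m Hm] _]]]]] _ _ _.
pose B f1 f2 := t f1 f2 + (- m)%:C * ip f1 f2.
have BE f1 : D f1 -> Re (B f1 f1) = Re (t f1 f1) - m * sqnormH f1.
  by move=> d1; rewrite /B (ip_self (DH d1)) !cE; ring.
have B_cvg : ccvg (fun n => B f (u n)) (B f g).
  apply: (herm_cvg D B) => //.
  - by move=> f1 f2 f3 c d1 d2 d3; rewrite /B tl// ipDl; [ring|exact: DH..].
  - move=> f1 f2 d1 d2; rewrite /B (th d1 d2) (ipC (DH d1) (DH d2)).
    by move: (t _ _) (ip _ _) => p q; apply: cext; rewrite !cE; ring.
  - by move=> f1 d1; rewrite BE// subr_ge0 Hm.
  - by move=> n; have [Du _] := Hu n.
  have lim : Re (t (u n \- g) (u n \- g)) - m * sqnormH (u n \- g) @[n --> \oo] --> 0 - m * 0.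
    by apply: cvgB => //; apply: cvgM => //; exact: cvg_cst.
  rewrite mulr0 subr0 in lim; apply: cvg_trans lim; apply: near_eq_cvg; apply: nearW => n.
  by rewrite BE.
have t_cvg : ccvg (fun n => t f (u n)) (t f g).
  have := ccvg_lin m%:C B_cvg (ip_cvg f Hf).
  rewrite (_ : B f g + _ = t f g); last first.
    by rewrite /B; move: (t _ _) (ip _ _) => p q; apply: cext; rewrite !cE; ring.
  by apply: ccvg_eq => n; rewrite /B; move: (t _ _) (ip _ _) => p q; apply: cext; rewrite !cE; ring.
apply: ccvg_unique t_cvg _; rewrite -mulN1r.
apply: ccvg_eq (fun n => esym (tE n)) _; apply: ccvg_lin; first exact: ip_cvg.
rewrite /dot2 big_ord_recl big_ord1.
set v := Gamma1 f; set v0 := v _ _; set v1 := v _ _.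
rewrite [X in ccvg _ X](_ : _ = 0 + v0 * (Lambda g ord0 0)^* + v1 * (Lambda g (lift ord0 ord0) 0)^*); last first.
  by rewrite add0r.
apply: (@ccvg_eq _ (fun n => 0 + v0 * (Gamma0 (u n) ord0 0)^* + v1 * (Gamma0 (u n) (lift ord0 ord0) 0)^*)).
  by move=> n; rewrite big_ord_recl big_ord1 add0r.
by apply: ccvg_lin (ccvg_conj (Gc _)); apply: ccvg_lin (ccvg_conj (Gc _)); exact: ccvg_cst.
Qed.

Let tThetaE Theta f g : tTheta alpha beta t Theta f g =
  t f g + dot2 (op_apply Theta (Lambda f)) (Lambda g).
Proof. by rewrite /tTheta BmulE. Qed.

Let conjD (p q : R[i]) : p^* + q^* = (p + q)^*.
Proof. by apply: cext; rewrite !cE//; ring. Qed.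

Lemma LTheta_ATheta Theta f h : selfadjoint_relation Theta ->
  LTheta alpha beta Theta f h -> ATheta alpha beta D t Theta f h.
Proof.
move=> sT [u [v [B Tuv]]]; have [Hf Hh _] := B.
have [f1 [z0 [y0 [R1 G0 G1 e1]]]] := graph_CRep halpha hbeta B.
have [f0 D0 fE] := D_CRep R1.
have kE x : -1 < x < 1 -> h x + s * f1 x = h x + s * f0 x by move=> xI; rewrite fE.
have R0 : CRep f0 z0 y0 (fun x => h x + s * f0 x) := CRep_eq_in kE (CRep_eq fE R1).
have e01 : eqH f1 f0 by apply: aeW => x /inIP; exact: fE.
have [E0 E1 _] := Gamma_eq halpha hbeta (CRep_Dmax halpha hbeta R1) (CRep_Dmax halpha hbeta R0) e01.
have L0 : Lambda f0 = u by rewrite (CRep_Lambda halpha hbeta R0) -E0.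
have [opu mulv] := selfadjoint_relation_op sT Tuv.
split; [exact: Hf|exact: Hh|exists f0; split; [|exact: eqH_trans e1 e01|]].
  split; first exact: D0.
  rewrite L0; exists (op_apply Theta u); exact: opu.
move=> g [Dg opg]; rewrite tThetaE L0 (form_Dmax D0 R0 Dg) -E1 G1.
rewrite (_ : (fun x => _ + _) = h); last by apply/funext => x; ring.
have := op_dom_mul_orth sT opg mulv.
rewrite -scaleN1r dot2Dl mulN1r => /eqP; rewrite subr_eq0 => /eqP ->.
by rewrite subrK.
Qed.

Lemma ATheta_LTheta Theta f h : selfadjoint_relation Theta ->
  ATheta alpha beta D t Theta f h <-> LTheta alpha beta Theta f h.
Proof.
move=> sT; split; last exact: LTheta_ATheta.
move=> [Hf Hh [f0 [[D0 op0] e0 tf]]].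
apply/(LTheta_adjoint halpha hbeta _ _ sT); split => // f' h' L'.
(* The test pair also belongs to A_Theta, so both form identities can be evaluated on the
   representatives f0 and f1; they agree by the Hermitian symmetry of t and of Theta_op. *)
have [Hf' Hh' [f1 [[D1 op1] e1 tf']]] := LTheta_ATheta sT L'.
have H0 := DH D0; have H1 := DH D1.
rewrite (eqH_ipr Hf H0 Hh' e0) -(tf' f0 (conj D0 op0)).
rewrite (eqH_ip Hf' H1 Hh e1) (ipC Hh H1) -(tf f1 (conj D1 op1)).
have E := etrans (op_apply_symmetric sT op1 op0) (dot2C (Lambda f1) _).
rewrite (tThetaE Theta f1 f0) (tThetaE Theta f0 f1) (th D0 D1) [X in _ + X]E.
exact: conjD.
Qed.

End FormDomain.

Theorem theorem4p2 (R : realType) (alpha beta : R)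
    (halpha : 0 < alpha < 1) (hbeta : 0 < beta < 1)
    (a b : R) (ha : -1 < a) (hab : a < b) (hb : b < 1)
    (t : (R -> R[i]) -> (R -> R[i]) -> R[i])
    (ht : associated_form alpha beta (A0 alpha beta) (formdom alpha beta a b) t) :
  (forall Theta : set ('cV[R[i]]_2 * 'cV[R[i]]_2), selfadjoint_relation Theta ->
     selfadjoint_extension alpha beta (Lmin alpha beta)
       (ATheta alpha beta (formdom alpha beta a b) t Theta) /\
     dom (ATheta alpha beta (formdom alpha beta a b) t Theta) =
       classesH alpha beta
         [set f | Dmax alpha beta f /\
                  Theta (Gamma0 alpha beta f, Gamma1 alpha beta f)]) /\
  (forall S : (R -> R[i]) -> (R -> R[i]) -> Prop,
     selfadjoint_extension alpha beta (Lmin alpha beta) S ->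
     exists Theta : set ('cV[R[i]]_2 * 'cV[R[i]]_2),
       selfadjoint_relation Theta /\
       forall f h, S f h <-> ATheta alpha beta (formdom alpha beta a b) t Theta f h).
Proof.
have DAC f : formdom alpha beta a b f -> AC_loc f by case.
have AL Theta f h := @ATheta_LTheta R alpha beta halpha hbeta _ t DAC ht Theta f h.
split; last first.
  move=> S sS; have sB := boundary_relation_selfadjoint halpha hbeta sS.
  exists (boundary_relation alpha beta S); split => // f h.
  have [SL LS] := extension_LTheta halpha hbeta f h sS; have [A1 A2] := AL _ f h sB.
  by split => [/SL/A2|/A1/LS].
move=> Theta sT.
have -> : ATheta alpha beta (formdom alpha beta a b) t Theta = LTheta alpha beta Theta.
  by apply/funext => f; apply/funext => h; apply/propext; exact: AL.
by split; [exact: LTheta_extension|exact: dom_LTheta].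
Qed.
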